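(* Let $G$ be a planar graph and $n\geq 3$ an integer. Then (where the last four cases are read in order, each applying only if none of the cases above it applies) \[ A_n(G)= \begin{cases} \{1\} & \text{if } n=3 \text{ and } G\simeq K_4,\\ \{1,2\} & \text{if } n=3 \text{ and } G\in\mathcal{T}_m\cup\{S_5,S_7\} \text{ for some } m\geq n,\\ \{0,2\} & \text{if } G\in\mathcal{Q}_m \text{ for some } m \text{ with } 3\leq m\leq n\leq\Delta(G),\\ \emptyset & \text{if } |V(G)|<n,\\ \{0\} & \text{else if } \Delta(G)<n,\\ \{0,1,2\} & \text{else if } G \text{ contains } K_{2,n} \text{ as a subgraph},\\ \{0,1\} & \text{otherwise}. \end{cases} \]
   Context: All graphs are simple and finite. $\Delta(G)$ is the maximum vertex degree of $G$. For distinct vertices $u_1,\dots,u_n$ of $G$, $N(u_1,\dots,u_n)$ is the set of vertices of $G$ adjacent to all of $u_1,\dots,u_n$, and \[A_n(G):=\{a : \exists \text{ distinct } u_1,\dots,u_n\in V(G) \text{ with } |N(u_1,\dots,u_n)|=a\}.\] $P_m$ is the simple path on $m\ge 2$ vertices; $G_1+G_2$ denotes the join (disjoint union of $G_1$ and $G_2$ together with all edges between $V(G_1)$ and $V(G_2)$). $\mathcal{T}_m:=\{H+K_2 : H \text{ is a spanning subgraph of } P_m \text{ with no isolated vertices}\}$, $m\geq 2$ (graphs are considered up to isomorphism). For $m\geq 3$, $\mathcal{Q}_m$ is the class of planar graphs $G$ with $\Delta(G)\geq m$ for which $m$ is the minimum integer ($\geq 3$) such that for every vertex $v$ of degree at least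 $m$ there exists another vertex $w\ne v$ with $N(w)=N(v)$. $S_5$ is the graph obtained from $K_4$ with vertices $a,b,c,d$ by adding three new vertices, adjacent respectively to exactly $\{a,b,c\}$, $\{a,b,d\}$, $\{a,c,d\}$. $S_7$ is obtained from $K_4$ with vertices $a,b,c,d$ by adding four new vertices, adjacent respectively to exactly $\{a,b,c\}$, $\{a,b,d\}$, $\{a,c,d\}$, $\{b,c,d\}$. *)

(* Defs.v *)
From HB Require Import structures.
From mathcomp Require Import all_boot all_order all_algebra.
From mathcomp Require Import all_classical all_reals all_analysis.
Import numFieldNormedType.Exports.

Set Implicit Arguments.
Unset Strict Implicit.
Unset Printing Implicit Defensive.

Import Order.TTheory GRing.Theory Num.Theory.

Record sgraph (V : finType) := SGraph {
  adj :> rel V;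
  adj_sym : symmetric adj;
  adj_irr : irreflexive adj }.

Section Graphs.
Variables (V : finType) (G : sgraph V).

Definition neighbours (v : V) : {set V} := [set w | G v w]%SET.

Definition degree (v : V) : nat := #|neighbours v|.

Definition max_degree : nat := \max_(v : V) degree v.

Definition common_neighbours n (u : n.-tuple V) : {set V} :=
  [set w | [forall i, G (tnth u i) w]]%SET.

Definition common_counts (n : nat) : set nat :=
  [set a | exists2 u : n.-tuple V, uniq u & #|common_neighbours u| = a]%classic.

End Graphs.

Definition isomorphic (V W : finType) (G : sgraph V) (H : sgraph W) : Prop :=
  exists2 f : V -> W, bijective f & forall x y, H (f x) (f y) = G x y.

(* The subgraph need not be induced. *)
Definition contains (V W : finType) (G : sgraph V) (H : sgraph W) : Prop :=
  exists2 f : W -> V, injective f & forall x y, H x y -> G (f x) (f y).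

Section Planarity.
Local Open Scope ring_scope.
Local Open Scope classical_set_scope.
Variables (R : realType) (V : finType) (G : sgraph V).

(* A drawing without crossings: [pt x] is the point representing the vertex x,
   and [arc x y], restricted to [0, 1], parametrises the arc representing the
   edge xy, from [pt x] to [pt y].  As an edge is unordered, [arc y x] has to
   be [arc x y] traversed backwards. *)
Definition plane_drawing (pt : V -> R * R) (arc : V -> V -> R -> R * R) :
    Prop :=
  [/\ injective pt,
      forall x y, G x y ->
        [/\ {within `[0, 1], continuous (arc x y)},
            {in `[0, 1]%R &, injective (arc x y)},
            arc x y 0 = pt x, arc x y 1 = pt y &
            forall t, t \in `[0, 1]%R -> arc y x t = arc x y (1 - t)],
      forall x y z t, G x y -> t \in `]0, 1[%R -> arc x y t != pt z &
      forall x y x' y' s t, G x y -> G x' y' ->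
        [set x; y]%SET != [set x'; y']%SET ->
        s \in `]0, 1[%R -> t \in `]0, 1[%R -> arc x y s != arc x' y' t].

Definition planar : Prop := exists pt arc, plane_drawing pt arc.

End Planarity.

Section Constructions.

Definition complete_rel (V : finType) : rel V := fun x y => x != y.

Fact complete_sym V : symmetric (@complete_rel V).
Proof. by move=> x y; rewrite /complete_rel eq_sym. Qed.

Fact complete_irr V : irreflexive (@complete_rel V).
Proof. by move=> x; rewrite /complete_rel eqxx. Qed.

Definition complete (m : nat) : sgraph 'I_m :=
  SGraph (@complete_sym 'I_m) (@complete_irr 'I_m).

Definition path_rel m : rel 'I_m := fun i j => (i.+1 == j) || (j.+1 == i).

Fact path_sym m : symmetric (@path_rel m).
Proof. by move=> i j; rewrite /path_rel orbC. Qed.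

Fact path_irr m : irreflexive (@path_rel m).
Proof. by move=> i; rewrite /path_rel gtn_eqF. Qed.

Definition path_graph (m : nat) : sgraph 'I_m :=
  SGraph (@path_sym m) (@path_irr m).

Definition bipartite_rel (a b : nat) : rel ('I_a + 'I_b) := fun x y =>
  match x, y with
  | inl _, inr _ | inr _, inl _ => true
  | _, _ => false
  end.

Fact bipartite_sym a b : symmetric (@bipartite_rel a b).
Proof. by move=> [?|?] [?|?]. Qed.

Fact bipartite_irr a b : irreflexive (@bipartite_rel a b).
Proof. by move=> [?|?]. Qed.

Definition complete_bipartite (a b : nat) : sgraph ('I_a + 'I_b)%type :=
  SGraph (@bipartite_sym a b) (@bipartite_irr a b).

Section Join.
Variables (V W : finType) (G : sgraph V) (H : sgraph W).

Definition join_rel : rel (V + W) := fun x y =>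
  match x, y with
  | inl v, inl v' => G v v'
  | inr w, inr w' => H w w'
  | _, _ => true
  end.

Fact join_sym : symmetric join_rel.
Proof. by move=> [v|w] [v'|w'] //=; rewrite adj_sym. Qed.

Fact join_irr : irreflexive join_rel.
Proof. by move=> [v|w] /=; rewrite adj_irr. Qed.

Definition graph_join : sgraph (V + W)%type := SGraph join_sym join_irr.

End Join.

(* Add k pairwise nonadjacent new vertices to G; the i-th of them is adjacent
   exactly to the members of the i-th list in [nb]. *)
Section Attach.
Variables (V : finType) (G : sgraph V) (k : nat) (nb : k.-tuple (seq V)).

Definition attach_rel : rel (V + 'I_k) := fun x y =>
  match x, y with
  | inl v, inl v' => G v v'
  | inl v, inr i | inr i, inl v => v \in tnth nb i
  | inr _, inr _ => false
  end.

Fact attach_sym : symmetric attach_rel.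
Proof. by move=> [v|i] [v'|j] //=; rewrite adj_sym. Qed.

Fact attach_irr : irreflexive attach_rel.
Proof. by move=> [v|i] //=; rewrite adj_irr. Qed.

Definition attach : sgraph (V + 'I_k)%type := SGraph attach_sym attach_irr.

End Attach.

End Constructions.

Definition K4a : 'I_4 := @Ordinal 4 0 isT.
Definition K4b : 'I_4 := @Ordinal 4 1 isT.
Definition K4c : 'I_4 := @Ordinal 4 2 isT.
Definition K4d : 'I_4 := @Ordinal 4 3 isT.

Definition S5 : sgraph ('I_4 + 'I_3)%type :=
  attach (complete 4)
    [tuple [:: K4a; K4b; K4c]; [:: K4a; K4b; K4d]; [:: K4a; K4c; K4d]].

Definition S7 : sgraph ('I_4 + 'I_4)%type :=
  attach (complete 4)
    [tuple [:: K4a; K4b; K4c]; [:: K4a; K4b; K4d]; [:: K4a; K4c; K4d];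
           [:: K4b; K4c; K4d]].

Definition in_T (m : nat) (V : finType) (G : sgraph V) : Prop :=
  2 <= m /\
  exists H : sgraph 'I_m,
    [/\ subrel H (path_graph m), forall i, exists j, H i j &
        isomorphic G (graph_join H (complete 2))].

Definition twins_from (m : nat) (V : finType) (G : sgraph V) : Prop :=
  forall v : V, m <= degree G v ->
    exists2 w : V, w != v & neighbours G w = neighbours G v.

Definition in_Q (R : realType) (m : nat) (V : finType) (G : sgraph V) : Prop :=
  [/\ planar R G, m <= max_degree G, 3 <= m, twins_from m G &
      forall k, 3 <= k -> twins_from k G -> m <= k].

(* Main.v *)
Require Import Defs.
From HB Require Import structures.
From mathcomp Require Import all_boot all_order all_algebra.
From mathcomp Require Import all_classical all_reals all_analysis.
From mathcomp Require Import lra zify.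
From Stdlib Require Import Ring.

Set Implicit Arguments.
Unset Strict Implicit.
Unset Printing Implicit Defensive.

(** Two ingredients are combined: a self-contained proof that a graph drawn
    without crossings contains no subdivision of K_{3,3} or K_5, and a
    combinatorial study of graphs in which one of the values 0, 1 is missing
    from the set of common-neighbour counts.

    Non-planarity is proved with the van Kampen obstruction modulo 2.  Sample
    every arc finely.  For disjoint arcs f and g the differences f(s) - g(t)
    form a grid of nonzero vectors, and counting modulo 2 the crossings of a
    fixed half-line along the boundary of the grid gives 0, because it gives 0
    around each small cell ([crossing_cell], [crossing_grid]).  On the sides of
    the grid this count only involves one arc seen from an end of the other,
    whence a cocycle relation on pairs of independent edges
    ([planar_parity_cocycle]).  It telescopes along walks, so it extends to
    pairs of disjoint walks ([walk_walk_parity]).  Adding up the relations over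
    all pairs of independent edges of K_{3,3} or K_5, everything cancels except
    an odd number of ones ([no_K33_walks], [no_K5_walks]).

    As K_{3,3} is excluded, n >= 3 vertices have at most two common neighbours
    ([count_le2]), so only the presence of 0, 1 and 2 is in question.

    If 1 is absent, each n-set with a common neighbour v has exactly one other
    common neighbour.  All n-subsets of the neighbourhood of v have in fact the
    same one, which is then a twin of v ([second_superset_n], [second_twins]).
    For n >= 4 this is because two n-sets sharing n - 1 vertices cannot have
    different ones, K_{3,3} being excluded.  For n = 3 it first has to be seen
    that there is no K_4: if c, d, x, y were a clique, the graph induced on the
    common neighbourhood of c and d would have no vertex of degree 1, hence a
    cycle, and two adjacent vertices joined to a cycle are not planar
    ([second_no_K4]).  So 1 is present, as soon as some vertex has degree at
    least n, unless the graph lies in some class Q_m with m <= n.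

    If 0 is absent and there are at least n vertices, any clique of at most n
    vertices extends, so that n >= 4 would give a K_5 ([dominated_small]).  For
    n = 3, two vertices adjacent to all others force the remaining ones to
    induce a linear forest without isolated vertices, which is the class T_m
    ([dominated_T]).  When at most one vertex is adjacent to all others, a
    finite case analysis leads from a K_4 to S_5 or S_7 ([dominated_S5],
    [dominated_S7]): whenever three known vertices have no known common
    neighbour, either an old vertex plays this role or a new one is added, and
    likewise a non-neighbour is added to a vertex that would otherwise be
    adjacent to everything; non-planar configurations are discarded.  The case
    analysis is recorded as a certificate which is checked by computation
    ([certifies_sound]). *)

(** * Uniform estimates for arcs in the plane *)

Section Uniform.
Import Order.TTheory GRing.Theory Num.Theory numFieldNormedType.Exports.
Local Open Scope ring_scope.
Local Open Scope classical_set_scope.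
Variable R : realType.
Implicit Types f g : R -> R * R.

Lemma within_segment_ball f (x e : R) : {within `[0, 1], continuous f} ->
  x \in `[0, 1]%R -> 0 < e ->
  exists2 d, 0 < d & forall t, t \in `[0, 1]%R -> `|x - t| < d -> `|f x - f t| < e.
Proof.
move=> /subspace_continuousP cf xI e0.
have /cvgrPdist_lt/(_ _ e0) := cf _ xI.
rewrite near_withinE => /nbhs_ballP[d /= d0 h]; exists d => // t tI td.
exact: h.
Qed.

(** A property of pairs (e, s) that holds locally in s for all small e holds
    for one e uniformly in s, by compactness of the unit segment. *)
Lemma compact_segment_right (P : R -> R -> Prop) :
  (forall x, x \in `[0, 1]%R -> exists2 d, 0 < d &
     forall s e, s \in `[0, 1]%R -> `|x - s| < d -> 0 < e < d -> P e s) ->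
  exists2 e, 0 < e & forall s, s \in `[0, 1]%R -> P e s.
Proof.
move=> hP.
have /compact_near_coveringP/near_covering_withinP cI := @segment_compact R 0 1.
have : \forall e \near 0^'+, `[0, 1] `<=` P e.
  apply: cI => x /hP[d d0 h].
  exists (ball x d, [set e | 0 < e < d]); last first.
    by move=> [s e] /= [xs ed] sI; exact: h.
  split; first exact: nbhsx_ballx.
  near=> e; apply/andP; split; near: e; [exact: nbhs_right_gt|exact: nbhs_right_lt].
move=> h; near (0 : R)^'+ => e; exists e.
  by near: e; exact: nbhs_right_gt.
by near: e.
Unshelve. all: by end_near. Qed.

Lemma unif_segment f e : {within `[0, 1], continuous f} -> 0 < e ->
  exists2 d, 0 < d & forall s t, s \in `[0, 1]%R -> t \in `[0, 1]%R ->
    `|s - t| < d -> `|f s - f t| < e.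
Proof.
move=> cf e0.
have [|d d0 h] := @compact_segment_right
  (fun d s => forall t, t \in `[0, 1]%R -> `|s - t| < d -> `|f s - f t| < e).
  move=> x xI; have e20 : 0 < e / 2 by lra.
  have [d d0 h] := within_segment_ball cf xI e20.
  exists (d / 2) => [|s d' sI xs /andP[_ d'd] t tI st]; first lra.
  have hs : `|f x - f s| < e / 2 by apply: h => //; lra.
  have ht : `|f x - f t| < e / 2.
    apply: h => //; rewrite (_ : x - t = (x - s) + (s - t)); last by lra.
    by rewrite (le_lt_trans (ler_normD _ _))//; lra.
  rewrite (_ : f s - f t = (f x - f t) - (f x - f s)); last first.
    by rewrite opprB [RHS]addrC addrA subrK.
  by rewrite (le_lt_trans (ler_normB _ _))//; lra.
by exists d => // s t sI tI; exact: h.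
Qed.

Lemma disjoint_arcs_dist f g :
  {within `[0, 1], continuous f} -> {within `[0, 1], continuous g} ->
  (forall s t, s \in `[0, 1]%R -> t \in `[0, 1]%R -> f s != g t) ->
  exists2 e, 0 < e & forall s t, s \in `[0, 1]%R -> t \in `[0, 1]%R ->
    e <= `|f s - g t|.
Proof.
move=> cf cg fg.
have [|d d0 h] := @compact_segment_right
  (fun d s => forall t, t \in `[0, 1]%R -> d <= `|f s - g t|); last first.
  by exists d => // s t sI tI; exact: h.
move=> x xI.
have [e e0 he] : exists2 e, 0 < e & forall t, t \in `[0, 1]%R -> e <= `|f x - g t|.
  apply: compact_segment_right => y yI.
  have m0 : 0 < `|f x - g y| by rewrite normr_gt0 subr_eq0 fg.
  have m20 : 0 < `|f x - g y| / 2 by lra.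
  have [d d0 h] := within_segment_ball cg yI m20.
  exists (Num.min d (`|f x - g y| / 2)) => [|s e sI].
    by rewrite lt_min d0.
  rewrite !lt_min => /andP[ysd _] /and3P[e0 _ em].
  have hs := h _ sI ysd.
  have := ler_normD (f x - g s) (g s - g y).
  rewrite addrA subrK (distrC (g s)); lra.
have e20 : 0 < e / 2 by lra.
have [d d0 h] := within_segment_ball cf xI e20.
exists (Num.min d (e / 2)) => [|s e' sI]; first by rewrite lt_min d0.
rewrite !lt_min => /andP[xsd _] /and3P[e'0 _ e'e] t tI.
have hs := h _ sI xsd; have := he _ tI.
have := ler_normD (f x - f s) (f s - g t).
rewrite addrA subrK; lra.
Qed.

End Uniform.

(** * Crossings of a half-line by a discrete closed curve *)

Section Crossing.
Import Order.TTheory GRing.Theory Num.Theory.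
Local Open Scope ring_scope.
Variable R : realType.
Implicit Types p q r s : R * R.

(** The open lower half-plane together with the negative half of the horizontal
    axis: of two opposite nonzero vectors, exactly one belongs to it. *)
Definition lower p := (p.2 < 0) || ((p.2 == 0) && (p.1 < 0)).

(** Whether the step from p to q crosses the half-line of positive abscissae.
    Only the abscissa of p is tested; for short steps away from the origin it
    has the same sign as that of q. *)
Definition crossing p q := (lower p (+) lower q) && (0 < p.1).

Lemma norm_pair_lt p e : (`|p| < e) = (`|p.1| < e) && (`|p.2| < e).
Proof. by rewrite prod_normE gt_max. Qed.

Lemma norm_pair_ge p e : (e <= `|p|) = (e <= `|p.1|) || (e <= `|p.2|).
Proof. by rewrite prod_normE le_max. Qed.

Lemma lowerN p : p != 0 -> lower (- p) = ~~ lower p.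
Proof.
case: p => x y; rewrite /lower xpair_eqE /= !oppr_lt0 oppr_eq0.
case: (ltgtP y 0) => //= _; case: (ltgtP x 0) => //=.
Qed.

(** The norm on pairs is the maximum norm: a short step that changes sides
    stays near the horizontal axis, hence far from the vertical one. *)
Lemma lower_neq_abscissa p q e : lower p != lower q -> `|p - q| < e ->
  e <= `|p| -> e <= `|p.1|.
Proof.
move=> pq; rewrite norm_pair_lt norm_pair_ge => /andP[_ pq2] /orP[//|p2].
case: p q => [x y] [x' y'] /= in pq pq2 p2 *; exfalso; move: pq; rewrite /lower /=.
have e0 : 0 < e by exact: le_lt_trans pq2.
have [y0|y0|y0] := ltgtP y 0; have [y0'|y0'|y0'] := ltgtP y' 0 => //= _;
  move: pq2 p2; rewrite ?y0 ?y0' ?normr0; rewrite ?ltr_norml ?ler_normr; lra.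
Qed.

Lemma abscissa_sign p q e : `|p - q| < e -> e <= `|p.1| -> e <= `|q.1| ->
  (0 < p.1) = (0 < q.1).
Proof.
rewrite norm_pair_lt => /andP[+ _]; case: p q => [x y] [x' y'] /=.
rewrite ltr_norml !ler_normr => pq xe xe'; apply/idP/idP; lra.
Qed.

(** No monodromy around a cell smaller than its distance to the origin. *)
Lemma crossing_cell p q r s e :
  {in [:: p; q; r; s], forall u, e <= `|u|} ->
  {in [:: p; q; r; s] &, forall u v, `|u - v| < e} ->
  crossing p q (+) crossing q r (+) crossing s r (+) crossing p s = false.
Proof.
move=> far near.
have [/andP[/andP[/eqP pq /eqP pr] /eqP ps]|diff] :=
    boolP ((lower p == lower q) && (lower p == lower r) && (lower p == lower s)).
  by rewrite /crossing -pq -pr -ps addbb.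
have big : {in [:: p; q; r; s], forall u, e <= `|u.1|}.
  move=> u uI.
  have /hasP[v vI uv] : has (fun v => lower u != lower v) [:: p; q; r; s].
    apply: contraR diff => /hasPn same.
    have E v : v \in [:: p; q; r; s] -> lower v = lower u.
      by move/same; rewrite negbK => /eqP.
    by rewrite !E ?inE ?eqxx ?orbT.
  exact: lower_neq_abscissa uv (near _ _ uI vI) (far _ uI).
have sgn : {in [:: p; q; r; s] &, forall u v, (0 < u.1) = (0 < v.1)}.
  by move=> u v uI vI; apply: abscissa_sign (near _ _ uI vI) (big _ uI) (big _ vI).
rewrite /crossing (sgn q p) ?(sgn s p) ?inE ?eqxx ?orbT//.
by case: (0 < p.1); case: (lower p); case: (lower q); case: (lower r);
  case: (lower s).
Qed.

(** Seen from the other side, a step crosses the opposite half-line; the two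
    crossings together count the changes of side. *)
Lemma crossingN p q e : 0 < e -> e <= `|p| -> e <= `|q| -> `|p - q| < e ->
  crossing (- p) (- q) = crossing p q (+) lower p (+) lower q.
Proof.
move=> e0 ep eq pq.
have p0 : p != 0 by rewrite -normr_gt0 (lt_le_trans e0).
have q0 : q != 0 by rewrite -normr_gt0 (lt_le_trans e0).
rewrite /crossing !lowerN//.
rewrite addbN addNb negbK.
have [<-|pql] := eqVneq (lower p) (lower q); first by rewrite addbb; case: (lower p).
have px : p.1 != 0.
  by rewrite -normr_gt0 (lt_le_trans e0)// (lower_neq_abscissa pql pq ep).
rewrite oppr_gt0; case: (ltgtP p.1 0) px => // _ _.
  by rewrite andbF andbT.
by rewrite andbF andbT; move: pql; case: (lower p); case: (lower q).
Qed.

Lemma xor_telescope (f : nat -> bool) n :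
  \big[addb/false]_(i < n) (f i (+) f i.+1) = f 0%N (+) f n.
Proof.
elim: n => [|n IH]; first by rewrite big_ord0 addbb.
by rewrite big_ord_recr /= IH; case: (f 0%N); case: (f n); case: (f n.+1).
Qed.

(** A discrete form of Stokes' theorem modulo 2. *)
Lemma grid_boundary (X Y : nat -> nat -> bool) m n :
  (forall i j, i < m -> j < n ->
     X i j (+) Y i.+1 j (+) X i j.+1 (+) Y i j = false)%N ->
  \big[addb/false]_(i < m) X i 0%N (+) \big[addb/false]_(i < m) X i n (+)
  (\big[addb/false]_(j < n) Y 0%N j (+) \big[addb/false]_(j < n) Y m j) = false.
Proof.
move=> cell.
have row i : (i < m)%N ->
    X i 0%N (+) X i n = \big[addb/false]_(j < n) (Y i j (+) Y i.+1 j).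
  move=> im; rewrite -xor_telescope; apply: eq_bigr => j _.
  have := cell i j im (ltn_ord j).
  by case: (X i j); case: (X i j.+1); case: (Y i j); case: (Y i.+1 j).
rewrite -big_split /= (eq_bigr (fun i : 'I_m =>
    \big[addb/false]_(j < n) (Y i j (+) Y i.+1 j))); last first.
  by move=> i _; exact: row.
rewrite exchange_big /= -big_split /= -big_split /= big1// => j _.
by rewrite (xor_telescope (Y^~ j)) addbb.
Qed.

Lemma crossing_grid (D : nat -> nat -> R * R) m n e :
  (forall i j, (i <= m)%N -> (j <= n)%N -> e <= `|D i j|) ->
  (forall i j i' j', (i <= m)%N -> (j <= n)%N -> (i' <= m)%N -> (j' <= n)%N ->
     (i <= i'.+1)%N -> (i' <= i.+1)%N -> (j <= j'.+1)%N -> (j' <= j.+1)%N ->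
     `|D i j - D i' j'| < e) ->
  \big[addb/false]_(i < m) crossing (D i 0%N) (D i.+1 0%N) (+)
  \big[addb/false]_(i < m) crossing (D i n) (D i.+1 n) (+)
  (\big[addb/false]_(j < n) crossing (D 0%N j) (D 0%N j.+1) (+)
   \big[addb/false]_(j < n) crossing (D m j) (D m j.+1)) = false.
Proof.
move=> far near.
apply: (@grid_boundary (fun i j => crossing (D i j) (D i.+1 j))
                       (fun i j => crossing (D i j) (D i j.+1))) => i j im jn.
apply: (@crossing_cell _ _ _ _ e).
  by move=> u; rewrite !inE => /or4P[] /eqP->; apply: far; rewrite // ltnW.
have [im' jn'] := (ltnW im, ltnW jn).
by move=> u v; rewrite !inE => /or4P[] /eqP-> /or4P[] /eqP->; apply: near => //; rewrite ?leqW.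
Qed.

End Crossing.

(** * The parity cocycle of a plane drawing *)

Section Cocycle.
Import Order.TTheory GRing.Theory Num.Theory numFieldNormedType.Exports.
Local Open Scope ring_scope.
Local Open Scope classical_set_scope.
Variable R : realType.
Implicit Types (f g : R -> R * R) (p : R * R) (n : nat).

(** The parity of the number of crossings of the half-line by the arc f seen
    from the point p, sampled at n + 1 equidistant parameters. *)
Definition arc_crossings f p n : bool :=
  \big[addb/false]_(i < n) crossing (f (i%:R / n%:R) - p) (f (i.+1%:R / n%:R) - p).

Lemma sample_in n i : (i <= n)%N -> i%:R / n%:R \in (`[0, 1]%R : interval R).
Proof.
case: n => [|n]; first by rewrite leqn0 => /eqP->; rewrite mul0r in_itv /= lexx ler01.
move=> le; rewrite in_itv /= divr_ge0// ler_pdivrMr ?ltr0n// mul1r ler_nat //.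
Qed.

Lemma sample_step n i j (d : R) : (i <= j.+1)%N -> (j <= i.+1)%N ->
  n.+1%:R^-1 < d -> `|i%:R / n.+1%:R - j%:R / n.+1%:R| < d.
Proof.
move=> ij ji dn; rewrite -mulrBl normrM (@ger0_norm _ (_^-1)) ?invr_ge0//.
rewrite (le_lt_trans _ dn)// ler_piMl ?invr_ge0//.
rewrite ler_norml; move: ij ji; rewrite -!(ler_nat R) -!natr1; lra.
Qed.

(** The boundary relation for the grid of differences f(s) - g(t).  Along two
    of its sides f - g moves with f; along the others it moves with - g, which
    accounts for the terms in [lower]. *)
Lemma disjoint_arcs_crossings f g :
  {within `[0, 1], continuous f} -> {within `[0, 1], continuous g} ->
  (forall s t, s \in `[0, 1]%R -> t \in `[0, 1]%R -> f s != g t) ->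
  exists N, forall n, (N <= n)%N ->
    arc_crossings f (g 0) n.+1 (+) arc_crossings f (g 1) n.+1 (+)
    (arc_crossings g (f 0) n.+1 (+) arc_crossings g (f 1) n.+1) (+)
    (lower (f 0 - g 0) (+) lower (f 0 - g 1)) (+)
    (lower (f 1 - g 0) (+) lower (f 1 - g 1)) = false.
Proof.
move=> cf cg fg.
have [e e0 he] := disjoint_arcs_dist cf cg fg.
have e20 : 0 < e / 2 by lra.
have [d1 d10 h1] := unif_segment cf e20.
have [d2 d20 h2] := unif_segment cg e20.
(* Steps of each arc below e / 2 keep the cells of the grid smaller than e. *)
have [N hN] : exists N, forall n, (N <= n)%N -> n.+1%:R^-1 < Num.min d1 d2.
  have d0 : 0 < Num.min d1 d2 by rewrite lt_min d10.
  exists (Num.bound (Num.min d1 d2)^-1) => n Nn.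
  rewrite invf_plt ?posrE ?ltr0n//.
  apply: lt_le_trans (archi_boundP _) _; first by rewrite invr_ge0 ltW.
  by rewrite ler_nat ltnW.
exists N => n /hN; rewrite lt_min => /andP[nd1 nd2].
pose D i j : R * R := f (i%:R / n.+1%:R) - g (j%:R / n.+1%:R).
have far i j : (i <= n.+1)%N -> (j <= n.+1)%N -> e <= `|D i j|.
  by move=> im jm; apply: he; exact: sample_in.
have near i j i' j' : (i <= n.+1)%N -> (j <= n.+1)%N -> (i' <= n.+1)%N -> (j' <= n.+1)%N ->
     (i <= i'.+1)%N -> (i' <= i.+1)%N -> (j <= j'.+1)%N -> (j' <= j.+1)%N ->
     `|D i j - D i' j'| < e.
  move=> im jm im' jm' ii' i'i jj' j'j.
  have Hf := h1 _ _ (sample_in im) (sample_in im') (sample_step ii' i'i nd1).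
  have Hg := h2 _ _ (sample_in jm) (sample_in jm') (sample_step jj' j'j nd2).
  have -> : D i j - D i' j' = (f (i%:R / n.+1%:R) - f (i'%:R / n.+1%:R)) -
                              (g (j%:R / n.+1%:R) - g (j'%:R / n.+1%:R)).
    by rewrite /D !opprB addrACA [RHS]addrACA [in RHS](addrC (- _)).
  rewrite (le_lt_trans (ler_normB _ _))//; lra.
have := crossing_grid far near.
have E0 : 0%:R / n.+1%:R = 0 :> R by rewrite mul0r.
have E1 : n.+1%:R / n.+1%:R = 1 :> R by rewrite divff// pnatr_eq0.
have Yside i : (i <= n.+1)%N ->
    \big[addb/false]_(j < n.+1) crossing (D i j) (D i j.+1) =
    arc_crossings g (f (i%:R / n.+1%:R)) n.+1 (+)
    (lower (D i 0%N) (+) lower (D i n.+1)).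
  move=> im; rewrite -(xor_telescope (fun j => lower (D i j))) -big_split /=.
  apply: eq_bigr => j _.
  have jm : (j <= n.+1)%N by rewrite ltnW.
  have Dn k : g (k%:R / n.+1%:R) - f (i%:R / n.+1%:R) = - D i k by rewrite opprB.
  rewrite !Dn (@crossingN _ _ _ e) ?far//; last by apply: near => //; rewrite leqW.
  by case: (crossing _ _); case: (lower _); case: (lower _).
rewrite !Yside// -/(arc_crossings _ _ _) /D !E0 !E1 /arc_crossings.
move: (\big[_/_]_(i < _) _) (\big[_/_]_(i < _) _)  (\big[_/_]_(i < _) _) (\big[_/_]_(i < _) _).
move: (lower _) (lower _) (lower _) (lower _).
by do 8!case.
Qed.

Lemma plane_drawing_disjoint (V : finType) (G : sgraph V) (pt : V -> R * R)
    (arc : V -> V -> R -> R * R) x y x' y' s t :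
  plane_drawing G pt arc -> G x y -> G x' y' ->
  [/\ x != x', x != y', y != x' & y != y'] ->
  s \in `[0, 1]%R -> t \in `[0, 1]%R -> arc x y s != arc x' y' t.
Proof.
move=> [inj ends avoid cross] xy xy' [xx' xy'n yx' yy'].
have [_ _ a0 a1 _] := ends _ _ xy.
have [_ _ a0' a1' _] := ends _ _ xy'.
have cases u : u \in `[0, 1]%R -> [\/ u = 0, u = 1 | u \in `]0, 1[%R].
  rewrite !in_itv /= !le_eqVlt => /andP[/orP[/eqP<-|->] /orP[/eqP->|->]];
  by [apply: Or31|apply: Or32|apply: Or33].
have neq u v : u != v -> pt u != pt v by apply: contra_neq; exact: inj.
move=> /cases[->|->|sI] /cases[->|->|tI]; rewrite ?a0 ?a1 ?a0' ?a1' ?neq//.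
- by rewrite eq_sym avoid.
- by rewrite eq_sym avoid.
- by rewrite avoid.
- by rewrite avoid.
apply: cross => //; apply/eqP => /setP/(_ x).
by rewrite !inE eqxx (negPf xx') (negPf xy'n).
Qed.

End Cocycle.

Section Obstruction.
Import GRing.Theory.
Variables (V : finType) (G : sgraph V).

(** Abstract form of the parities attached to a drawing: [L x y] tells on which
    side of y the vertex x lies, and [K v x y] is the crossing parity of the
    edge xy seen from the vertex v.  The last clause is the relation satisfied
    by two edges without common end. *)
Definition parity_cocycle (L : rel V) (K : V -> V -> V -> bool) : Prop :=
  [/\ forall x y, x != y -> L y x = ~~ L x y,
      forall v x y, K v y x = K v x y &
      forall x y x' y', G x y -> G x' y' ->
        [/\ x != x', x != y', y != x' & y != y'] ->
        K x' x y (+) K y' x y (+) (K x x' y' (+) K y x' y') (+)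
        (L x x' (+) L x y') (+) (L y x' (+) L y y') = false].

Lemma planar_parity_cocycle (R : realType) : planar R G ->
  exists L K, parity_cocycle L K.
Proof.
move=> [pt [arc dr]].
pose L x y := lower (pt x - pt y)%R.
have [inj ends _ _] := dr.
have hN (q : V * V * V * V) : exists N, forall n, N <= n ->
    let: (x, y, x', y') := q in G x y -> G x' y' ->
    [/\ x != x', x != y', y != x' & y != y'] ->
    arc_crossings (arc x y) (pt x') n.+1 (+) arc_crossings (arc x y) (pt y') n.+1
    (+) (arc_crossings (arc x' y') (pt x) n.+1 (+)
         arc_crossings (arc x' y') (pt y) n.+1) (+)
    (L x x' (+) L x y') (+) (L y x' (+) L y y') = false.
  case: q => [[[x y] x'] y'].
  have [xy|] := boolP (G x y); last by exists 0.
  have [xy'|] := boolP (G x' y'); last by exists 0.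
  have [/and4P neqs|neqs] := boolP [&& x != x', x != y', y != x' & y != y'];
    last by exists 0 => n _ _ _ /and4P; rewrite (negPf neqs).
  have [ca _ a0 a1 _] := ends _ _ xy.
  have [ca' _ a0' a1' _] := ends _ _ xy'.
  have [|N h] := disjoint_arcs_crossings ca ca'.
    by move=> s t; exact: (plane_drawing_disjoint dr).
  by exists N => n /h; rewrite /L a0 a1 a0' a1'.
(* One sampling is fine enough for all the finitely many pairs of edges. *)
have {}hN : exists n, forall q : V * V * V * V,
    let: (x, y, x', y') := q in G x y -> G x' y' ->
    [/\ x != x', x != y', y != x' & y != y'] ->
    arc_crossings (arc x y) (pt x') n.+1 (+) arc_crossings (arc x y) (pt y') n.+1
    (+) (arc_crossings (arc x' y') (pt x) n.+1 (+)
         arc_crossings (arc x' y') (pt y) n.+1) (+)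
    (L x x' (+) L x y') (+) (L y x' (+) L y y') = false.
  have [N hb] := choice hN.
  by exists (\max_q N q) => q; apply: hb; exact: leq_bigmax.
case: hN => n hn.
(* The crossing parity of an edge is computed along a fixed orientation. *)
pose K v x y := if enum_rank x < enum_rank y
  then arc_crossings (arc x y) (pt v) n.+1
  else arc_crossings (arc y x) (pt v) n.+1.
exists L, K; split.
- move=> x y xy; rewrite /L -opprB lowerN//.
  by rewrite subr_eq0; apply: contra_neq xy => /inj.
- by move=> v x y; rewrite /K; case: ltngtP => // /val_inj/enum_rank_inj->.
move=> x y x' y' xy xy' [n1 n2 n3 n4].
have yx : G y x by rewrite adj_sym.
have yx' : G y' x' by rewrite adj_sym.
have := And4 n1 n2 n3 n4; have := And4 n2 n1 n4 n3.
have := And4 n3 n4 n1 n2; have := And4 n4 n3 n2 n1.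
move=> /(hn (y, x, y', x') yx yx')/= h1 /(hn (y, x, x', y') yx xy')/= h2.
move=> /(hn (x, y, y', x') xy yx')/= h3 /(hn (x, y, x', y') xy xy')/= h4.
rewrite /K; case: ifP => _; case: ifP => _;
  [rewrite -h4|rewrite -h3|rewrite -h2|rewrite -h1]; clear;
  move: (arc_crossings _ _ _) (arc_crossings _ _ _) (arc_crossings _ _ _)
    (arc_crossings _ _ _) (L _ _) (L _ _) (L _ _) (L _ _); by do 8!case.
Qed.
End Obstruction.

(** * Subdivisions of K_{3,3} and K_5 *)

(** Identities modulo 2 are left to [ring] on booleans, which is stated with
    [xorb]. *)
Lemma addb_xorb a b : a (+) b = xorb a b. Proof. by case: a; case: b. Qed.

Section Walks.
Variables (V : finType) (G : sgraph V) (L : rel V) (K : V -> V -> V -> bool).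
Hypothesis cocycle : parity_cocycle G L K.

(** The crossing parity, seen from v, of the walk that starts at x and then
    visits p. *)
Fixpoint walk_parity v x (p : seq V) : bool :=
  if p is y :: p' then K v x y (+) walk_parity v y p' else false.

Lemma edge_walk_parity x x' y q : G x x' -> path G y q ->
  x \notin y :: q -> x' \notin y :: q ->
  K y x x' (+) K (last y q) x x' (+) (walk_parity x y q (+) walk_parity x' y q) (+)
  (L x y (+) L x (last y q)) (+) (L x' y (+) L x' (last y q)) = false.
Proof.
move=> xx'; elim: q y => [|z q IH] y; first by move=> *; rewrite /= !addbb.
move=> /andP[yz zq].
rewrite 2!(in_cons y) 2!negb_or => /andP[xy xq] /andP[x'y x'q].
have [_ _ /(_ x x' y z xx' yz)] := cocycle.
move: xq x'q (IH z zq xq x'q) xy x'y; rewrite 2!in_cons 2!negb_or.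
move=> /andP[xz _] /andP[x'z _] /= + xy x'y => + /(_ (And4 xy xz x'y x'z)).
move=> h1 h2; have E := congr2 addb h1 h2.
by rewrite -[RHS]E !addb_xorb; ring.
Qed.

(** The cocycle relation extends from independent edges to disjoint walks:
    summing over the edges of both walks, inner vertices cancel. *)
Lemma walk_walk_parity x p y q : path G x p -> path G y q ->
  ~~ has (mem (x :: p)) (y :: q) ->
  walk_parity y x p (+) walk_parity (last y q) x p (+)
  (walk_parity x y q (+) walk_parity (last x p) y q) (+)
  (L x y (+) L x (last y q)) (+) (L (last x p) y (+) L (last x p) (last y q)) = false.
Proof.
move=> + yq; rewrite has_sym; elim: p x => [|z p IH] x; first by move=> *; rewrite /= !addbb.
move=> /andP[xz zp]; rewrite [has _ _]/= negb_or => /andP[xq dis].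
have zq : z \notin y :: q by move: dis; rewrite /= negb_or => /andP[].
have := edge_walk_parity xz yq xq zq; have := IH z zp dis; rewrite /=.
move=> h1 h2; have E := congr2 addb h1 h2.
by rewrite -[RHS]E !addb_xorb; ring.
Qed.

End Walks.

(** Parities on K_{3,3} with sides indexed by i, i' and j, j'.  In the sum over
    the eighteen pairs of independent edges every [ka], [kb], [laa], [lab] and
    [lba] occurs an even number of times, whereas each unordered pair {j, j'}
    contributes three times [lbb j j' (+) lbb j' j = true]. *)
Lemma K33_parity (ka kb : nat -> nat -> nat -> bool) (laa lab lba lbb : nat -> nat -> bool) :
  (forall i j i' j', i < i' < 3 -> j < 3 -> j' < 3 -> j != j' ->
    ka i' i j (+) kb j' i j (+) (ka i i' j' (+) kb j i' j') (+)
    (laa i i' (+) lab i j') (+) (lba j i' (+) lbb j j') = false) ->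
  (forall j j', j < j' < 3 -> lbb j' j = ~~ lbb j j') -> False.
Proof.
move=> h anti.
have b1 := anti 0 1 isT; have b2 := anti 0 2 isT; have b3 := anti 1 2 isT.
have pairs : \big[addb/false]_(i <- [:: (0, 1); (0, 2); (1, 2)])
   \big[addb/false]_(j <- [:: (0, 1); (0, 2); (1, 0); (1, 2); (2, 0); (2, 1)])
   (let: (i, i', (j, j')) := (i, j) in
    ka i' i j (+) kb j' i j (+) (ka i i' j' (+) kb j i' j') (+)
    (laa i i' (+) lab i j') (+) (lba j i' (+) lbb j j')) = false.
  by rewrite !big_cons !big_nil !h.
suff : false = true by [].
rewrite -pairs !big_cons !big_nil b1 b2 b3 -!addTb !addb_xorb; ring.
Qed.

(** The same for the fifteen pairs of independent edges of K_5. *)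
Lemma K5_parity (k : nat -> nat -> nat -> bool) (l : nat -> nat -> bool) :
  (forall i j i' j', i < j < 5 -> i < i' -> i' < j' < 5 -> j != i' -> j != j' ->
    k i' i j (+) k j' i j (+) (k i i' j' (+) k j i' j') (+)
    (l i i' (+) l i j') (+) (l j i' (+) l j j') = false) ->
  (forall i j, i < j < 5 -> l j i = ~~ l i j) -> False.
Proof.
move=> h anti.
have pairs : \big[addb/false]_(e <- [::
     (0, 1, (2, 3)); (0, 1, (2, 4)); (0, 1, (3, 4)); (0, 2, (1, 3)); (0, 2, (1, 4));
     (0, 2, (3, 4)); (0, 3, (1, 2)); (0, 3, (1, 4)); (0, 3, (2, 4)); (0, 4, (1, 2));
     (0, 4, (1, 3)); (0, 4, (2, 3)); (1, 2, (3, 4)); (1, 3, (2, 4)); (1, 4, (2, 3))])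
   (let: (i, j, (i', j')) := e in
    k i' i j (+) k j' i j (+) (k i i' j' (+) k j i' j') (+)
    (l i i' (+) l i j') (+) (l j i' (+) l j j')) = false.
  by rewrite !big_cons !big_nil !h.
suff : false = true by [].
rewrite -pairs !big_cons !big_nil (anti 1 2)// (anti 1 3)// (anti 1 4)// (anti 2 3)//
  (anti 2 4)// (anti 3 4)// -!addTb !addb_xorb; ring.
Qed.

(** The walk x :: p leads from x to y. *)
Definition joins (V : finType) (G : sgraph V) x p y := path G x p && (last x p == y).

Section Kuratowski.
Variables (R : realType) (V : finType) (G : sgraph V).
Hypothesis Gplanar : planar R G.

(** Walks need only be disjoint when they stand for independent edges of
    K_{3,3}; walks with a common end may meet or cross. *)
Lemma no_K33_walks (a b : nat -> V) (P : nat -> nat -> seq V) :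
  (forall i j, i < 3 -> j < 3 -> joins G (a i) (P i j) (b j)) ->
  (forall i j i' j', i < i' < 3 -> j < 3 -> j' < 3 -> j != j' ->
     ~~ has (mem (a i :: P i j)) (a i' :: P i' j')) -> False.
Proof.
move=> walks dis.
have [L [K co]] := planar_parity_cocycle Gplanar.
have eq i j i' j' : i < i' < 3 -> j < 3 -> j' < 3 -> j != j' ->
    walk_parity K (a i') (a i) (P i j) (+) walk_parity K (b j') (a i) (P i j) (+)
    (walk_parity K (a i) (a i') (P i' j') (+) walk_parity K (b j) (a i') (P i' j'))
    (+) (L (a i) (a i') (+) L (a i) (b j')) (+) (L (b j) (a i') (+) L (b j) (b j'))
     = false.
  move=> /andP[ii' i'3] j3 j'3 jj'; have i3 := ltn_trans ii' i'3.
  have /andP[p1 /eqP l1] := walks i j i3 j3.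
  have /andP[p2 /eqP l2] := walks i' j' i'3 j'3.
  have := walk_walk_parity co p1 p2 (dis i j i' j' _ j3 j'3 jj').
  by rewrite l1 l2 ii' i'3; apply.
apply: (K33_parity eq) => j j' /andP[jj' j'3].
have [anti _ _] := co; apply: anti; have j3 := ltn_trans jj' j'3.
have /andP[_ /eqP l1] := walks 0 j isT j3.
have /andP[_ /eqP l2] := walks 1 j' isT j'3.
apply: contraNneq (dis 0 j 1 j' isT j3 j'3 (negbT (ltn_eqF jj'))) => bb.
apply/hasP; exists (b j).
  by rewrite bb -l2 mem_last.
by have := mem_last (a 0) (P 0 j); rewrite l1.
Qed.

Lemma no_K5_walks (a : nat -> V) (P : nat -> nat -> seq V) :
  (forall i j, i < j < 5 -> a i != a j) ->
  (forall i j, i < j < 5 -> joins G (a i) (P i j) (a j)) ->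
  (forall i j i' j', i < j < 5 -> i < i' -> i' < j' < 5 -> j != i' -> j != j' ->
     ~~ has (mem (a i :: P i j)) (a i' :: P i' j')) -> False.
Proof.
move=> inj walks dis.
have [L [K co]] := planar_parity_cocycle Gplanar.
apply: (@K5_parity (fun r i j => walk_parity K (a r) (a i) (P i j))
                   (fun i j => L (a i) (a j))).
  move=> i j i' j' ij ii' ij' ji' jj'.
  have /andP[p1 /eqP l1] := walks i j ij.
  have /andP[p2 /eqP l2] := walks i' j' ij'.
  have := walk_walk_parity co p1 p2 (dis i j i' j' ij ii' ij' ji' jj').
  by rewrite l1 l2; apply.
move=> i j /andP[ij j5]; have [anti _ _] := co; apply: anti.
by apply: inj; rewrite ij.
Qed.
End Kuratowski.

(** * Certificates for finite case analyses *)

(** Adjacency in the graph on natural numbers with the edge list E. *)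
Definition linked (E : seq (nat * nat)) : rel nat :=
  fun i j => ((i, j) \in E) || ((j, i) \in E).

(** A witness of non-planarity: the branch vertices of a subdivision of K_{3,3}
    (by sides) or of K_5, and the list of those paths, ends included, that have
    more than one edge. *)
Inductive kuratowski :=
  | K33 of seq nat & seq nat & seq (seq nat)
  | K5 of seq nat & seq (seq nat).

(** The walk from x to y, without x: read off the list ps, or a single edge. *)
Definition route (ps : seq (seq nat)) x y : seq nat :=
  if [seq p <- ps | (head 0 p == x) && (last 0 p == y)] is p :: _
  then behead p else [:: y].

Section Check.
Variables (k : nat) (E : seq (nat * nat)).

Definition route_ok x p y :=
  [&& path (linked E) x p, last x p == y & all (gtn k) (x :: p)].

Definition check_K33 (a b : seq nat) ps :=
  let W i j := route ps (nth 0 a i) (nth 0 b j) in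
  all (fun i => all (fun j => route_ok (nth 0 a i) (W i j) (nth 0 b j) &&
    all (fun i' => all (fun j' => (i < i') && (j != j') ==>
      ~~ has (mem (nth 0 a i :: W i j)) (nth 0 a i' :: W i' j'))
    (iota 0 3)) (iota 0 3)) (iota 0 3)) (iota 0 3).

Definition check_K5 (a : seq nat) ps :=
  let W i j := route ps (nth 0 a i) (nth 0 a j) in
  uniq a && all (fun i => all (fun j => (i < j) ==>
    (route_ok (nth 0 a i) (W i j) (nth 0 a j) &&
    all (fun i' => all (fun j' => [&& i < i', i' < j', j != i' & j != j'] ==>
      ~~ has (mem (nth 0 a i :: W i j)) (nth 0 a i' :: W i' j'))
    (iota 0 5)) (iota 0 5))) (iota 0 5)) (iota 0 5).

Definition check_kuratowski w :=
  match w with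
  | K33 a b ps => check_K33 a b ps
  | K5 a ps => (size a == 5) && check_K5 a ps
  end.

End Check.

(** A partial description of a graph consists of the number k of known vertices,
    a list E of edges and a list N of non-edges between them.  A certificate is
    a case analysis on such a description:
    - [Hit m]: the sought pattern is found on the vertices m;
    - [Kur w]: the description is not planar, by the witness w;
    - [Edge i j c1 c2]: according to whether i and j are adjacent or not;
    - [New x y z c]: no old vertex can be a common neighbour of x, y and z, so
      the vertex k is one;
    - [Far x c]: x is adjacent to all old vertices, so the vertex k is not
      adjacent to x. *)
Inductive cert :=
  | Hit of seq nat
  | Kur of kuratowski
  | Edge of nat & nat & cert & cert
  | New of nat & nat & nat & cert
  | Far of nat & cert.

(** Validity of the certificate c for the description (k, E, N) and the pattern
    with pk vertices and edges pE.  The first nu vertices are the vertices of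
    the graph that are adjacent to all others: each new vertex is joined to
    them, and they keep their labels in the pattern. *)
Fixpoint certifies (nu pk : nat) (pE : seq (nat * nat)) (c : cert) (k : nat)
    (E N : seq (nat * nat)) : bool :=
  let E' := [seq (u, k) | u <- iota 0 nu] ++ E in
  match c with
  | Hit m => [&& size m == pk, uniq m, all (gtn k) m, take nu m == iota 0 nu &
      all (fun e => linked E (nth 0 m e.1) (nth 0 m e.2)) pE]
  | Kur w => check_kuratowski k E w
  | Edge i j c1 c2 => [&& i < k, j < k,
      certifies nu pk pE c1 k ((i, j) :: E) N & certifies nu pk pE c2 k E ((i, j) :: N)]
  | New x y z c => [&& all (gtn k) [:: x; y; z], uniq [:: x; y; z],
      all (fun w => has (fun v => (w == v) || linked N w v) [:: x; y; z]) (iota 0 k) &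
      certifies nu pk pE c k.+1 [:: (x, k), (y, k), (z, k) & E'] N]
  | Far x c => [&& nu <= x < k,
      all (fun w => (w == x) || linked E w x) (iota 0 k) &
      certifies nu pk pE c k.+1 E' ((x, k) :: N)]
  end.

Section Soundness.
Variables (R : realType) (V : finType) (G : sgraph V).
Hypothesis Gplanar : planar R G.

(** The first k values of f are distinct and satisfy the description (k, E, N). *)
Definition realizes (f : nat -> V) k (E N : seq (nat * nat)) :=
  [/\ {in gtn k &, injective f}, {in E, forall e, G (f e.1) (f e.2)} &
      {in N, forall e, ~~ G (f e.1) (f e.2)}].

Lemma realizes_linked f k E N i j : realizes f k E N -> linked E i j -> G (f i) (f j).
Proof.
by move=> [_ fE _]; rewrite /linked => /orP[/fE|/fE] //=; rewrite adj_sym.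
Qed.

Lemma realizes_unlinked f k E N i j : realizes f k E N -> linked N i j -> ~~ G (f i) (f j).
Proof.
by move=> [_ _ fN]; rewrite /linked => /orP[/fN|/fN] //=; rewrite adj_sym.
Qed.

Lemma has_map_inj (f : nat -> V) k s t :
  {in gtn k &, injective f} -> all (gtn k) s -> all (gtn k) t ->
  has (mem [seq f i | i <- s]) [seq f i | i <- t] -> has (mem s) t.
Proof.
move=> inj /allP sk /allP tk /hasP[_ /mapP[i it ->] /mapP[j js fij]].
by apply/hasP; exists i => //; rewrite (inj i j (tk i it) (sk j js) fij).
Qed.

Lemma realizes_route f k E N x p y : realizes f k E N -> route_ok k E x p y ->
  joins G (f x) [seq f i | i <- p] (f y).
Proof.
move=> rf /and3P[xp /eqP<- _]; rewrite /joins last_map eqxx andbT path_map.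
by apply: sub_path xp => i j; exact: realizes_linked rf.
Qed.

Lemma check_kuratowski_sound f k E N w : realizes f k E N ->
  check_kuratowski k E w -> False.
Proof.
move=> rf; have [inj _ _] := rf; case: w => [a b ps|a ps] /=.
  move=> /allP chk.
  pose W i j := route ps (nth 0 a i) (nth 0 b j).
  have ok i j : i < 3 -> j < 3 -> route_ok k E (nth 0 a i) (W i j) (nth 0 b j).
    move=> i3 j3; have := chk i; rewrite mem_iota => /(_ i3)/allP/(_ j).
    by rewrite mem_iota => /(_ j3)/andP[].
  apply: (@no_K33_walks _ _ _ Gplanar (fun i => f (nth 0 a i))
    (fun j => f (nth 0 b j)) (fun i j => [seq f v | v <- W i j])).
    by move=> i j i3 j3; apply: realizes_route rf _; exact: ok.
  move=> i j i' j' /andP[ii' i'3] j3 j'3 jj'; have i3 := ltn_trans ii' i'3.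
  have /and3P[_ _ k1] := ok i j i3 j3; have /and3P[_ _ k2] := ok i' j' i'3 j'3.
  apply/negP => /(has_map_inj inj k1 k2); apply/negP.
  have := chk i; rewrite mem_iota => /(_ i3)/allP/(_ j).
  rewrite mem_iota => /(_ j3)/andP[_] /allP/(_ i'); rewrite mem_iota => /(_ i'3)/allP/(_ j').
  by rewrite mem_iota ii' jj'; apply.
move=> /and3P[/eqP a5 au /allP chk].
pose W i j := route ps (nth 0 a i) (nth 0 a j).
have ok i j : i < j < 5 -> route_ok k E (nth 0 a i) (W i j) (nth 0 a j).
  move=> /andP[ij j5]; have i5 := ltn_trans ij j5.
  have := chk i; rewrite mem_iota => /(_ i5)/allP/(_ j).
  by rewrite mem_iota ij => /(_ j5)/andP[].
apply: (@no_K5_walks _ _ _ Gplanar (fun i => f (nth 0 a i))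
    (fun i j => [seq f v | v <- W i j])).
- move=> i j ij; have /and3P[_ /eqP lj] := ok _ _ ij; rewrite /= => /andP[ik /allP Wk].
  have jk : nth 0 a j < k.
    by rewrite -lj; have := mem_last (nth 0 a i) (W i j);
       rewrite in_cons => /predU1P[->//|/Wk].
  have /andP[ij' j5] := ij.
  apply/eqP => /inj; rewrite ?inE ik jk => /(_ isT isT)/eqP.
  by rewrite nth_uniq ?a5 ?(ltn_trans ij')// (ltn_eqF ij').
- by move=> i j ij; apply: realizes_route rf _; exact: ok.
move=> i j i' j' ij ii' ij' ji' jj'.
have /and3P[_ _ k1] := ok i j ij; have /and3P[_ _ k2] := ok i' j' ij'.
apply/negP => /(has_map_inj inj k1 k2); apply/negP.
have [/andP[ij1 j5] /andP[ij1' j5']] := (ij, ij').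
have := chk i; rewrite mem_iota => /(_ (ltn_trans ij1 j5))/allP/(_ j).
rewrite mem_iota ij1 => /(_ j5)/andP[_] /allP/(_ i').
rewrite mem_iota (ltn_trans ij1' j5') => /(_ isT).
by move=> /allP/(_ j'); rewrite mem_iota ii' ij1' ji' jj' j5'; apply.
Qed.

Hypothesis dominated : forall x y z : V, uniq [:: x; y; z] ->
  exists w, [/\ G x w, G y w & G z w].
Variable us : seq V.
Hypothesis us_universal : forall u x, u \in us -> x != u -> G u x.
Hypothesis others_not : forall x, x \notin us -> exists2 y, y != x & ~~ G x y.

(** The labelling f, with the vertex v labelled k. *)
Definition extend (f : nat -> V) k v i := if i == k then v else f i.

(** All pairs of the list have their entries among the first k labels. *)
Definition below k (E : seq (nat * nat)) := all (fun e => (e.1 < k) && (e.2 < k)) E.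

Lemma below_widen k E : below k E -> below k.+1 E.
Proof.
by apply: sub_all => e /andP[e1 e2]; rewrite !ltnS (ltnW e1) (ltnW e2).
Qed.

Lemma realizes_extend f k E N v E1 N1 : realizes f k E N -> below k E -> below k N ->
  {in gtn k, forall i, f i != v} ->
  {in E1, forall e, [/\ e.1 < k, e.2 = k & G (f e.1) v]} ->
  {in N1, forall e, [/\ e.1 < k, e.2 = k & ~~ G (f e.1) v]} ->
  realizes (extend f k v) k.+1 (E1 ++ E) (N1 ++ N).
Proof.
move=> [inj fE fN] /allP Ek /allP Nk fv fE1 fN1.
have old i : i < k -> extend f k v i = f i by move=> ik; rewrite /extend ltn_eqF.
have new : extend f k v k = v by rewrite /extend eqxx.
split.
- move=> i j; rewrite !inE !ltnS (leq_eqVlt i) (leq_eqVlt j).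
  move=> /predU1P[->|ik] /predU1P[->|jk]; rewrite ?new ?old //.
  + by move=> /eqP; rewrite eq_sym (negPf (fv _ _)).
  + by move=> /eqP; rewrite (negPf (fv _ _)).
  + exact: inj.
- move=> e; rewrite mem_cat => /orP[/fE1[e1 -> ge]|eE].
    by rewrite new old.
  by have /andP[e1 e2] := Ek _ eE; rewrite !old// fE.
- move=> e; rewrite mem_cat => /orP[/fN1[e1 -> ge]|eN].
    by rewrite new old.
  by have /andP[e1 e2] := Nk _ eN; rewrite !old// fN.
Qed.

Lemma below_universal k E n : below k E -> n <= k ->
  below k.+1 ([seq (u, k) | u <- iota 0 n] ++ E).
Proof.
move=> Ek nk; rewrite /below all_cat -/(below _ E) below_widen// andbT.
apply/allP => e /mapP[u]; rewrite mem_iota => /= un ->.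
by rewrite leqnn andbT ltnS (leq_trans (ltnW un)).
Qed.

Lemma extend_universal k f v : size us <= k ->
  (forall i, i < size us -> f i \in us) ->
  (forall u, u \in us -> exists2 i, i < size us & f i = u) ->
  (forall i, i < size us -> extend f k v i \in us) /\
  (forall u, u \in us -> exists2 i, i < size us & extend f k v i = u).
Proof.
move=> uk fu uf; have old i : i < size us -> extend f k v i = f i.
  by move=> iu; rewrite /extend ltn_eqF// (leq_trans iu).
by split=> [i iu|u /uf[i iu fi]]; [rewrite old ?fu|exists i; rewrite ?old].
Qed.

(** In a planar graph where three vertices always have a common neighbour, and
    where us lists exactly the vertices adjacent to all others, a valid
    certificate yields the pattern. *)
Lemma certifies_sound pk pE c k E N f :
  (forall i, i < size us -> f i \in us) ->
  (forall u, u \in us -> exists2 i, i < size us & f i = u) -> size us <= k ->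
  below k E -> below k N ->
  realizes f k E N -> certifies (size us) pk pE c k E N ->
  exists g, [/\ realizes g pk pE [::], forall i, i < size us -> g i \in us &
    forall u, u \in us -> exists2 i, i < size us & g i = u].
Proof.
elim: c k E N f => [m|w|i j c1 IH1 c2 IH2|x y z c IH|x c IH] k E N f fu uf uk Ek Nk rf /=.
- move=> /and5P[/eqP mk mu /allP mlt /eqP mu0 /allP mE].
  have [inj _ _] := rf.
  have m0 i : i < size us -> nth 0 m i = i.
    by move=> iu; rewrite -(nth_take 0 iu) mu0 nth_iota.
  exists (fun i => f (nth 0 m i)); split; last 2 first.
  - by move=> i iu; rewrite m0// fu.
  - by move=> u /uf[i iu <-]; exists i; rewrite ?m0.
  split=> [i j|e /mE|//].
    rewrite -mk !inE => im jm.
    move=> /(inj _ _ (mlt _ (mem_nth 0 im)) (mlt _ (mem_nth 0 jm)))/eqP.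
    by rewrite nth_uniq// => /eqP.
  exact: realizes_linked rf.
- by move=> /(check_kuratowski_sound rf).
- move=> /and4P[ik jk chk1 chk2]; have [inj fE fN] := rf.
  have [fij|fij] := boolP (G (f i) (f j)).
    apply: (IH1 _ _ _ f) chk1 => //; first by rewrite /below /= ik jk.
    split=> // e.
    by rewrite in_cons => /predU1P[->//|/fE].
  apply: (IH2 _ _ _ f) chk2 => //; first by rewrite /below /= ik jk.
  split=> // e.
  by rewrite in_cons => /predU1P[->//|/fN].
- move=> /and4P[/and4P[xk yk zk _] xyz /allP blocked chk].
  have [inj fE fN] := rf.
  have [|v [xv yv zv]] := @dominated (f x) (f y) (f z).
    move: xyz; rewrite /= !inE !negb_or !andbT => /andP[/andP[xy xz] yz].
    by rewrite -andbA; apply/and3P; split; [move: xy|move: xz|move: yz];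
       apply: contra_neq => /inj; apply.
  have fv : {in gtn k, forall i, f i != v}.
    move=> i ik; apply/eqP => fi; subst v.
    have /hasP[q] : has (fun q => (i == q) || linked N i q) [:: x; y; z].
      by apply: blocked; rewrite mem_iota.
    have qv : q \in [:: x; y; z] -> G (f i) (f q).
      by rewrite adj_sym !inE => /or3P[] /eqP->.
    move=> /qv iq /orP[/eqP iE|/(realizes_unlinked rf)]; last by rewrite iq.
    by move: iq; rewrite iE adj_irr.
  have [fu' uf'] := extend_universal v uk fu uf.
  apply: (IH _ _ _ (extend f k v)) chk => //; first exact: leqW.
  - rewrite /below /= !ltnS leqnn (ltnW xk) (ltnW yk) (ltnW zk) /= -/(below _ _).
    exact: below_universal.
  - exact: below_widen.
  rewrite -!cat_cons -[N]cat0s; apply: realizes_extend => // e.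
  rewrite !in_cons => /or4P[/eqP->|/eqP->|/eqP->|/mapP[u]] //.
  rewrite mem_iota => /= us_u ->; split=> //; first exact: leq_trans us_u uk.
  by apply: us_universal (fu _ us_u) _; rewrite eq_sym fv// inE (leq_trans us_u).
move=> /and3P[/andP[nux xk] /allP near chk]; have [inj fE fN] := rf.
have fx : f x \notin us.
  apply/negP => /uf[i iu] /(inj _ _ (leq_trans iu uk) xk) ix.
  by rewrite -ix leqNgt iu in nux.
have [v vx nv] := others_not fx.
have fv : {in gtn k, forall i, f i != v}.
  move=> i ik; apply/eqP => fi; subst v.
  have /orP[/eqP ix|/(realizes_linked rf)] : (i == x) || linked E i x.
  - by apply: near; rewrite mem_iota.
    by rewrite ix eqxx in vx.
  by rewrite adj_sym (negPf nv).
have [fu' uf'] := extend_universal v uk fu uf.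
apply: (IH _ _ _ (extend f k v)) chk => //; first exact: leqW.
- exact: below_universal.
- by rewrite /= leqnn ltnW//= below_widen.
rewrite -[_ :: N]cat1s; apply: realizes_extend => // e; last first.
  by rewrite inE => /eqP->.
move=> /mapP[u]; rewrite mem_iota => /= us_u ->; split=> //; first exact: leq_trans us_u uk.
by apply: us_universal (fu _ us_u) _; rewrite eq_sym fv// inE (leq_trans us_u).
Qed.
End Soundness.

(** * The certificates for S_5 and S_7 *)

(** In [S5_edges] and [S7_edges] the labels 0, 1, 2, 3 stand for the vertices
    a, b, c, d of K_4, and the labels from 4 on for the added vertices. *)
Definition K4_edges := [:: (0, 1); (0, 2); (0, 3); (1, 2); (1, 3); (2, 3)].
Definition S5_edges := [:: (0, 1); (0, 2); (0, 3); (0, 4); (0, 5); (0, 6); (1, 2); (1,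
  3); (1, 4); (1, 5); (2, 3); (2, 4); (2, 6); (3, 5); (3, 6)].
Definition S7_edges := [:: (0, 1); (0, 2); (0, 3); (0, 4); (0, 5); (0, 6); (1, 2); (1,
  3); (1, 4); (1, 5); (1, 7); (2, 3); (2, 4); (2, 6); (2, 7); (3, 5); (3, 6); (3, 7)].
(** Starting from a K_4, in which 0 is the only vertex adjacent to all others,
    S_5 is found. *)
Definition cert_S5 :=
  Far 1 (Edge 3 4 (Far 3 (Edge 2 5 (Edge 2 4 (Far 2 (Edge 1 5 (Edge 4 5 (Kur (K33 [:: 0; 1;
  4] [:: 2; 3; 5] [::])) (Edge 3 6 (Edge 1 6 (Hit [:: 0; 1; 2; 3; 5; 6; 4]) (New 0 5 6 (Kur
  (K33 [:: 0; 3; 5] [:: 1; 2; 6] [:: [:: 5; 7; 6]])))) (New 0 4 6 (Edge 5 6 (Kur (K33 [:: 0;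
  3; 5] [:: 1; 2; 4] [:: [:: 5; 6; 7; 4]])) (Edge 1 7 (Kur (K33 [:: 0; 1; 4] [:: 2; 3; 7]
  [::])) (New 0 1 6 (Kur (K33 [:: 0; 1; 4] [:: 2; 3; 8] [:: [:: 4; 7; 6; 8]])))))))) (Edge 4
  5 (Edge 3 6 (Edge 4 6 (Hit [:: 0; 2; 3; 4; 1; 5; 6]) (New 0 5 6 (Kur (K33 [:: 0; 3; 5] [::
  2; 4; 7] [:: [:: 3; 6; 7]])))) (New 0 1 6 (Edge 5 6 (Kur (K33 [:: 0; 3; 5] [:: 2; 4; 6]
  [:: [:: 3; 1; 7; 6]])) (Edge 4 7 (Kur (K33 [:: 0; 1; 4] [:: 2; 3; 7] [::])) (New 0 4 6
  (Kur (K33 [:: 0; 1; 4] [:: 2; 3; 8] [:: [:: 1; 7; 6; 8]]))))))) (New 0 2 5 (Edge 6 7 (Edge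
  3 6 (Kur (K33 [:: 0; 2; 3] [:: 1; 4; 7] [:: [:: 3; 6; 7]])) (Edge 1 7 (Edge 4 7 (Kur (K33
  [:: 0; 1; 4] [:: 2; 3; 7] [::])) (New 0 4 6 (Kur (K33 [:: 0; 1; 4] [:: 2; 3; 7] [:: [:: 4;
  8; 6; 7]])))) (New 0 1 6 (Edge 4 7 (Kur (K33 [:: 0; 2; 7] [:: 4; 5; 6] [:: [:: 2; 1; 8;
  6]])) (Edge 4 8 (Kur (K33 [:: 0; 1; 4] [:: 2; 3; 8] [::])) (New 0 4 6 (Kur (K33 [:: 0; 1;
  4] [:: 2; 3; 8] [:: [:: 4; 9; 6; 8]])))))))) (New 0 5 6 (Edge 3 6 (Kur (K33 [:: 0; 2; 3]
  [:: 1; 4; 5] [:: [:: 3; 6; 8; 5]])) (Edge 1 8 (Edge 4 8 (Kur (K33 [:: 0; 1; 4] [:: 2; 3;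
  8] [::])) (New 0 4 6 (Kur (K33 [:: 0; 2; 8] [:: 1; 5; 6] [:: [:: 2; 4; 9; 6]])))) (New 0 1
  6 (Edge 4 8 (Kur (K33 [:: 0; 1; 4] [:: 2; 3; 8] [:: [:: 1; 9; 6; 8]])) (Edge 4 9 (Kur (K33
  [:: 0; 1; 4] [:: 2; 3; 9] [::])) (New 0 4 6 (Kur (K33 [:: 0; 1; 4] [:: 2; 3; 10] [:: [::
  1; 9; 6; 10]])))))))))))))) (New 0 3 4 (Edge 5 6 (Edge 1 5 (Kur (K33 [:: 0; 3; 5] [:: 1;
  2; 6] [::])) (Edge 2 6 (Hit [:: 0; 2; 3; 6; 1; 5; 4]) (New 0 2 5 (Edge 3 7 (Kur (K33 [::
  0; 3; 5] [:: 2; 6; 7] [::])) (Edge 4 5 (Kur (K33 [:: 0; 3; 5] [:: 2; 4; 6] [::])) (Edge 6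
  7 (Kur (K33 [:: 0; 2; 6] [:: 3; 5; 7] [::])) (New 0 4 7 (Kur (K33 [:: 0; 3; 5] [:: 2; 4;
  6] [:: [:: 5; 7; 8; 4]]))))))))) (New 0 4 5 (Edge 2 6 (Kur (K33 [:: 0; 2; 4] [:: 3; 5; 6]
  [:: [:: 4; 7; 5]])) (Edge 6 7 (Kur (K33 [:: 0; 3; 7] [:: 4; 5; 6] [:: [:: 3; 2; 5]]))
  (Edge 1 5 (Kur (K33 [:: 0; 3; 5] [:: 1; 2; 7] [:: [:: 3; 4; 7]])) (Edge 4 5 (Edge 2 7 (Kur
  (K33 [:: 0; 2; 4] [:: 3; 5; 7] [::])) (Edge 3 7 (Kur (K33 [:: 0; 3; 5] [:: 2; 4; 7] [::]))
  (New 0 1 7 (Kur (K33 [:: 0; 2; 4] [:: 1; 3; 5] [:: [:: 4; 7; 8; 1]]))))) (New 0 5 6 (Kur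
  (K33 [:: 0; 5; 6] [:: 3; 7; 8] [:: [:: 5; 2; 3]; [:: 6; 4; 7]]))))))))))) (New 0 1 5 (Edge
  4 6 (Edge 2 6 (Kur (K33 [:: 0; 3; 6] [:: 1; 2; 4] [::])) (Edge 2 4 (Kur (K33 [:: 0; 1; 4]
  [:: 2; 3; 6] [::])) (Edge 1 5 (Edge 3 6 (Hit [:: 0; 1; 3; 6; 2; 5; 4]) (New 0 3 4 (Edge 1
  7 (Kur (K33 [:: 0; 1; 4] [:: 3; 6; 7] [::])) (Edge 4 5 (Kur (K33 [:: 0; 1; 4] [:: 3; 5; 6]
  [::])) (Edge 6 7 (Kur (K33 [:: 0; 3; 6] [:: 1; 4; 7] [::])) (New 0 5 7 (Kur (K33 [:: 0; 3;
  6] [:: 1; 4; 7] [:: [:: 6; 5; 8; 7]])))))))) (New 0 2 5 (Kur (K33 [:: 0; 3; 6] [:: 1; 2;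
  4] [:: [:: 6; 5; 7; 2]])))))) (New 0 4 5 (Edge 2 6 (Kur (K33 [:: 0; 3; 6] [:: 1; 2; 4] [::
  [:: 6; 5; 7; 4]])) (Edge 2 7 (Kur (K33 [:: 0; 3; 7] [:: 2; 4; 5] [:: [:: 3; 1; 6; 5]]))
  (Edge 2 4 (Kur (K33 [:: 0; 1; 4] [:: 2; 3; 6] [:: [:: 4; 7; 5; 6]])) (Edge 1 5 (Edge 3 6
  (Kur (K33 [:: 0; 3; 5] [:: 1; 6; 7] [:: [:: 3; 4; 7]])) (Edge 6 7 (Kur (K33 [:: 0; 1; 7]
  [:: 4; 5; 6] [:: [:: 1; 3; 4]])) (Edge 4 5 (Edge 1 7 (Kur (K33 [:: 0; 1; 4] [:: 3; 5; 7]
  [::])) (Edge 3 7 (Kur (K33 [:: 0; 3; 5] [:: 1; 4; 7] [::])) (New 0 2 7 (Kur (K33 [:: 0; 3;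
  5] [:: 1; 4; 7] [:: [:: 3; 2; 8; 7]]))))) (New 0 4 6 (Kur (K33 [:: 0; 1; 4] [:: 3; 5; 8]
  [:: [:: 1; 6; 8]; [:: 4; 7; 5]])))))) (New 0 2 5 (Kur (K33 [:: 0; 1; 5] [:: 2; 3; 6] [::
  [:: 5; 8; 2]; [:: 5; 7; 4; 3]])))))))))))) (New 0 2 4 (Edge 2 4 (Far 2 (Edge 5 6 (Edge 3 6
  (Edge 1 6 (Kur (K33 [:: 0; 2; 6] [:: 1; 3; 5] [::])) (Edge 3 5 (Hit [:: 0; 2; 3; 5; 1; 4;
  6]) (New 0 3 6 (Edge 2 7 (Kur (K33 [:: 0; 2; 6] [:: 3; 5; 7] [::])) (Edge 5 7 (Kur (K33
  [:: 0; 3; 5] [:: 2; 6; 7] [::])) (Edge 4 6 (Kur (K33 [:: 0; 2; 6] [:: 3; 4; 5] [::])) (New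
  0 4 7 (Kur (K33 [:: 0; 2; 6] [:: 3; 5; 7] [:: [:: 2; 4; 8; 7]]))))))))) (Edge 1 5 (Edge 3
  5 (Kur (K5 [:: 0; 1; 2; 3; 5] [::])) (Edge 1 6 (Hit [:: 0; 1; 2; 5; 3; 6; 4]) (New 0 3 6
  (Kur (K33 [:: 0; 3; 5] [:: 1; 2; 6] [:: [:: 3; 7; 6]]))))) (New 0 1 6 (Edge 3 5 (Kur (K33
  [:: 0; 1; 5] [:: 2; 3; 7] [:: [:: 5; 6; 7]])) (Edge 3 7 (Kur (K33 [:: 0; 2; 7] [:: 1; 3;
  6] [:: [:: 2; 5; 6]])) (Edge 1 6 (Edge 2 7 (Kur (K33 [:: 0; 2; 6] [:: 1; 5; 7] [::]))
  (Edge 5 7 (Kur (K33 [:: 0; 1; 5] [:: 2; 6; 7] [::])) (Edge 4 6 (Kur (K33 [:: 0; 2; 6] [::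
  1; 4; 5] [::])) (New 0 4 7 (Kur (K33 [:: 0; 1; 5] [:: 2; 6; 7] [:: [:: 5; 4; 8; 7]]))))))
  (New 0 3 6 (Kur (K33 [:: 0; 2; 6] [:: 5; 7; 8] [:: [:: 2; 1; 7]; [:: 2; 3; 8]])))))))))
  (New 0 4 6 (Edge 3 6 (Edge 3 5 (Kur (K33 [:: 0; 3; 4] [:: 2; 5; 7] [:: [:: 3; 6; 7]]))
  (Edge 5 7 (Kur (K33 [:: 0; 2; 7] [:: 4; 5; 6] [:: [:: 2; 3; 6]])) (Edge 1 5 (Kur (K33 [::
  0; 3; 5] [:: 1; 2; 6] [:: [:: 5; 4; 7; 6]])) (Edge 4 6 (Edge 2 7 (Kur (K33 [:: 0; 2; 6]
  [:: 3; 4; 7] [::])) (Edge 3 7 (Kur (K33 [:: 0; 3; 4] [:: 2; 6; 7] [::])) (Edge 1 6 (Kur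
  (K33 [:: 0; 2; 6] [:: 1; 3; 4] [::])) (New 0 1 7 (Kur (K33 [:: 0; 2; 6] [:: 3; 4; 7] [::
  [:: 2; 1; 8; 7]])))))) (New 0 5 6 (Kur (K33 [:: 0; 5; 6] [:: 2; 7; 8] [:: [:: 5; 4; 7];
  [:: 6; 3; 2]]))))))) (Edge 1 7 (Edge 3 7 (Kur (K33 [:: 0; 2; 7] [:: 1; 3; 4] [::])) (Edge
  1 6 (Edge 1 5 (Kur (K33 [:: 0; 1; 4] [:: 2; 5; 7] [::])) (Edge 4 6 (Kur (K33 [:: 0; 1; 4]
  [:: 2; 6; 7] [::])) (Edge 5 7 (Kur (K33 [:: 0; 2; 7] [:: 1; 4; 5] [::])) (New 0 5 6 (Kur
  (K33 [:: 0; 2; 7] [:: 1; 4; 6] [:: [:: 2; 5; 8; 6]])))))) (New 0 3 6 (Kur (K33 [:: 0; 2;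
  7] [:: 1; 3; 4] [:: [:: 7; 6; 8; 3]]))))) (New 0 1 6 (Edge 3 7 (Kur (K33 [:: 0; 2; 7] [::
  3; 4; 6] [:: [:: 2; 1; 8; 6]])) (Edge 3 8 (Kur (K33 [:: 0; 2; 8] [:: 1; 3; 6] [:: [:: 2;
  4; 7; 6]])) (Edge 1 6 (Edge 1 5 (Kur (K33 [:: 0; 1; 4] [:: 2; 5; 7] [:: [:: 1; 6; 7]]))
  (Edge 2 8 (Kur (K33 [:: 0; 2; 6] [:: 1; 7; 8] [:: [:: 2; 4; 7]])) (Edge 4 8 (Kur (K33 [::
  0; 1; 4] [:: 2; 6; 8] [:: [:: 4; 7; 6]])) (Edge 5 7 (Kur (K33 [:: 0; 2; 7] [:: 4; 5; 6]
  [:: [:: 2; 1; 6]])) (New 0 5 8 (Kur (K33 [:: 0; 2; 8] [:: 1; 5; 6] [:: [:: 2; 4; 7; 6];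
  [:: 8; 9; 5]]))))))) (New 0 3 6 (Kur (K33 [:: 0; 3; 6] [:: 1; 2; 9] [:: [:: 6; 8; 1]; [::
  6; 7; 4; 2]])))))))))))) (New 0 4 5 (Edge 1 5 (Edge 3 5 (Kur (K5 [:: 0; 1; 2; 3; 5] [::]))
  (Edge 3 6 (Kur (K33 [:: 0; 3; 5] [:: 1; 2; 6] [::])) (New 0 3 4 (Kur (K33 [:: 0; 3; 5] [::
  1; 2; 4] [:: [:: 3; 7; 4]]))))) (Edge 1 6 (Edge 3 5 (Kur (K33 [:: 0; 1; 5] [:: 2; 3; 6]
  [::])) (Edge 3 6 (Kur (K33 [:: 0; 2; 6] [:: 1; 3; 5] [::])) (New 0 3 4 (Kur (K33 [:: 0; 2;
  6] [:: 1; 3; 5] [:: [:: 6; 4; 7; 3]]))))) (New 0 1 4 (Edge 2 6 (Kur (K33 [:: 0; 2; 4] [::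
  1; 5; 6] [:: [:: 4; 7; 1]])) (Edge 3 6 (Kur (K33 [:: 0; 2; 6] [:: 3; 4; 5] [:: [:: 2; 1;
  7; 4]])) (Edge 6 7 (Kur (K33 [:: 0; 5; 7] [:: 1; 4; 6] [:: [:: 5; 2; 1]])) (New 0 1 6 (Kur
  (K33 [:: 0; 1; 4] [:: 5; 7; 8] [:: [:: 1; 2; 5]; [:: 4; 6; 8]]))))))))))))).

(** Starting from a K_4, if no vertex is adjacent to all others, S_7 is found. *)
Definition cert_S7 :=
  Far 0 (Edge 3 4 (Far 3 (Edge 2 5 (Edge 1 5 (Edge 1 4 (Far 1 (Edge 2 6 (Edge 2 4 (Far 2
  (Edge 0 5 (Edge 4 5 (Kur (K33 [:: 0; 1; 4] [:: 2; 3; 5] [::])) (Edge 3 7 (Edge 0 7 (Edge 3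
  6 (Edge 0 6 (Edge 5 6 (Kur (K33 [:: 0; 3; 5] [:: 1; 2; 6] [::])) (Edge 1 7 (Hit [:: 0; 1;
  2; 3; 5; 7; 6; 4]) (New 0 5 7 (Kur (K33 [:: 0; 3; 5] [:: 1; 2; 8] [:: [:: 3; 7; 8]])))))
  (New 2 5 6 (Kur (K33 [:: 0; 1; 6] [:: 2; 3; 5] [:: [:: 6; 8; 5]])))) (New 4 6 7 (Kur (K33
  [:: 0; 3; 4] [:: 1; 2; 7] [:: [:: 4; 8; 7]])))) (New 1 5 7 (Kur (K33 [:: 0; 2; 8] [:: 1;
  3; 5] [:: [:: 8; 7; 3]])))) (New 1 4 7 (Edge 5 7 (Kur (K33 [:: 0; 2; 4] [:: 1; 3; 5] [::
  [:: 4; 8; 7; 5]])) (Edge 0 8 (Kur (K33 [:: 0; 1; 4] [:: 2; 3; 8] [::])) (New 0 1 7 (Kur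
  (K33 [:: 0; 1; 4] [:: 2; 3; 9] [:: [:: 4; 8; 7; 9]])))))))) (Edge 4 5 (Edge 3 7 (Edge 4 7
  (Edge 3 6 (Edge 4 6 (Edge 0 6 (Kur (K33 [:: 0; 3; 4] [:: 1; 2; 6] [::])) (Edge 1 7 (Hit
  [:: 1; 2; 3; 4; 0; 5; 7; 6]) (New 0 3 7 (Kur (K33 [:: 0; 3; 4] [:: 1; 2; 8] [:: [:: 4; 7;
  8]]))))) (New 2 5 6 (Kur (K33 [:: 1; 4; 6] [:: 2; 3; 5] [:: [:: 6; 8; 5]])))) (New 0 6 7
  (Kur (K33 [:: 0; 3; 4] [:: 1; 2; 7] [:: [:: 0; 8; 7]])))) (New 1 5 7 (Kur (K33 [:: 1; 3;
  5] [:: 2; 4; 8] [:: [:: 3; 7; 8]])))) (New 0 1 7 (Edge 5 7 (Kur (K33 [:: 0; 1; 4] [:: 2;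
  3; 5] [:: [:: 0; 8; 7; 5]])) (Edge 4 8 (Kur (K33 [:: 0; 1; 4] [:: 2; 3; 8] [::])) (New 1 4
  7 (Kur (K33 [:: 0; 1; 4] [:: 2; 3; 8] [:: [:: 4; 9; 7; 8]]))))))) (New 1 2 5 (Edge 7 8
  (Edge 6 8 (Edge 3 8 (Kur (K33 [:: 0; 4; 8] [:: 1; 2; 3] [::])) (Edge 3 6 (Kur (K33 [:: 0;
  4; 8] [:: 1; 2; 3] [:: [:: 8; 6; 3]])) (Edge 1 7 (Edge 0 8 (Edge 4 8 (Kur (K33 [:: 0; 2;
  4] [:: 1; 3; 8] [::])) (New 2 4 6 (Kur (K33 [:: 0; 2; 4] [:: 1; 3; 8] [:: [:: 4; 9; 6;
  8]])))) (New 0 2 6 (Edge 4 8 (Kur (K33 [:: 0; 1; 4] [:: 2; 3; 8] [:: [:: 0; 9; 6; 8]]))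
  (Edge 4 9 (Kur (K33 [:: 0; 2; 4] [:: 1; 3; 9] [::])) (New 2 4 6 (Kur (K33 [:: 0; 2; 4] [::
  1; 3; 9] [:: [:: 4; 10; 6; 9]]))))))) (New 0 3 7 (Kur (K33 [:: 0; 3; 8] [:: 1; 2; 9] [::
  [:: 8; 7; 9]])))))) (New 2 5 6 (Edge 3 8 (Kur (K33 [:: 0; 4; 8] [:: 1; 2; 3] [::])) (Edge
  3 6 (Kur (K33 [:: 0; 4; 5] [:: 1; 2; 3] [:: [:: 5; 9; 6; 3]])) (Edge 3 9 (Kur (K33 [:: 0;
  4; 5] [:: 1; 2; 3] [:: [:: 5; 9; 3]])) (Edge 1 7 (Edge 7 9 (Kur (K33 [:: 1; 8; 9] [:: 2;
  5; 7] [::])) (New 0 6 7 (Kur (K33 [:: 1; 8; 9] [:: 2; 5; 7] [:: [:: 9; 6; 10; 7]])))) (New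
  0 3 7 (Kur (K33 [:: 0; 3; 8] [:: 1; 2; 10] [:: [:: 8; 7; 10]]))))))))) (New 1 5 7 (Edge 6
  9 (Edge 3 9 (Kur (K33 [:: 0; 4; 9] [:: 1; 2; 3] [:: [:: 9; 6; 2]])) (Edge 3 6 (Kur (K33
  [:: 0; 4; 6] [:: 1; 2; 3] [:: [:: 6; 9; 1]])) (Edge 1 7 (Edge 0 9 (Edge 4 9 (Kur (K33 [::
  0; 4; 5] [:: 1; 2; 9] [::])) (New 4 6 7 (Kur (K33 [:: 0; 1; 6] [:: 2; 3; 9] [:: [:: 6; 10;
  4; 3]])))) (New 0 6 7 (Edge 4 9 (Kur (K33 [:: 0; 1; 4] [:: 2; 3; 9] [:: [:: 0; 10; 6;
  9]])) (Edge 4 10 (Kur (K33 [:: 0; 1; 4] [:: 2; 3; 10] [:: [:: 1; 7; 10]])) (New 4 6 7 (Kur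
  (K33 [:: 0; 2; 4] [:: 1; 3; 6] [:: [:: 0; 10; 6]; [:: 4; 11; 6]]))))))) (New 0 3 7 (Kur
  (K33 [:: 0; 3; 5] [:: 1; 2; 10] [:: [:: 5; 9; 7; 10]])))))) (New 5 6 7 (Edge 3 9 (Kur (K33
  [:: 0; 4; 5] [:: 1; 2; 3] [:: [:: 5; 9; 3]])) (Edge 3 10 (Kur (K33 [:: 0; 4; 5] [:: 1; 2;
  3] [:: [:: 5; 10; 3]])) (Edge 3 6 (Kur (K33 [:: 0; 4; 6] [:: 1; 2; 3] [:: [:: 6; 10; 5;
  1]])) (Edge 1 7 (Edge 0 9 (Kur (K33 [:: 0; 5; 7] [:: 1; 2; 9] [:: [:: 7; 10; 6; 2]]))
  (Edge 2 9 (Kur (K33 [:: 1; 9; 10] [:: 2; 5; 7] [:: [:: 10; 6; 2]])) (Edge 4 9 (Kur (K33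
  [:: 1; 2; 9] [:: 4; 5; 7] [:: [:: 2; 6; 10; 7]])) (Edge 3 7 (Kur (K33 [:: 0; 4; 7] [:: 1;
  2; 3] [:: [:: 7; 10; 6; 2]])) (Edge 3 8 (Kur (K33 [:: 0; 4; 8] [:: 1; 2; 3] [::])) (New 1
  3 9 (Kur (K33 [:: 0; 4; 5] [:: 1; 2; 3] [:: [:: 5; 9; 11; 3]])))))))) (New 0 3 7 (Kur (K33
  [:: 0; 3; 5] [:: 1; 2; 11] [:: [:: 5; 10; 7; 11]]))))))))))))))) (New 1 3 4 (Edge 5 7
  (Edge 6 7 (Edge 4 5 (Kur (K33 [:: 1; 3; 5] [:: 2; 4; 7] [::])) (Edge 3 6 (Edge 0 5 (Kur
  (K33 [:: 0; 2; 7] [:: 1; 3; 5] [::])) (Edge 2 7 (Hit [:: 1; 2; 3; 7; 0; 5; 4; 6]) (New 1 2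
  5 (Edge 3 8 (Kur (K33 [:: 1; 3; 5] [:: 2; 7; 8] [::])) (Edge 7 8 (Kur (K33 [:: 1; 2; 7]
  [:: 3; 5; 8] [::])) (New 1 4 8 (Kur (K33 [:: 1; 2; 7] [:: 3; 4; 5] [:: [:: 2; 8; 9;
  4]])))))))) (New 4 6 7 (Kur (K33 [:: 1; 3; 6] [:: 2; 4; 7] [:: [:: 6; 8; 4]]))))) (New 3 4
  6 (Kur (K33 [:: 1; 7; 8] [:: 3; 4; 5] [:: [:: 8; 6; 2; 5]])))) (New 1 4 5 (Edge 7 8 (Kur
  (K33 [:: 1; 3; 8] [:: 2; 4; 7] [:: [:: 8; 5; 2]])) (Edge 3 6 (Edge 2 7 (Kur (K33 [:: 1; 2;
  4] [:: 3; 5; 7] [:: [:: 4; 8; 5]])) (Edge 0 5 (Kur (K33 [:: 0; 2; 4] [:: 1; 3; 5] [:: [::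
  4; 8; 5]])) (Edge 4 5 (Edge 2 8 (Kur (K33 [:: 1; 2; 4] [:: 3; 5; 8] [::])) (Edge 3 8 (Kur
  (K33 [:: 1; 3; 5] [:: 2; 4; 8] [::])) (New 0 1 8 (Kur (K33 [:: 0; 2; 4] [:: 1; 3; 5] [::
  [:: 0; 9; 8; 5]]))))) (New 1 5 7 (Kur (K33 [:: 1; 3; 5] [:: 2; 4; 7] [:: [:: 5; 8; 4]; [::
  5; 9; 7]])))))) (New 4 6 7 (Kur (K33 [:: 1; 3; 9] [:: 2; 4; 7] [:: [:: 9; 6; 2]])))))))))
  (New 0 3 6 (Edge 5 7 (Kur (K33 [:: 0; 3; 5] [:: 1; 2; 7] [::])) (New 0 5 6 (Kur (K33 [::
  0; 3; 5] [:: 1; 2; 8] [:: [:: 3; 7; 6; 8]]))))))) (Edge 2 4 (New 2 3 4 (Far 2 (Edge 5 6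
  (Edge 6 7 (Edge 0 6 (Kur (K33 [:: 0; 3; 5] [:: 1; 2; 6] [::])) (Edge 1 7 (Edge 0 5 (Kur
  (K33 [:: 0; 1; 6] [:: 2; 3; 5] [::])) (Edge 3 7 (Edge 1 6 (Hit [:: 1; 2; 3; 6; 0; 5; 7;
  4]) (New 1 2 5 (Edge 3 8 (Kur (K33 [:: 1; 6; 8] [:: 2; 3; 5] [::])) (Edge 4 5 (Kur (K33
  [:: 1; 4; 6] [:: 2; 3; 5] [::])) (Edge 6 8 (Kur (K33 [:: 1; 2; 6] [:: 3; 5; 8] [::])) (New
  2 4 8 (Kur (K33 [:: 1; 2; 6] [:: 3; 4; 5] [:: [:: 1; 8; 9; 4]])))))))) (New 0 1 7 (Kur
  (K33 [:: 0; 1; 6] [:: 2; 3; 8] [:: [:: 6; 7; 8]]))))) (New 0 3 7 (Kur (K33 [:: 0; 3; 5]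
  [:: 1; 2; 8] [:: [:: 5; 6; 7; 8]]))))) (New 4 5 7 (Kur (K33 [:: 1; 4; 6] [:: 2; 3; 5] [::
  [:: 4; 8; 5]])))) (New 2 4 5 (Edge 0 8 (Kur (K33 [:: 0; 3; 5] [:: 1; 2; 8] [:: [:: 3; 4;
  8]])) (Edge 1 7 (Edge 1 6 (Kur (K33 [:: 1; 2; 4] [:: 3; 5; 6] [:: [:: 4; 8; 5]])) (Edge 3
  7 (Edge 6 8 (Kur (K33 [:: 2; 3; 8] [:: 4; 5; 6] [:: [:: 3; 1; 5]])) (Edge 0 5 (Kur (K33
  [:: 0; 1; 4] [:: 2; 3; 5] [:: [:: 4; 8; 5]])) (Edge 4 5 (Edge 1 8 (Kur (K33 [:: 1; 2; 4]
  [:: 3; 5; 8] [::])) (Edge 3 8 (Kur (K33 [:: 1; 4; 8] [:: 2; 3; 5] [::])) (New 0 2 8 (Kur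
  (K33 [:: 0; 1; 4] [:: 2; 3; 5] [:: [:: 0; 9; 8; 5]]))))) (New 2 5 6 (Kur (K33 [:: 2; 5; 6]
  [:: 3; 8; 9] [:: [:: 5; 1; 3]; [:: 6; 4; 8]])))))) (New 0 6 7 (Kur (K33 [:: 0; 1; 6] [::
  2; 3; 9] [:: [:: 1; 7; 9]]))))) (New 0 5 7 (Kur (K33 [:: 0; 1; 4] [:: 2; 3; 5] [:: [:: 0;
  9; 5]; [:: 4; 8; 5]]))))))))) (New 0 4 5 (Kur (K33 [:: 0; 3; 5] [:: 1; 2; 6] [:: [:: 3; 4;
  6]]))))) (New 0 2 5 (Edge 2 4 (Far 2 (Edge 6 7 (Edge 4 6 (Edge 1 6 (Kur (K33 [:: 0; 1; 4]
  [:: 2; 3; 6] [::])) (Edge 3 7 (Edge 1 4 (Kur (K33 [:: 0; 2; 4] [:: 1; 3; 6] [::])) (Edge 0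
  5 (Edge 0 7 (Edge 3 6 (Hit [:: 0; 2; 3; 6; 1; 5; 7; 4]) (New 2 3 4 (Edge 0 8 (Kur (K33 [::
  0; 2; 4] [:: 3; 6; 8] [::])) (Edge 4 5 (Kur (K33 [:: 0; 2; 4] [:: 3; 5; 6] [::])) (Edge 6
  8 (Kur (K33 [:: 0; 4; 8] [:: 2; 3; 6] [::])) (New 2 5 8 (Kur (K33 [:: 0; 4; 5] [:: 2; 3;
  6] [:: [:: 5; 9; 8; 3]])))))))) (New 1 3 7 (Kur (K33 [:: 0; 2; 8] [:: 1; 3; 6] [:: [:: 8;
  7; 6]])))) (New 1 2 5 (Kur (K33 [:: 0; 1; 4] [:: 2; 3; 6] [:: [:: 1; 8; 5; 6]]))))) (New 0
  1 7 (Kur (K33 [:: 0; 1; 4] [:: 2; 3; 6] [:: [:: 1; 8; 7; 6]]))))) (New 2 4 5 (Edge 1 8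
  (Kur (K33 [:: 1; 4; 5] [:: 2; 3; 8] [:: [:: 5; 6; 0; 3]])) (Edge 3 7 (Edge 0 5 (Kur (K33
  [:: 0; 6; 8] [:: 2; 3; 5] [:: [:: 6; 7; 3]; [:: 8; 4; 3]])) (Edge 1 6 (Kur (K5 [:: 0; 1;
  2; 3; 6] [:: [:: 3; 7; 6]])) (Edge 1 4 (Kur (K33 [:: 0; 2; 4] [:: 1; 3; 8] [:: [:: 0; 6;
  5; 8]])) (New 1 2 5 (Kur (K33 [:: 0; 3; 9] [:: 1; 2; 6] [:: [:: 3; 7; 6]; [:: 9; 5;
  6]])))))) (New 1 4 7 (Kur (K33 [:: 0; 1; 4] [:: 2; 3; 9] [:: [:: 0; 6; 7; 9]]))))))) (New
  0 5 7 (Edge 4 8 (Edge 1 8 (Kur (K33 [:: 0; 1; 4] [:: 2; 3; 8] [::])) (Edge 3 7 (Edge 1 4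
  (Kur (K5 [:: 0; 1; 2; 3; 4] [:: [:: 0; 8; 4]])) (Edge 0 7 (Edge 0 5 (Edge 3 6 (Kur (K33
  [:: 0; 4; 5] [:: 2; 6; 8] [:: [:: 4; 3; 6]])) (Edge 6 8 (Kur (K5 [:: 0; 2; 5; 6; 8] [::
  [:: 2; 4; 8]])) (Edge 5 7 (Kur (K33 [:: 0; 4; 7] [:: 2; 3; 8] [:: [:: 7; 5; 2]])) (New 4 6
  7 (Kur (K33 [:: 0; 4; 7] [:: 3; 8; 9] [:: [:: 0; 6; 9]])))))) (New 1 5 7 (Kur (K33 [:: 0;
  1; 4] [:: 2; 3; 8] [:: [:: 1; 9; 7; 8]])))) (New 1 3 7 (Kur (K33 [:: 0; 1; 4] [:: 2; 3; 8]
  [:: [:: 1; 9; 7; 8]]))))) (New 0 1 7 (Kur (K33 [:: 0; 1; 4] [:: 2; 3; 9] [:: [:: 4; 8; 7;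
  9]]))))) (New 4 5 7 (Edge 1 9 (Kur (K33 [:: 0; 1; 4] [:: 2; 3; 9] [:: [:: 0; 8; 5; 9]]))
  (Edge 3 7 (Edge 1 4 (Kur (K33 [:: 0; 2; 4] [:: 1; 3; 6] [:: [:: 4; 9; 5; 6]])) (Edge 1 8
  (Kur (K33 [:: 0; 1; 7] [:: 2; 3; 8] [:: [:: 7; 9; 5; 2]])) (Edge 0 7 (Edge 2 8 (Kur (K33
  [:: 0; 2; 5] [:: 3; 6; 8] [:: [:: 5; 9; 7; 3]])) (Edge 3 8 (Kur (K33 [:: 0; 3; 5] [:: 2;
  7; 8] [:: [:: 5; 9; 7]])) (Edge 1 7 (Kur (K33 [:: 0; 2; 7] [:: 1; 3; 8] [:: [:: 2; 5;
  8]])) (Edge 1 6 (Kur (K33 [:: 0; 1; 5] [:: 2; 3; 6] [:: [:: 5; 9; 7; 3]])) (New 0 1 8 (Kur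
  (K33 [:: 0; 1; 8] [:: 2; 3; 10] [:: [:: 8; 5; 2]; [:: 8; 7; 3]]))))))) (New 1 3 7 (Kur
  (K33 [:: 0; 2; 10] [:: 1; 3; 6] [:: [:: 10; 7; 8; 5; 6]])))))) (New 1 4 7 (Kur (K33 [:: 0;
  1; 4] [:: 2; 3; 10] [:: [:: 0; 8; 7; 10]])))))))))) (Edge 3 6 (Edge 1 6 (Kur (K5 [:: 0; 1;
  2; 3; 6] [::])) (New 1 4 5 (Kur (K33 [:: 0; 3; 5] [:: 1; 2; 6] [:: [:: 5; 7; 1]])))) (New
  1 4 6 (Kur (K33 [:: 0; 2; 7] [:: 1; 3; 6] [:: [:: 7; 4; 3]]))))))) (New 0 1 5 (Edge 1 5
  (Edge 4 6 (Edge 2 6 (Kur (K5 [:: 0; 1; 2; 3; 6] [:: [:: 3; 4; 6]])) (Edge 1 4 (Edge 2 4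
  (Kur (K33 [:: 0; 1; 4] [:: 2; 3; 6] [::])) (Edge 0 5 (Far 1 (Edge 3 7 (Edge 6 7 (Edge 0 7
  (Edge 3 6 (Hit [:: 0; 1; 3; 6; 2; 5; 7; 4]) (New 1 3 4 (Edge 0 8 (Kur (K33 [:: 0; 1; 4]
  [:: 3; 6; 8] [::])) (Edge 4 5 (Kur (K33 [:: 0; 1; 4] [:: 3; 5; 6] [::])) (Edge 6 8 (Kur
  (K33 [:: 0; 4; 8] [:: 1; 3; 6] [::])) (New 1 5 8 (Kur (K33 [:: 0; 3; 6] [:: 1; 5; 7] [::
  [:: 3; 8; 9; 5]])))))))) (New 2 3 7 (Kur (K33 [:: 0; 1; 7] [:: 2; 3; 6] [:: [:: 7; 8;
  2]])))) (New 0 5 7 (Kur (K33 [:: 0; 4; 5] [:: 1; 6; 8] [:: [:: 4; 3; 7; 8]])))) (New 2 4 7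
  (Kur (K33 [:: 0; 1; 4] [:: 2; 3; 6] [:: [:: 4; 8; 2]]))))) (New 1 2 5 (Kur (K33 [:: 0; 2;
  4] [:: 1; 3; 6] [:: [:: 2; 7; 5; 6]]))))) (New 2 3 4 (Kur (K33 [:: 0; 1; 4] [:: 2; 3; 6]
  [:: [:: 4; 7; 2]]))))) (New 1 4 5 (Edge 2 7 (Kur (K33 [:: 0; 1; 7] [:: 2; 3; 5] [:: [:: 0;
  6; 5]; [:: 7; 4; 3]])) (Edge 1 4 (Edge 2 6 (Kur (K33 [:: 0; 2; 4] [:: 1; 3; 6] [:: [:: 4;
  7; 5; 6]])) (Edge 2 4 (Kur (K33 [:: 0; 1; 4] [:: 2; 3; 6] [:: [:: 4; 7; 5; 6]])) (Edge 0 5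
  (Edge 3 6 (Kur (K33 [:: 0; 6; 7] [:: 1; 3; 5] [:: [:: 7; 4; 3]])) (Edge 6 7 (Kur (K33 [::
  0; 1; 7] [:: 4; 5; 6] [:: [:: 0; 3; 4]])) (Edge 4 5 (Edge 0 7 (Kur (K33 [:: 0; 1; 4] [::
  3; 5; 7] [::])) (Edge 3 7 (Kur (K33 [:: 0; 4; 7] [:: 1; 3; 5] [::])) (New 1 2 7 (Kur (K33
  [:: 0; 2; 4] [:: 1; 3; 5] [:: [:: 2; 8; 7; 5]]))))) (New 1 4 6 (Kur (K33 [:: 0; 5; 8] [::
  1; 4; 6] [:: [:: 0; 3; 4]; [:: 5; 7; 4]])))))) (New 1 2 5 (Kur (K33 [:: 1; 2; 5] [:: 3; 6;
  8] [:: [:: 2; 0; 6]; [:: 5; 7; 4; 3]])))))) (New 2 3 4 (Kur (K33 [:: 0; 1; 8] [:: 2; 3; 6]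
  [:: [:: 8; 4; 7; 5; 6]]))))))) (New 0 5 6 (Edge 4 7 (Edge 2 6 (Kur (K33 [:: 0; 3; 6] [::
  1; 2; 7] [:: [:: 3; 4; 7]])) (Edge 2 7 (Kur (K33 [:: 0; 1; 7] [:: 2; 3; 6] [:: [:: 7; 4;
  3]])) (New 0 2 5 (Kur (K33 [:: 0; 1; 5] [:: 2; 3; 6] [:: [:: 5; 8; 2]; [:: 5; 7; 4;
  3]]))))) (New 4 5 6 (Edge 2 8 (Kur (K33 [:: 0; 1; 8] [:: 2; 3; 6] [:: [:: 8; 4; 3]]))
  (Edge 2 6 (Kur (K5 [:: 0; 1; 2; 3; 6] [:: [:: 3; 4; 8; 6]])) (New 2 4 5 (Kur (K33 [:: 0;
  1; 4] [:: 2; 3; 6] [:: [:: 4; 9; 2]; [:: 4; 8; 6]])))))))))))) (New 1 2 4 (Edge 2 4 (Far 2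
  (Edge 5 6 (Edge 1 4 (Edge 1 6 (Far 1 (Edge 5 7 (Edge 3 6 (Edge 0 5 (Kur (K33 [:: 0; 2; 6]
  [:: 1; 3; 5] [::])) (Edge 3 7 (Edge 0 6 (Kur (K33 [:: 0; 3; 5] [:: 1; 2; 6] [::])) (Edge 2
  7 (Edge 3 5 (Hit [:: 1; 2; 3; 5; 0; 4; 6; 7]) (New 1 3 6 (Edge 2 8 (Kur (K33 [:: 1; 2; 6]
  [:: 3; 5; 8] [::])) (Edge 5 8 (Kur (K33 [:: 1; 3; 5] [:: 2; 6; 8] [::])) (Edge 4 6 (Kur
  (K33 [:: 1; 2; 6] [:: 3; 4; 5] [::])) (New 1 4 8 (Kur (K33 [:: 1; 4; 7] [:: 2; 3; 5] [::
  [:: 4; 9; 8; 3]])))))))) (New 0 3 7 (Kur (K33 [:: 0; 3; 5] [:: 1; 2; 8] [:: [:: 5; 7;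
  8]]))))) (New 0 2 7 (Kur (K33 [:: 0; 2; 6] [:: 1; 3; 5] [:: [:: 0; 8; 7; 5]]))))) (Edge 0
  5 (Edge 3 5 (Kur (K5 [:: 0; 1; 2; 3; 5] [::])) (Edge 2 7 (Edge 0 6 (Edge 0 7 (Hit [:: 0;
  1; 2; 5; 3; 6; 7; 4]) (New 2 3 7 (Kur (K33 [:: 0; 1; 7] [:: 2; 3; 5] [:: [:: 7; 8; 3]]))))
  (New 1 3 6 (Kur (K33 [:: 0; 2; 6] [:: 1; 3; 5] [:: [:: 6; 8; 3]])))) (New 0 3 7 (Kur (K33
  [:: 0; 3; 5] [:: 1; 2; 8] [:: [:: 5; 7; 8]]))))) (New 0 1 6 (Edge 3 8 (Kur (K33 [:: 0; 3;
  5] [:: 1; 2; 8] [:: [:: 5; 6; 8]])) (Edge 2 7 (Edge 3 5 (Kur (K33 [:: 0; 1; 5] [:: 2; 3;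
  6] [:: [:: 0; 8; 6]])) (Edge 0 6 (Edge 2 8 (Kur (K33 [:: 0; 5; 8] [:: 1; 2; 6] [::]))
  (Edge 5 8 (Kur (K33 [:: 0; 1; 5] [:: 2; 6; 8] [::])) (Edge 4 6 (Kur (K33 [:: 0; 4; 5] [::
  1; 2; 6] [::])) (New 1 4 8 (Kur (K33 [:: 0; 4; 5] [:: 1; 2; 6] [:: [:: 4; 9; 8; 6]]))))))
  (New 1 3 6 (Kur (K33 [:: 0; 1; 6] [:: 5; 8; 9] [:: [:: 0; 2; 5]; [:: 0; 3; 9]]))))) (New 0
  3 7 (Kur (K33 [:: 0; 3; 5] [:: 1; 2; 9] [:: [:: 5; 7; 9]])))))))) (New 2 4 7 (Edge 6 8
  (Kur (K33 [:: 1; 5; 8] [:: 2; 4; 6] [::])) (New 4 6 7 (Kur (K33 [:: 1; 5; 9] [:: 2; 4; 6]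
  [:: [:: 9; 7; 8; 2]]))))))) (Edge 0 5 (Edge 3 5 (Kur (K33 [:: 0; 3; 4] [:: 1; 2; 5] [::]))
  (New 0 3 6 (Kur (K33 [:: 0; 3; 5] [:: 1; 2; 7] [:: [:: 5; 6; 7]])))) (New 0 4 6 (Kur (K33
  [:: 0; 4; 5] [:: 1; 2; 7] [:: [:: 5; 6; 7]]))))) (New 2 4 5 (Edge 6 7 (Edge 0 5 (Edge 3 5
  (Kur (K5 [:: 0; 1; 2; 3; 5] [::])) (Edge 3 7 (Kur (K33 [:: 0; 1; 7] [:: 2; 3; 5] [::]))
  (New 2 3 4 (Kur (K33 [:: 0; 1; 8] [:: 2; 3; 5] [:: [:: 8; 4; 5]]))))) (Edge 0 7 (Edge 3 5
  (Kur (K33 [:: 0; 2; 5] [:: 1; 3; 7] [::])) (Edge 3 7 (Kur (K33 [:: 0; 3; 5] [:: 1; 2; 7]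
  [::])) (New 2 3 4 (Kur (K33 [:: 0; 4; 5] [:: 1; 2; 7] [:: [:: 4; 8; 3; 1]]))))) (New 0 4 6
  (Kur (K33 [:: 2; 4; 6] [:: 5; 7; 8] [:: [:: 2; 0; 8]]))))) (New 4 5 6 (Edge 0 5 (Edge 3 5
  (Kur (K5 [:: 0; 1; 2; 3; 5] [::])) (Edge 3 8 (Kur (K5 [:: 0; 1; 2; 3; 5] [:: [:: 3; 8;
  5]])) (New 3 4 6 (Kur (K33 [:: 0; 1; 4] [:: 2; 3; 5] [:: [:: 4; 9; 3]]))))) (Edge 0 8
  (Edge 3 5 (Kur (K5 [:: 0; 1; 2; 3; 5] [:: [:: 0; 8; 5]])) (Edge 3 8 (Kur (K33 [:: 0; 3; 5]
  [:: 1; 2; 8] [::])) (New 3 4 6 (Kur (K33 [:: 0; 3; 5] [:: 1; 2; 8] [:: [:: 3; 9; 6;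
  8]]))))) (New 0 4 6 (Edge 1 7 (Kur (K33 [:: 0; 5; 7] [:: 1; 2; 4] [:: [:: 0; 9; 4]]))
  (Edge 3 7 (Kur (K33 [:: 1; 2; 7] [:: 3; 4; 5] [:: [:: 1; 0; 9; 4]])) (Edge 7 9 (Kur (K33
  [:: 1; 4; 7] [:: 2; 5; 9] [:: [:: 1; 0; 9]])) (New 0 2 7 (Kur (K33 [:: 2; 7; 8] [:: 4; 5;
  10] [:: [:: 8; 6; 9; 0; 10]]))))))))))))) (New 1 4 6 (Edge 1 6 (Edge 1 4 (Far 1 (Edge 7 8
  (Edge 3 6 (Edge 0 7 (Kur (K33 [:: 0; 2; 6] [:: 1; 3; 7] [:: [:: 2; 4; 7]])) (Edge 3 8
  (Edge 3 5 (Kur (K33 [:: 1; 3; 4] [:: 2; 5; 7] [:: [:: 3; 8; 7]])) (Edge 4 6 (Kur (K33 [::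
  1; 3; 4] [:: 2; 6; 7] [:: [:: 3; 8; 7]])) (Edge 5 7 (Kur (K33 [:: 1; 2; 7] [:: 3; 4; 5]
  [:: [:: 7; 8; 3]])) (Edge 0 5 (Kur (K33 [:: 0; 1; 4] [:: 2; 3; 5] [:: [:: 4; 7; 6; 3]]))
  (New 1 5 6 (Kur (K33 [:: 1; 2; 6] [:: 3; 7; 9] [:: [:: 2; 4; 7]; [:: 2; 5; 9]]))))))) (New
  0 6 8 (Kur (K33 [:: 0; 3; 7] [:: 1; 2; 6] [:: [:: 0; 9; 6]; [:: 7; 4; 2]]))))) (Edge 0 7
  (Edge 3 7 (Kur (K33 [:: 0; 3; 4] [:: 1; 2; 7] [::])) (Edge 0 6 (Edge 0 5 (Kur (K33 [:: 0;
  1; 4] [:: 2; 5; 7] [::])) (Edge 4 6 (Kur (K33 [:: 0; 1; 4] [:: 2; 6; 7] [::])) (Edge 5 7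
  (Kur (K33 [:: 0; 4; 5] [:: 1; 2; 7] [::])) (New 1 5 6 (Kur (K33 [:: 0; 4; 6] [:: 1; 2; 7]
  [:: [:: 6; 9; 5; 2]])))))) (New 1 3 6 (Kur (K33 [:: 0; 3; 4] [:: 1; 2; 7] [:: [:: 3; 9; 6;
  7]]))))) (New 0 1 6 (Edge 3 9 (Kur (K33 [:: 0; 3; 6] [:: 1; 2; 9] [:: [:: 6; 7; 4; 2]]))
  (Edge 0 5 (Kur (K33 [:: 0; 1; 4] [:: 2; 5; 7] [:: [:: 0; 9; 6; 7]])) (Edge 2 8 (Edge 4 6
  (Kur (K33 [:: 1; 2; 6] [:: 4; 7; 9] [:: [:: 2; 8; 7]; [:: 2; 0; 9]])) (Edge 5 7 (Kur (K5
  [:: 1; 2; 4; 5; 7] [:: [:: 2; 8; 7]])) (Edge 5 9 (Kur (K33 [:: 0; 5; 6] [:: 1; 2; 9] [::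
  [:: 6; 7; 8; 2]])) (New 1 5 6 (Kur (K33 [:: 1; 5; 7] [:: 2; 4; 6] [:: [:: 5; 10; 6]; [::
  7; 8; 2]])))))) (New 0 3 8 (Kur (K33 [:: 0; 3; 4] [:: 1; 2; 10] [:: [:: 4; 7; 8;
  10]]))))))))) (New 4 6 8 (Edge 5 8 (Edge 0 9 (Kur (K33 [:: 0; 4; 5] [:: 1; 2; 9] [:: [::
  5; 8; 9]])) (Edge 3 6 (Kur (K33 [:: 1; 2; 9] [:: 3; 4; 5] [:: [:: 9; 6; 3]; [:: 9; 8;
  5]])) (New 0 6 8 (Kur (K33 [:: 0; 4; 5] [:: 1; 2; 8] [:: [:: 0; 10; 8]; [:: 4; 9; 8]])))))
  (Edge 2 9 (Edge 5 9 (Kur (K5 [:: 1; 2; 4; 5; 9] [:: [:: 1; 6; 9]])) (Edge 2 8 (Edge 2 7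
  (Kur (K33 [:: 1; 7; 9] [:: 2; 4; 6] [::])) (Edge 0 7 (Kur (K33 [:: 0; 4; 6] [:: 1; 2; 7]
  [:: [:: 6; 9; 2]])) (Edge 3 7 (Kur (K33 [:: 1; 7; 9] [:: 3; 4; 6] [:: [:: 9; 2; 3]]))
  (Edge 4 8 (Edge 3 8 (Kur (K33 [:: 1; 2; 8] [:: 3; 4; 9] [:: [:: 1; 6; 9]])) (Edge 0 9
  (Edge 0 8 (Kur (K33 [:: 0; 2; 4] [:: 1; 8; 9] [::])) (Edge 3 9 (Kur (K33 [:: 0; 3; 4] [::
  1; 2; 9] [::])) (New 2 3 8 (Kur (K33 [:: 0; 3; 4] [:: 1; 2; 9] [:: [:: 3; 10; 8; 9]])))))
  (New 0 2 8 (Kur (K33 [:: 1; 2; 8] [:: 4; 9; 10] [:: [:: 1; 6; 9]; [:: 1; 0; 10]]))))) (New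
  5 7 8 (Kur (K33 [:: 1; 5; 9] [:: 2; 4; 6] [:: [:: 5; 10; 7; 6]]))))))) (New 4 5 8 (Kur
  (K33 [:: 1; 2; 10] [:: 4; 5; 9] [:: [:: 1; 6; 9]; [:: 10; 8; 9]]))))) (New 2 4 8 (Edge 5 9
  (Kur (K33 [:: 1; 5; 10] [:: 2; 4; 9] [:: [:: 1; 6; 9]; [:: 10; 8; 9]])) (Edge 5 10 (Kur
  (K5 [:: 1; 2; 4; 5; 10] [:: [:: 1; 6; 9; 8; 10]])) (Edge 2 8 (Edge 5 7 (Kur (K33 [:: 1; 2;
  7] [:: 4; 5; 6] [:: [:: 2; 8; 9; 6]])) (Edge 1 9 (Edge 3 6 (Kur (K33 [:: 1; 4; 6] [:: 2;
  7; 9] [:: [:: 6; 3; 2]])) (Edge 0 10 (Kur (K33 [:: 0; 4; 8] [:: 1; 2; 10] [:: [:: 8; 9;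
  1]])) (Edge 0 9 (Edge 1 10 (Kur (K33 [:: 1; 4; 8] [:: 2; 9; 10] [::])) (Edge 3 8 (Kur (K33
  [:: 0; 1; 8] [:: 2; 3; 9] [::])) (Edge 2 7 (Kur (K33 [:: 1; 2; 4] [:: 5; 7; 9] [:: [:: 2;
  0; 9]])) (New 2 3 10 (Kur (K33 [:: 2; 9; 10] [:: 4; 8; 11] [:: [:: 9; 0; 3; 11]]))))))
  (New 0 6 8 (Kur (K33 [:: 1; 4; 6] [:: 2; 7; 9] [:: [:: 6; 11; 0; 2]])))))) (New 4 5 9 (Kur
  (K33 [:: 1; 2; 11] [:: 4; 5; 9] [:: [:: 1; 6; 9]; [:: 2; 8; 9]]))))) (New 4 5 8 (Kur (K33
  [:: 1; 10; 11] [:: 2; 4; 8] [:: [:: 1; 6; 9; 8]; [:: 11; 5; 2]])))))))))))) (New 4 6 7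
  (Edge 0 7 (Edge 3 7 (Kur (K5 [:: 0; 1; 2; 3; 7] [:: [:: 2; 4; 7]])) (Edge 3 8 (Kur (K33
  [:: 0; 1; 8] [:: 2; 3; 7] [:: [:: 8; 4; 2]])) (New 3 4 6 (Kur (K33 [:: 0; 1; 4] [:: 2; 3;
  7] [:: [:: 4; 9; 3]]))))) (Edge 0 8 (Edge 3 7 (Kur (K33 [:: 0; 2; 7] [:: 1; 3; 8] [:: [::
  2; 4; 8]])) (Edge 3 8 (Kur (K33 [:: 0; 3; 7] [:: 1; 2; 8] [:: [:: 7; 4; 2]])) (New 3 4 6
  (Kur (K33 [:: 1; 8; 9] [:: 3; 6; 7] [:: [:: 8; 0; 3]; [:: 9; 4; 7]]))))) (New 0 4 6 (Edge
  3 7 (Kur (K33 [:: 0; 2; 7] [:: 1; 3; 4] [:: [:: 0; 9; 4]])) (Edge 3 8 (Kur (K33 [:: 1; 4;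
  6] [:: 7; 8; 9] [:: [:: 1; 3; 8]; [:: 1; 0; 9]])) (Edge 3 9 (Kur (K33 [:: 0; 3; 5] [:: 1;
  2; 9] [:: [:: 5; 4; 9]])) (New 3 4 6 (Kur (K33 [:: 0; 1; 4] [:: 2; 3; 9] [:: [:: 1; 6; 9];
  [:: 4; 10; 3]]))))))))))) (Edge 0 7 (Edge 3 7 (Kur (K5 [:: 0; 1; 2; 3; 7] [:: [:: 2; 4;
  7]])) (New 0 3 6 (Kur (K33 [:: 0; 3; 5] [:: 1; 2; 8] [:: [:: 5; 4; 7; 6; 8]])))) (New 0 3
  6 (Kur (K33 [:: 0; 3; 5] [:: 1; 2; 8] [:: [:: 5; 4; 7; 6; 8]])))))))) (New 1 4 5 (Edge 1 4
  (Far 1 (Edge 6 7 (Edge 5 7 (Edge 0 5 (Edge 3 5 (Kur (K5 [:: 0; 1; 2; 3; 5] [::])) (Edge 3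
  6 (Kur (K33 [:: 0; 2; 6] [:: 1; 3; 5] [::])) (New 1 3 4 (Kur (K33 [:: 0; 2; 4] [:: 1; 3;
  5] [:: [:: 4; 8; 3]]))))) (Edge 0 6 (Edge 3 5 (Kur (K33 [:: 0; 1; 5] [:: 2; 3; 6] [::]))
  (Edge 3 6 (Kur (K33 [:: 0; 3; 5] [:: 1; 2; 6] [::])) (New 1 3 4 (Kur (K33 [:: 0; 3; 5] [::
  1; 2; 6] [:: [:: 3; 8; 4; 6]]))))) (New 0 4 7 (Kur (K33 [:: 1; 4; 7] [:: 5; 6; 8] [:: [::
  1; 0; 8]]))))) (Edge 2 6 (Edge 0 6 (Edge 3 6 (Kur (K33 [:: 0; 3; 5] [:: 1; 2; 6] [::]))
  (New 3 4 7 (Kur (K33 [:: 0; 2; 4] [:: 1; 3; 6] [:: [:: 4; 8; 3]])))) (New 0 4 7 (Kur (K33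
  [:: 0; 5; 6] [:: 1; 2; 4] [:: [:: 0; 8; 4]])))) (New 2 4 7 (Kur (K33 [:: 1; 5; 8] [:: 2;
  4; 6] [:: [:: 8; 7; 6]]))))) (New 4 5 7 (Edge 5 7 (Edge 0 5 (Edge 3 5 (Kur (K5 [:: 0; 1;
  2; 3; 5] [::])) (Edge 3 8 (Kur (K5 [:: 0; 1; 2; 3; 5] [:: [:: 3; 8; 5]])) (New 3 4 7 (Kur
  (K33 [:: 0; 2; 4] [:: 1; 3; 5] [:: [:: 4; 9; 3]]))))) (Edge 0 8 (Edge 3 5 (Kur (K5 [:: 0;
  1; 2; 3; 5] [:: [:: 0; 8; 5]])) (Edge 3 8 (Kur (K33 [:: 0; 3; 5] [:: 1; 2; 8] [::])) (New
  3 4 7 (Kur (K33 [:: 0; 4; 5] [:: 1; 3; 8] [:: [:: 4; 9; 3]; [:: 5; 2; 3]]))))) (New 0 4 7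
  (Edge 2 6 (Kur (K33 [:: 0; 5; 6] [:: 1; 2; 4] [:: [:: 0; 9; 4]])) (Edge 3 6 (Kur (K33 [::
  1; 3; 5] [:: 2; 4; 6] [:: [:: 3; 0; 9; 4]])) (Edge 6 9 (Kur (K33 [:: 1; 5; 9] [:: 2; 4; 6]
  [:: [:: 9; 0; 2]])) (New 0 1 6 (Kur (K33 [:: 1; 6; 8] [:: 4; 5; 10] [:: [:: 8; 7; 9; 0;
  10]]))))))))) (New 4 7 8 (Edge 0 8 (Edge 3 8 (Kur (K33 [:: 0; 3; 5] [:: 1; 2; 8] [::]))
  (Edge 3 9 (Kur (K33 [:: 0; 3; 5] [:: 1; 2; 8] [:: [:: 3; 9; 8]])) (New 3 4 7 (Kur (K33 [::
  0; 4; 5] [:: 1; 2; 8] [:: [:: 4; 10; 3; 2]]))))) (Edge 0 9 (Edge 3 8 (Kur (K33 [:: 0; 3;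
  5] [:: 1; 2; 8] [:: [:: 0; 9; 8]])) (Edge 3 9 (Kur (K33 [:: 0; 3; 5] [:: 1; 2; 9] [:: [::
  5; 8; 9]])) (New 3 4 7 (Kur (K33 [:: 0; 3; 5] [:: 1; 2; 8] [:: [:: 0; 9; 8]; [:: 3; 10; 4;
  8]]))))) (New 0 4 7 (Edge 6 10 (Kur (K33 [:: 1; 5; 10] [:: 2; 4; 6] [:: [:: 10; 0; 2]]))
  (Edge 2 6 (Kur (K33 [:: 0; 5; 6] [:: 1; 2; 4] [:: [:: 0; 10; 4]])) (Edge 3 6 (Kur (K33 [::
  1; 2; 6] [:: 3; 4; 5] [:: [:: 2; 0; 10; 4]])) (New 0 6 7 (Kur (K33 [:: 0; 1; 5] [:: 2; 4;
  6] [:: [:: 0; 10; 4]; [:: 0; 11; 6]])))))))))))))) (New 4 5 6 (Edge 0 5 (Edge 3 6 (Kur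
  (K33 [:: 0; 2; 6] [:: 1; 3; 5] [::])) (Edge 3 7 (Kur (K5 [:: 0; 1; 2; 3; 5] [:: [:: 3; 7;
  5]])) (New 3 4 5 (Kur (K5 [:: 0; 1; 2; 3; 5] [:: [:: 3; 8; 5]]))))) (Edge 0 6 (Edge 3 6
  (Kur (K33 [:: 0; 3; 5] [:: 1; 2; 6] [::])) (Edge 3 7 (Kur (K33 [:: 0; 3; 5] [:: 1; 2; 7]
  [:: [:: 0; 6; 7]])) (New 0 3 4 (Kur (K33 [:: 0; 3; 5] [:: 1; 2; 8] [:: [:: 5; 4; 8]])))))
  (New 0 4 7 (Kur (K33 [:: 1; 4; 7] [:: 5; 6; 8] [:: [:: 1; 0; 8]]))))))))))).

(** S_5 with one more vertex is impossible: the pattern asked for is a loop,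
    and only contradictory branches occur. *)
Definition cert_S5_full :=
  Edge 3 4 (Kur (K33 [:: 0; 2; 3] [:: 1; 4; 6] [::])) (Edge 4 5 (Kur (K33 [:: 0; 2; 5] [::
  1; 3; 4] [::])) (Edge 4 6 (Kur (K33 [:: 0; 1; 6] [:: 2; 3; 4] [::])) (Edge 1 7 (Edge 1 6
  (Kur (K5 [:: 0; 1; 2; 3; 6] [::])) (Edge 2 7 (Kur (K33 [:: 0; 1; 2] [:: 3; 4; 7] [::]))
  (Edge 3 7 (Kur (K33 [:: 0; 1; 3] [:: 2; 5; 7] [::])) (Edge 5 6 (Kur (K33 [:: 0; 2; 5] [::
  1; 3; 6] [::])) (New 0 6 7 (Kur (K33 [:: 0; 1; 6] [:: 2; 3; 8] [:: [:: 1; 7; 8]])))))))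
  (Edge 2 7 (Edge 2 5 (Kur (K33 [:: 0; 1; 2] [:: 3; 4; 5] [::])) (Edge 3 7 (Kur (K33 [:: 0;
  2; 3] [:: 1; 6; 7] [::])) (Edge 5 6 (Kur (K33 [:: 0; 1; 6] [:: 2; 3; 5] [::])) (New 0 5 7
  (Kur (K33 [:: 0; 2; 5] [:: 1; 3; 7] [:: [:: 5; 8; 7]])))))) (New 0 4 7 (Edge 5 7 (Kur (K33
  [:: 0; 3; 4] [:: 1; 2; 5] [:: [:: 4; 8; 7; 5]])) (Edge 6 7 (Kur (K33 [:: 0; 3; 4] [:: 1;
  2; 6] [:: [:: 4; 8; 7; 6]])) (Edge 3 8 (Kur (K33 [:: 0; 3; 4] [:: 1; 2; 8] [::])) (New 0 3
  7 (Kur (K33 [:: 0; 3; 4] [:: 1; 2; 8] [:: [:: 3; 9; 7; 8]]))))))))))).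

(** S_7 with one more vertex is impossible. *)
Definition cert_S7_full :=
  Edge 2 5 (Kur (K33 [:: 0; 2; 3] [:: 1; 5; 6] [::])) (Edge 3 4 (Kur (K33 [:: 0; 4; 7] [::
  1; 2; 3] [::])) (Edge 4 6 (Kur (K33 [:: 0; 3; 4] [:: 1; 2; 6] [::])) (Edge 4 7 (Kur (K33
  [:: 0; 2; 7] [:: 1; 3; 4] [::])) (Edge 0 8 (Edge 0 7 (Kur (K33 [:: 0; 1; 3] [:: 2; 5; 7]
  [::])) (Edge 6 7 (Kur (K33 [:: 0; 2; 7] [:: 1; 3; 6] [::])) (Edge 1 8 (Edge 2 8 (Kur (K33
  [:: 0; 1; 2] [:: 3; 4; 8] [::])) (Edge 3 8 (Kur (K33 [:: 0; 1; 3] [:: 2; 5; 8] [::]))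
  (Edge 5 7 (Kur (K33 [:: 0; 1; 7] [:: 2; 3; 5] [::])) (New 1 7 8 (Kur (K33 [:: 0; 1; 7] [::
  2; 3; 8] [:: [:: 7; 9; 8]])))))) (Edge 3 8 (Edge 2 8 (Kur (K33 [:: 0; 2; 3] [:: 1; 6; 8]
  [::])) (Edge 4 5 (Kur (K33 [:: 0; 2; 5] [:: 1; 3; 4] [::])) (New 0 4 8 (Kur (K33 [:: 0; 3;
  4] [:: 1; 2; 9] [:: [:: 3; 8; 9]]))))) (New 2 7 8 (Kur (K33 [:: 0; 2; 7] [:: 1; 3; 9] [::
  [:: 0; 8; 9]]))))))) (Edge 1 8 (Edge 1 6 (Kur (K33 [:: 0; 6; 7] [:: 1; 2; 3] [::])) (Edge
  6 7 (Kur (K33 [:: 0; 2; 7] [:: 1; 3; 6] [::])) (Edge 3 8 (Edge 2 8 (Kur (K33 [:: 0; 7; 8]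
  [:: 1; 2; 3] [::])) (Edge 4 5 (Kur (K33 [:: 0; 2; 5] [:: 1; 3; 4] [::])) (New 1 4 8 (Kur
  (K33 [:: 0; 2; 9] [:: 1; 3; 4] [:: [:: 9; 8; 3]]))))) (New 2 6 8 (Kur (K33 [:: 0; 3; 9]
  [:: 1; 2; 6] [:: [:: 9; 8; 1]])))))) (New 4 5 8 (Kur (K33 [:: 0; 3; 4] [:: 1; 2; 5] [::
  [:: 4; 9; 5]])))))))).

(** For each non-adjacent pair of S_5, a witness that joining it destroys
    planarity. *)
Definition S5_maximal :=
 [::
 ((1, 6), K5 [:: 0; 1; 2; 3; 6] [::]);
 ((2, 5), K5 [:: 0; 1; 2; 3; 5] [::]);
 ((3, 4), K33 [:: 0; 1; 3] [:: 2; 4; 5] [::]);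
 ((4, 5), K33 [:: 0; 3; 4] [:: 1; 2; 5] [::]);
 ((4, 6), K33 [:: 0; 1; 6] [:: 2; 3; 4] [::]);
 ((5, 6), K33 [:: 0; 2; 5] [:: 1; 3; 6] [::])].

(** The same for S_7. *)
Definition S7_maximal :=
 [::
 ((0, 7), K33 [:: 0; 1; 2] [:: 3; 4; 7] [::]);
 ((1, 6), K33 [:: 0; 6; 7] [:: 1; 2; 3] [::]);
 ((2, 5), K33 [:: 0; 1; 2] [:: 3; 4; 5] [::]);
 ((3, 4), K33 [:: 0; 4; 7] [:: 1; 2; 3] [::]);
 ((4, 5), K33 [:: 0; 3; 4] [:: 1; 2; 5] [::]);
 ((4, 6), K33 [:: 0; 3; 4] [:: 1; 2; 6] [::]);
 ((4, 7), K33 [:: 0; 2; 7] [:: 1; 3; 4] [::]);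
 ((5, 6), K33 [:: 0; 1; 6] [:: 2; 3; 5] [::]);
 ((5, 7), K33 [:: 0; 3; 7] [:: 1; 2; 5] [::]);
 ((6, 7), K33 [:: 0; 3; 7] [:: 1; 2; 6] [::])].

Lemma cert_S5_ok : certifies 1 7 S5_edges cert_S5 4 K4_edges [::].
Proof. by vm_compute. Qed.

Lemma cert_S7_ok : certifies 0 8 S7_edges cert_S7 4 K4_edges [::].
Proof. by vm_compute. Qed.

Lemma cert_S5_full_ok : certifies 1 0 [:: (0, 0)] cert_S5_full 8 ((0, 7) :: S5_edges) [::].
Proof. by vm_compute. Qed.

Lemma cert_S7_full_ok : certifies 0 0 [:: (0, 0)] cert_S7_full 9 S7_edges [::].
Proof. by vm_compute. Qed.

(** * Cycles and linear forests *)

Section Trails.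
Variables (T : finType) (e : rel T).
Hypotheses (e_sym : symmetric e) (e_irr : irreflexive e).

(** x :: p is a path without repetitions. *)
Definition trail x p := uniq (x :: p) && path e x p.

Lemma trail_rev x p : trail x p -> trail (last x p) (rev (belast x p)).
Proof.
rewrite /trail rev_path -rev_rcons -lastI rev_uniq => /andP[-> xp] /=.
by rewrite (eq_path (e' := e)) // => u v; exact: e_sym.
Qed.

(** Every trail extends at its origin to one whose origin has all its
    neighbours on the trail.  The fourth clause says that the extension stays
    in the connected component. *)
Lemma maximal_trail x p : trail x p -> exists x' q,
  [/\ trail x' q, {subset x :: p <= x' :: q}, last x' q = last x p,
      forall A : pred T, (forall u v, A u -> e u v -> A v) ->
        all A (x :: p) -> all A (x' :: q) &
      forall y, e x' y -> y \in x' :: q].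
Proof.
have [n] := ubnP (#|T| - size p); elim: n x p => // n IH x p lt /andP[up xp].
have [/existsP[y /andP[xy yp]]|max] := boolP [exists y, e x y && (y \notin x :: p)].
  have up' : uniq (y :: x :: p) by rewrite /= yp; exact: up.
  have := max_card (mem (y :: x :: p)); rewrite (card_uniqP up') /= => le.
  have [||x' [q [tr sub ls inv mx]]] := IH y (x :: p).
  - by move: lt le => /=; lia.
  - by rewrite /trail up' /= e_sym xy.
  exists x', q; split=> //.
    by move=> z zp; apply: sub; rewrite in_cons zp orbT.
  by move=> A cl /= /andP[Ax Ap]; apply: inv => //=; rewrite Ax Ap (cl x y).
exists x, p; split=> //; first by rewrite /trail up.
move=> y xy; apply: contraNT max => yp; apply/existsP; exists y.
by rewrite xy.
Qed.

Lemma cycle_of_min_degree2 x0 y0 : e x0 y0 ->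
  (forall x y, e x y -> exists2 z, z != y & e x z) ->
  exists x p, [/\ trail x p, 1 < size p & e (last x p) x].
Proof.
move=> xy0 deg2.
have [//|x [q [/andP[uq xq] sub _ _ mx]]] := @maximal_trail x0 [::].
have x0q : x0 \in x :: q by apply: sub; rewrite inE.
case: q => [|y q] in uq xq sub mx x0q.
  move: x0q mx; rewrite inE => /eqP<- /(_ _ xy0); rewrite inE => /eqP yx.
  by rewrite yx e_irr in xy0.
have /andP[xy yq] := xq.
have [z zy xz] := deg2 _ _ xy.
have : z \in q.
  have := mx _ xz; rewrite !in_cons (negPf zy) => /or3P[/eqP zx||]//.
  by rewrite zx e_irr in xz.
move=> /splitPr zq; case: zq => q1 q2 in uq xq sub mx x0q yq *.
exists x, (y :: rcons q1 z); split=> //.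
- apply/andP; split.
    by move: uq; rewrite -cat_rcons -!cat_cons cat_uniq => /andP[].
  by move: xq; rewrite -cat_rcons -cat_cons cat_path => /andP[].
- by rewrite /= size_rcons.
- by rewrite /= last_rcons e_sym.
Qed.

Hypothesis deg2 : forall x y z w, e x y -> e x z -> e x w -> ~~ uniq [:: y; z; w].
Hypothesis acyclic : forall x p, trail x p -> 1 < size p -> ~~ e (last x p) x.

(** In an acyclic graph a trail has no chords. *)
Lemma trail_consecutive x p y z : trail x p -> y \in x :: p -> z \in x :: p ->
  e y z -> index y (x :: p) < index z (x :: p) ->
  (index y (x :: p)).+1 = index z (x :: p).
Proof.
(* Naming the list x :: p keeps it from being split during the case analysis. *)
have [s sE] : {s | s = x :: p} by exists (x :: p).
rewrite /trail -sE => /andP[us].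
have -> : path e x p = sorted e s by rewrite sE.
move=> ss ys; case/splitPr: ys us ss => s1 s2 us ss.
have yi : index y (s1 ++ y :: s2) = size s1.
  rewrite index_cat /= eqxx addn0; case: ifP => // ys1.
  by move: us; rewrite uniq_catC /= mem_cat ys1 orbT.
rewrite yi => zs yz lt.
have zs2 : z \in s2.
  move: zs lt; rewrite mem_cat in_cons => /or3P[zs1|/eqP zy|//].
    by rewrite index_cat zs1 ltnNge => /negP[]; rewrite ltnW// index_mem.
  by rewrite zy e_irr in yz.
case/splitPr: zs2 us ss zs lt yi => s3 s4 us ss _ _ _.
have uyz : uniq (y :: rcons s3 z).
  by move: us; rewrite cat_uniq -(cat_rcons z) -cat_cons cat_uniq => /and3P[_ _ /andP[]].
have pyz : path e y (rcons s3 z).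
  move: ss; rewrite -(cat_rcons z); case: s1 {us} => [|u s1] /=.
    by rewrite cat_path => /andP[].
  by rewrite cat_path /= cat_path => /and3P[_ _ /andP[]].
have := @acyclic y (rcons s3 z); rewrite /trail uyz pyz size_rcons last_rcons e_sym yz.
case: s3 us {ss uyz pyz} => [|u s3] us; last by move=> /(_ isT isT).
move=> _; rewrite index_cat; case: ifP => zs1.
  by move: us; rewrite uniq_catC /= !mem_cat !inE zs1 /= !orbT andbF.
by rewrite /= eqxx; case: eqP yz => [->|_ _]; rewrite ?e_irr// addn1.
Qed.

(** A graph without cycles and with all degrees at most 2 is a disjoint union of
    paths, so its vertices can be listed with adjacent ones consecutive. *)
Lemma linear_forest_order (A : {set T}) :
  (forall x y, x \in A -> e x y -> y \in A) ->
  exists s, [/\ uniq s, s =i A & forall x y, x \in A -> e x y ->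
     (index x s).+1 = index y s \/ (index y s).+1 = index x s].
Proof.
have [n] := ubnP #|A|; elim: n A => // n IH A lt closed.
have [->|[x0 x0A]] := set_0Vmem A.
  by exists [::]; split=> // x; [rewrite !inE|move=> y; rewrite inE].
have [//|x1 [q1 [tr1 sub1 _ inv1 mx1]]] := @maximal_trail x0 [::].
have [|x [p [tr sub ls inv mx]]] := @maximal_trail (last x1 q1) (rev (belast x1 q1)).
  exact: trail_rev.
have same1 : rev (x1 :: q1) = last x1 q1 :: rev (belast x1 q1).
  by rewrite lastI rev_rcons.
have pA : {subset x :: p <= A}.
  have := inv1 [in A] closed; rewrite /= x0A => /(_ isT) A1.
  apply/allP/inv => //; rewrite -same1 all_rev; exact: A1.
have mx_last y : e (last x p) y -> y \in x :: p.
  have -> : last x p = x1.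
    by rewrite ls; case: (q1) => // u q; rewrite /= rev_cons last_rcons.
  by move=> /mx1 yq; apply: sub; rewrite -same1 mem_rev.
have /andP[up xp] := tr.
have closed_t y z : y \in x :: p -> e y z -> z \in x :: p.
  have [t tE] : {t | t = x :: p} by exists (x :: p).
  move: mx mx_last up; rewrite -tE => mx mx_last ut yt yz.
  case/splitPr: yt tE ut mx mx_last => t1 t2 tE ut mx mx_last.
  case: t1 => [|t0 t1] in tE ut mx mx_last *.
    by case: tE => xy _; apply: mx; rewrite -xy.
  case: t2 => [|v t2] in tE ut mx mx_last *.
    by case: tE => _ pE; apply: mx_last; rewrite -pE last_cat.
  have [->|zv] := eqVneq z v; first by rewrite mem_cat !in_cons eqxx !orbT.
  case: tE => xt0 pE; move: xp; rewrite -pE cat_path /= => /and4P[_ uy yv _].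
  have := deg2 (x := y) (y := last x t1) (z := v) (w := z).
  rewrite e_sym uy yv yz => /(_ isT isT isT).
  rewrite /= !inE (eq_sym v z) zv !andbT negbK.
  have ut1 : last x t1 \in t0 :: t1 by rewrite -xt0 mem_last.
  case/orP => [/eqP ev|/eqP <-].
  - move: ut; rewrite cat_uniq => /and3P[_ /hasPn/(_ v)].
    by rewrite in_cons mem_head orbT => /(_ isT)/negP[]; rewrite -ev.
  - by rewrite -in_cons -cat_cons mem_cat ut1.
have [||s [us sA cs]] := IH (A :\: [set z in x :: p]).
- apply: leq_trans (_ : #|A| <= n); last by rewrite -ltnS.
  apply: proper_card; apply/properP; split; first exact: subsetDl.
  by exists x; [rewrite pA ?mem_head|rewrite !inE eqxx].
- move=> y z; rewrite !inE -!in_cons => /andP[yp yA] yz.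
  rewrite (closed _ _ yA yz) andbT; apply: contra yp => zp.
  by apply: closed_t zp _; rewrite e_sym.
exists ((x :: p) ++ s); split.
- rewrite cat_uniq up us andbT; apply/hasPn => y; rewrite sA !inE -in_cons.
  by case/andP.
- by move=> y; rewrite mem_cat sA !inE -in_cons; case: (boolP (y \in _)) => //= /pA.
move=> y z yA yz; have zA := closed _ _ yA yz.
rewrite !index_cat; case: ifP => yp.
  have zp := closed_t _ _ yp yz; rewrite zp.
  have [lt'|lt'|E] := ltngtP (index y (x :: p)) (index z (x :: p)).
  - by left; apply: trail_consecutive.
  - by right; apply: trail_consecutive; rewrite // e_sym.
  - have yz' : y = z by rewrite -(nth_index x yp) E nth_index.
    by rewrite yz' e_irr in yz.
case: ifP => zp; first by rewrite (closed_t z y) // in yp; rewrite e_sym.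
have := cs y z _ yz; rewrite !inE -in_cons yp yA => /(_ isT).
by case=> [<-|<-]; [left|right]; rewrite addnS.
Qed.
End Trails.

(** * Forbidden configurations *)

Section Forbidden.
Variables (R : realType) (V : finType) (G : sgraph V).
Hypothesis Gplanar : planar R G.

(** A list of vertices whose adjacencies include a certified non-planar graph
    cannot occur. *)
Lemma planar_refute x0 (s : seq V) E w : uniq s ->
  all (fun e => G (nth x0 s e.1) (nth x0 s e.2)) E ->
  check_kuratowski (size s) E w -> False.
Proof.
move=> us /allP sE; apply: (check_kuratowski_sound Gplanar (f := nth x0 s) (N := [::])).
split=> // i j; rewrite !inE => si sj /eqP; rewrite nth_uniq// => /eqP//.
Qed.

Lemma no_K33 (A B : seq V) : uniq A -> uniq B -> size A = 3 -> size B = 3 ->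
  {in A & B, forall a b, G a b} -> False.
Proof.
case: A => [|a0 [|a1 [|a2 []]]] //; case: B => [|b0 [|b1 [|b2 []]]] // uA uB _ _ AB.
have adj i j : i < 3 -> j < 3 -> G (nth a0 [:: a0; a1; a2] i) (nth a0 [:: b0; b1; b2] j).
  by move=> i3 j3; apply: AB; rewrite mem_nth.
apply: (@planar_refute a0 [:: a0; a1; a2; b0; b1; b2]
  [:: (0, 3); (0, 4); (0, 5); (1, 3); (1, 4); (1, 5); (2, 3); (2, 4); (2, 5)]
  (K33 [:: 0; 1; 2] [:: 3; 4; 5] [::])) => //.
  rewrite (cat_uniq [:: a0; a1; a2] [:: b0; b1; b2]) uA uB andbT.
  apply/hasPn => b bB; apply/negP => /(AB b b)/(_ bB); by rewrite adj_irr.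
by rewrite /= (adj 0 0)// (adj 0 1)// (adj 0 2)// (adj 1 0)// (adj 1 1)// (adj 1 2)//
  (adj 2 0)// (adj 2 1)// (adj 2 2).
Qed.

(** The vertices in the list are pairwise adjacent (hence distinct). *)
Definition clique (s : seq V) := pairwise G s.

Lemma clique_uniq s : clique s -> uniq s.
Proof.
elim: s => //= x s IH /andP[/allP xs /IH ->]; rewrite andbT.
by apply/negP => /xs; rewrite adj_irr.
Qed.

Lemma no_K5 s : clique s -> size s = 5 -> False.
Proof.
move=> cs; have us := clique_uniq cs.
case: s cs us => [|a [|b [|c [|d [|e []]]]]] //=.
rewrite !andbT => /and4P[/and4P[ab ac ad ae] /and3P[bc bd be] /andP[cd ce] de] us _.
apply: (@planar_refute a [:: a; b; c; d; e]
  [:: (0, 1); (0, 2); (0, 3); (0, 4); (1, 2); (1, 3); (1, 4); (2, 3); (2, 4); (3, 4)]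
  (K5 (iota 0 5) [::])) => //; first by rewrite /= andbT.
by rewrite /= ab ac ad ae bc bd be cd ce de.
Qed.

(** Two adjacent vertices c, d joined to a cycle x, x1, x2, x3, ... are not
    planar: c, x, x2 and d, x1, x3 are the branch vertices of a subdivision of
    K_{3,3}, in which x is joined to x3 by the rest of the cycle.  A triangle
    gives K_5. *)
Lemma no_K2_join_cycle c d x p : G c d -> trail G x p -> 1 < size p -> G (last x p) x ->
  all (G c) (x :: p) -> all (G d) (x :: p) -> False.
Proof.
move=> cd /andP[up xp] p2 lx cp dp.
case: p => [|x1 [|x2 p]] // in up xp p2 lx cp dp *.
have ucd : uniq [:: c, d, x, x1, x2 & p].
  apply/and3P; split; last exact: up.
    rewrite in_cons negb_or; apply/andP; split.
      by apply/eqP => cd'; rewrite cd' adj_irr in cd.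
    by apply/negP => /(allP cp); rewrite adj_irr.
  by apply/negP => /(allP dp); rewrite adj_irr.
move: cp dp xp => /= /and4P[cx cx1 cx2 cp] /and4P[dx dx1 dx2 dp] /and3P[xx1 x12 xp].
case: p => [|x3 p] in up p2 lx ucd cp dp xp *.
  apply: (@no_K5 [:: c; d; x; x1; x2]) => //.
  by rewrite /clique /= cd cx cx1 cx2 dx dx1 dx2 xx1 x12 adj_sym lx.
move: xp cp dp => /= /andP[x23 xp] /andP[cx3 _] /andP[dx3 _].
have back : path G x (rev (x3 :: p)).
  have := rev_path G x3 (rcons p x); rewrite last_rcons belast_rcons => ->.
  by rewrite (eq_path (e' := G)) => [|u v]; rewrite ?rcons_path ?xp// adj_sym.
(* The walk from x to x3 is the rest of the cycle, run backwards. *)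
pose a i := match i with 0 => c | 1 => x | _ => x2 end.
pose b i := match i with 0 => d | 1 => x1 | _ => x3 end.
pose P i j := match i, j with 1, 2 => rev (x3 :: p) | _, _ => [:: b j] end.
apply: (@no_K33_walks _ _ _ Gplanar a b P).
  have edge u v : G u v -> joins G u [:: v] v by rewrite /joins /= eqxx => ->.
  case=> [|[|[|i]]] [|[|[|j]]] //= _ _; rewrite /P /a /b; try (apply: edge => //;
    by rewrite adj_sym).
  by rewrite /joins back /= rev_cons last_rcons.
have short s u v : u \notin s -> v \notin s -> ~~ has (mem s) [:: u; v].
  by move=> us vs; rewrite /= orbF; apply/norP; split.
move: ucd; rewrite /= !inE !negb_or.
case/and5P => /and5P[? ? ? ? /andP[? ?]] /and5P[? ? ? ? ?] /and4P[? ? ? ?]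
  /and3P[? ? ?] /and3P[/andP[? ?] ? _].
case=> [|[|i]] [|[|[|j]]] [|[|[|i']]] [|[|[|j']]] // /andP[lt1 lt2] // _ _ _;
  rewrite /P /a /b; first [apply: short
    | rewrite -[_ || _]/(has (mem _) (x :: rev (x3 :: p))) has_sym; apply: short];
  rewrite !inE ?mem_rev ?inE !negb_or;
  repeat match goal with
  | H : is_true (?a != ?b) |- context [?a == ?b] => rewrite (negPf H)
  | H : is_true (?a != ?b) |- context [?b == ?a] => rewrite (eq_sym b a) (negPf H)
  | H : is_true (?a \notin ?s) |- context [?a \in ?s] => rewrite (negPf H)
  end => //.
Qed.
End Forbidden.

(** * Graphs in which no n vertices have exactly one common neighbour *)

Section Counts.
Variables (V : finType) (G : sgraph V).

(** The set of common neighbours of the vertices of a list. *)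
Definition commons (s : seq V) : {set V} := [set w | all (G w) s]%SET.

Lemma common_countsP n a : common_counts G n a <->
  exists s, [/\ uniq s, size s = n & #|commons s| = a].
Proof.
have E (u : n.-tuple V) : common_neighbours G u = commons u.
  apply/setP => w; rewrite !inE; apply/forallP/allP => [h x /tnthP[i ->]|h i].
    by rewrite adj_sym.
  by rewrite adj_sym h// mem_tnth.
split=> [[u uu ua]|[s [us sn sa]]].
  by exists u; split; rewrite ?size_tuple// -E.
by exists (Tuple (introT eqP sn)); rewrite ?E.
Qed.
End Counts.

Section Second.
Variables (R : realType) (V : finType) (G : sgraph V).
Hypothesis Gplanar : planar R G.

(** A common neighbour of n distinct vertices is never the only one. *)
Definition all_second n := forall v s, uniq s -> size s = n -> all (G v) s ->
  exists2 w, w != v & all (G w) s.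

(** The common neighbourhood of two adjacent vertices c, d contains no vertex of
    degree 1, since a neighbour w of u there is a common neighbour of c, d, u,
    and so is some other vertex. *)
Lemma second_no_K4 : all_second 3 -> forall s, clique G s -> size s = 4 -> False.
Proof.
move=> second [|c [|d [|x [|y []]]]] // cl _; move: cl; rewrite /clique /= !andbT.
move=> /and3P[/and3P[cd cx cy] /andP[dx dy] xy].
pose e u w := [&& G u w, G c u && G d u & G c w && G d w].
have e_sym : symmetric e by move=> u w; rewrite /e adj_sym; congr (_ && _); exact: andbC.
have e_irr : irreflexive e by move=> u; rewrite /e adj_irr.
have [||z [p [/andP[up zp] p2 lz]]] := @cycle_of_min_degree2 V e e_sym e_irr x y.
- by rewrite /e xy cx cy dx dy.
- move=> u w /and3P[uw /andP[cu du] /andP[cw dw]].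
  have cliq : clique G [:: c; d; u] by rewrite /clique /= cd cu du.
  have [|w' w'w] := second w [:: c; d; u] (clique_uniq cliq) (erefl _).
    by rewrite /= ![G w _]adj_sym cw dw uw.
  rewrite /= andbT => /and3P[w'c w'd w'u]; exists w' => //.
  by rewrite /e ![G _ w']adj_sym w'c w'd w'u cu du.
have Ge : subrel e G by move=> u w /andP[].
have inN : all (fun u => G c u && G d u) (z :: p).
  case: p zp {up lz} p2 => //= u p /andP[zu up] _.
  have /and3P[_ -> ->] := zu.
  elim: p u {zu} up => //= w p IH u /andP[uw /IH ->].
  by have /and3P[_ _ ->] := uw.
apply: (no_K2_join_cycle Gplanar cd (x := z) (p := p)) => //.
- by rewrite /trail up (sub_path Ge).
- exact: Ge.
- by apply: sub_all inN => u /andP[].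
- by apply: sub_all inN => u /andP[].
Qed.

(** This lemma and the next one serve when v is adjacent to a, b, c, d and wx is
    a second common neighbour of the three vertices other than x.  If all four
    wx are new vertices, then v, wd, d and a, b, c are the branch vertices of a
    subdivision of K_{3,3}, where d reaches a, b, c through wb, wc, wa. *)
Lemma four_outside v a b c d wa wb wc wd : uniq [:: v; a; b; c; d; wd; wa; wb; wc] ->
  all (G v) [:: a; b; c] -> all (G wd) [:: a; b; c] -> all (G wa) [:: b; c; d] ->
  all (G wb) [:: a; c; d] -> all (G wc) [:: a; b; d] -> False.
Proof.
move=> us /and4P[va vb vc _] /and4P[da db dc _] /and4P[ab ac ad _].
move=> /and4P[ba bc bd _] /and4P[ca cb cd _].
apply: (@planar_refute _ _ _ Gplanar v [:: v; a; b; c; d; wd; wa; wb; wc]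
  [:: (0, 1); (0, 2); (0, 3); (5, 1); (5, 2); (5, 3); (6, 3); (6, 4);
      (7, 1); (7, 4); (8, 2); (8, 4)]
  (K33 [:: 0; 5; 4] [:: 1; 2; 3] [:: [:: 4; 7; 1]; [:: 4; 8; 2]; [:: 4; 6; 3]])) => //.
by rewrite /= va vb vc da db dc ac ad ba bd cb cd.
Qed.

(** If wd is d itself, then v, wa, a and b, c, d are the branch vertices; a
    reaches b and c through wc and wb. *)
Lemma one_inside v a b c d wa wb wc : uniq [:: v; a; b; c; d; wa; wb; wc] ->
  all (G v) [:: b; c; d] -> G a d -> all (G wa) [:: b; c; d] ->
  all (G wb) [:: a; c] -> all (G wc) [:: a; b] -> False.
Proof.
move=> us /and4P[vb vc vd _] ad /and4P[ab ac wad _].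
move=> /and3P[ba bc _] /and3P[ca cb _].
apply: (@planar_refute _ _ _ Gplanar v [:: v; a; b; c; d; wa; wb; wc]
  [:: (0, 2); (0, 3); (0, 4); (5, 2); (5, 3); (5, 4); (1, 4);
      (6, 1); (6, 3); (7, 1); (7, 2)]
  (K33 [:: 0; 5; 1] [:: 2; 3; 4] [:: [:: 1; 6; 3]; [:: 1; 7; 2]])) => //.
by rewrite /= vb vc vd ab ac wad ad ba bc ca cb.
Qed.

(** Distinctness of two vertices, because they would otherwise violate an
    adjacency or non-adjacency at hand. *)
Ltac adj_neq :=
  let E := fresh "E" in apply/eqP => E; subst;
  match goal with
  | H : is_true (adj _ ?x ?x) |- _ => by rewrite adj_irr in H
  | H : is_true (adj _ ?x ?y), H' : is_true (~~ adj _ ?x ?y) |- _ =>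
      by rewrite H in H'
  end.

Ltac neq := first [assumption | rewrite eq_sym; assumption | adj_neq].

Ltac uniq_neq := rewrite /= !inE !negb_or !andbT; repeat (apply/andP; split); neq.

Ltac adj_all := rewrite /= ?inE ?negb_or ?andbT; repeat (apply/andP; split);
  first [assumption | neq].

(** The situation of [one_inside]: d is the second common neighbour of x, y, z,
    and in the absence of a K_4 none of x, y, z is adjacent to the other two and
    to d. *)
Lemma own_second v x y z d wx wy wz :
  (forall s, clique G s -> size s = 4 -> False) ->
  uniq [:: x; y; z] -> all (G v) [:: x; y; z; d] -> all (G d) [:: x; y; z] ->
  all (G wx) [:: y; z; d] -> ~~ G wx x -> wx != v ->
  all (G wy) [:: x; z; d] -> ~~ G wy y -> wy != v ->
  all (G wz) [:: x; y; d] -> ~~ G wz z -> wz != v -> False.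
Proof.
move=> noK4; rewrite /= !inE !negb_or !andbT => /andP[/andP[xy xz] yz].
move=> /and4P[vx vy vz vd] /and3P[dx dy dz].
move=> /and3P[xwy xwz xwd] nx xv /and3P[ywx ywz ywd] ny yv /and3P[zwx zwy zwd] nz zv.
have K p q : G v p -> G v q -> G d p -> G d q -> G p q -> False.
  move=> vp vq dp dq pq; apply: (noK4 [:: v; d; p; q]) => //.
  by rewrite /clique /= vd vp vq dp dq pq.
have wxx : wx != x by apply/eqP => E; subst wx; exact: (K x y).
have wyy : wy != y by apply/eqP => E; subst wy; exact: (K y x).
have wzz : wz != z by apply/eqP => E; subst wz; exact: (K z x).
apply: (@one_inside v x y z d wx wy wz).
- uniq_neq.
- by rewrite /= vy vz vd.
- by rewrite adj_sym.
- by rewrite /= xwy xwz xwd.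
- by rewrite /= ywx ywz.
- by rewrite /= zwx zwy.
Qed.

(** Otherwise the second common neighbours of the four triples of {a, b, c, d}
    are distinct, and at most one of them can belong to {a, b, c, d}. *)
Lemma second_superset v a b c d w : all_second 3 -> uniq [:: a; b; c; d] ->
  all (G v) [:: a; b; c; d] -> all (G w) [:: a; b; c] -> w != v -> G w d.
Proof.
move=> second u4 v4 w3 wv; have noK4 := second_no_K4 second.
move: (u4) (v4) (w3); rewrite /= !inE !negb_or !andbT.
move=> /and3P[/and3P[ab ac ad] /andP[bc bd] cd] /and4P[va vb vc vd] /and3P[wa wb wc].
apply: contraT => nw.
have sec p q r : G v p -> G v q -> G v r -> uniq [:: p; q; r] ->
    exists2 w', w' != v & all (G w') [:: p; q; r].
  by move=> vp vq vr us; apply: second; rewrite //= vp vq vr.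
have K p q r w' : G v p -> G v q -> G v r -> G w p -> G w q -> G w r ->
    G w' p -> G w' q -> G w' r -> w' != v -> w' != w -> uniq [:: p; q; r] -> False.
  move=> vp vq vr wp wq wr wp' wq' wr' w'v w'w us.
  apply: (no_K33 Gplanar (A := [:: v; w; w']) _ us) => //.
    by rewrite /= !inE !negb_or eq_sym wv (eq_sym v) w'v eq_sym w'w.
  by move=> s t; rewrite !inE => /or3P[]/eqP-> /or3P[]/eqP->.
have [|yc ycv] := sec a b d va vb vd; first by uniq_neq.
have [|yb ybv] := sec a c d va vc vd; first by uniq_neq.
have [|ya yav] := sec b c d vb vc vd; first by uniq_neq.
rewrite /= !andbT => /and3P[yab yac yad] /and3P[yba ybc ybd] /and3P[yca ycb ycd].
have abc : uniq [:: a; b; c] by uniq_neq.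
have nc : ~~ G yc c.
  by apply/negP => ycc; apply: (K a b c yc) => //; adj_neq.
have nb : ~~ G yb b.
  by apply/negP => ybb; apply: (K a b c yb) => //; adj_neq.
have na : ~~ G ya a.
  by apply/negP => yaa; apply: (K a b c ya) => //; adj_neq.
have [wd|wd] := eqVneq w d.
  subst w; exfalso; apply: (@own_second v a b c d ya yb yc) => //; adj_all.
have [ycE|ycc] := eqVneq yc c.
  subst yc; exfalso; apply: (@own_second v a b d c ya yb w) => //; adj_all.
have [ybE|ybb] := eqVneq yb b.
  subst yb; exfalso; apply: (@own_second v a c d b ya yc w) => //; adj_all.
have [yaE|yaa] := eqVneq ya a.
  subst ya; exfalso; apply: (@own_second v b c d a yb yc w) => //; adj_all.
exfalso; apply: (@four_outside v a b c d ya yb yc w) => //; adj_all.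
Qed.

Lemma second_superset_n n v S w x : 3 <= n -> all_second n -> uniq S -> size S = n ->
  all (G v) S -> all (G w) S -> w != v -> G v x -> G w x.
Proof.
move=> n3 second uS Sn vS wS wv vx.
have [xS|xS] := boolP (x \in S); first exact: (allP wS).
case: (ltngtP n 3) n3 => // [n4|nE] _.
  case: S uS Sn vS wS xS => [|s0 S]; first by move=> _ /= Sn; rewrite -Sn in n4.
  move=> /= /andP[s0S uS] Sn /andP[vs0 vS] /andP[ws0 wS].
  rewrite in_cons negb_or => /andP[xs0 xS].
  have [|||w' w'v /= /andP[w'x w'S]] := second v (x :: S); rewrite /= ?xS ?vx//.
  have [<-//|w'w] := eqVneq w' w.
  exfalso; apply: (no_K33 Gplanar (A := [:: v; w; w']) (B := take 3 S)).
  - by rewrite /= !inE !negb_or eq_sym wv (eq_sym v) w'v eq_sym w'w.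
  - exact: take_uniq.
  - by [].
  - by rewrite size_takel// -ltnS Sn.
  - move=> s t + /mem_take tS; rewrite !inE => /or3P[]/eqP->.
    + exact: (allP vS).
    + exact: (allP wS).
    + exact: (allP w'S).
rewrite nE in Sn second.
case: S uS Sn vS wS xS => [|a [|b [|c []]]] // uS _ vS wS xS.
apply: (@second_superset v a b c x) => //.
  by rewrite -[[:: a; b; c; x]]/(rcons [:: a; b; c] x) rcons_uniq xS.
by rewrite -[[:: a; b; c; x]]/(rcons [:: a; b; c] x) all_rcons vx.
Qed.

(** By the preceding lemma some w other than v has N(v) included in N(w), and
    some w' other than w has N(w) included in N(w').  As K_{3,3} is excluded,
    w' is v. *)
Lemma second_twins n : 3 <= n -> all_second n -> twins_from n G.
Proof.
move=> n3 second.
have sup v : n <= degree G v -> exists2 w, w != v & forall x, G v x -> G w x.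
  rewrite /degree => dv.
  have [|||w wv wS] := second v (take n (enum (neighbours G v))).
  - by rewrite take_uniq// enum_uniq.
  - by rewrite size_takel// -cardE.
  - by apply/allP => x /mem_take; rewrite mem_enum inE.
  exists w => // x; apply: (second_superset_n n3 second _ _ _ wS wv).
  - by rewrite take_uniq// enum_uniq.
  - by rewrite size_takel// -cardE.
  - by apply/allP => y /mem_take; rewrite mem_enum inE.
move=> v dv; have [w wv vw] := sup v dv; exists w => //.
have dw : n <= degree G w.
  apply: leq_trans dv _; apply: subset_leq_card; apply/fintype.subsetP => x.
  by rewrite !inE; exact: vw.
have [w' w'w ww'] := sup w dw.
suff w'v : w' = v.
  by apply/setP => x; rewrite !inE; apply/idP/idP => [/ww'|/vw]; rewrite ?w'v.
apply/eqP/contraT => w'v; exfalso.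
have sub x : x \in take 3 (enum (neighbours G v)) -> G v x.
  by move/mem_take; rewrite mem_enum inE.
apply: (no_K33 Gplanar (A := [:: v; w; w']) (B := take 3 (enum (neighbours G v)))).
- by rewrite /= !inE !negb_or eq_sym wv (eq_sym v) w'v eq_sym w'w.
- by rewrite take_uniq// enum_uniq.
- by [].
- by rewrite size_takel// -cardE (leq_trans n3).
- move=> s t + /sub vt; rewrite !inE => /or3P[]/eqP-> //; first exact: vw.
  exact/ww'/vw.
Qed.
End Second.

(** * Graphs given by an edge list on natural numbers *)

Lemma isomorphic_of_inj (V W : finType) (G : sgraph V) (H : sgraph W) (g : W -> V) :
  injective g -> #|V| <= #|W| -> (forall x y, G (g x) (g y) = H x y) -> isomorphic G H.
Proof.
move=> ginj VW gH; have [h gK hK] := inj_card_bij ginj VW.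
exists h; first by exists g.
by move=> x y; rewrite -gH !hK.
Qed.

Section Coded.
Variables (W : finType) (H : sgraph W) (code : W -> nat) (k : nat) (E : seq (nat * nat)).
Hypothesis code_inj : injective code.
Hypothesis code_lt : forall x, code x < k.
Hypothesis code_card : #|W| = k.
Hypothesis code_adj : forall x y, H x y = linked E (code x) (code y).

(** A spanning copy of H in G without additional adjacencies is an
    isomorphism. *)
Lemma coded_isomorphic (V : finType) (G : sgraph V) f :
  realizes G f k E [::] -> #|V| <= k ->
  (forall i j, i < k -> j < k -> ~~ linked E i j -> ~~ G (f i) (f j)) -> isomorphic G H.
Proof.
move=> rf Vk max; have [inj _ _] := rf.
apply: (@isomorphic_of_inj _ _ _ _ (f \o code)); last 1 first.
- move=> x y; rewrite code_adj /=; apply/idP/idP; last exact: realizes_linked rf.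
  by apply: contraTT; exact: max.
- by move=> x y /inj/code_inj; apply; rewrite inE code_lt.
- by rewrite code_card.
Qed.

Lemma coded_commons s :
  #|commons H s| = count (fun i => all (linked E i) [seq code x | x <- s]) (iota 0 k).
Proof.
have perm : perm_eq [seq code x | x <- enum W] (iota 0 k).
  apply: uniq_perm; [by rewrite map_inj_uniq ?enum_uniq|exact: iota_uniq|].
  have [|||_ eqi] := @uniq_min_size _ [seq code x | x <- enum W] (iota 0 k).
  - by rewrite map_inj_uniq ?enum_uniq.
  - by move=> i /mapP[x _ ->]; rewrite mem_iota code_lt.
  - by rewrite size_iota size_map -cardE code_card.
  - exact: eqi.
rewrite -(permP perm) count_map enumT cardE /enum_mem size_filter.
apply: eq_count => w; rewrite !inE /= all_map.
by apply: eq_all => x /=; rewrite code_adj.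
Qed.

End Coded.

(** The labels of a graph obtained from K_4 by attaching k vertices. *)
Definition attach_code k (x : 'I_4 + 'I_k) : nat :=
  match x with inl i => i | inr j => 4 + j end.

Lemma attach_code_inj k : injective (@attach_code k).
Proof.
move=> [i|i] [j|j] /= => [/val_inj->//|E|E|/addnI/val_inj->//].
  by have := ltn_ord i; rewrite E.
by have := ltn_ord j; rewrite -E.
Qed.

Lemma attach_code_lt k x : @attach_code k x < 4 + k.
Proof. by case: x => i /=; [rewrite ltn_addr|rewrite ltn_add2l]. Qed.

Lemma attach_code_card k : #|{: 'I_4 + 'I_k}| = 4 + k.
Proof. by rewrite card_sum !card_ord. Qed.

Lemma S5_code x y : S5 x y = linked S5_edges (attach_code x) (attach_code y).
Proof.
by case: x => [[[|[|[|[|i]]]] Hi]|[[|[|[|i]]] Hi]] //;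
   case: y => [[[|[|[|[|j]]]] Hj]|[[|[|[|j]]] Hj]] //.
Qed.

Lemma S7_code x y : S7 x y = linked S7_edges (attach_code x) (attach_code y).
Proof.
by case: x => [[[|[|[|[|i]]]] Hi]|[[|[|[|[|i]]]] Hi]] //;
   case: y => [[[|[|[|[|j]]]] Hj]|[[|[|[|[|j]]]] Hj]] //.
Qed.

Section Maximal.
Variables (R : realType) (V : finType) (G : sgraph V).
Hypothesis Gplanar : planar R G.

(** Each pair of distinct labels is linked, or comes with a witness that linking
    it destroys planarity. *)
Definition check_maximal k E (ws : seq (nat * nat * kuratowski)) :=
  all (fun i => all (fun j => (i < j) ==> linked E i j ||
    has (fun t => (t.1 == (i, j)) && check_kuratowski k ((i, j) :: E) t.2) ws)
  (iota 0 k)) (iota 0 k).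

Lemma check_maximal_sound f k E ws i j : realizes G f k E [::] ->
  check_maximal k E ws -> i < k -> j < k -> ~~ linked E i j -> ~~ G (f i) (f j).
Proof.
move=> rf /allP chk; wlog ij : i j / i < j => [wl ik jk nij|].
  have [ij|ji|->] := ltngtP i j; last by rewrite adj_irr.
    exact: wl.
  by rewrite adj_sym; apply: wl => //; move: nij; rewrite /linked orbC.
move=> ik jk nij; apply/negP => fij.
have [inj fE _] := rf.
have /(has_nthP (0, 0, K5 [::] [::]))[t _ /andP[_]] :
    has (fun t => (t.1 == (i, j)) && check_kuratowski k ((i, j) :: E) t.2) ws.
  have := chk i; rewrite mem_iota => /(_ ik)/allP/(_ j).
  by rewrite mem_iota => /(_ jk); rewrite ij (negPf nij).
apply: (check_kuratowski_sound Gplanar (f := f) (N := [::])); split=> // e.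
by rewrite in_cons => /predU1P[->|/fE].
Qed.

End Maximal.

(** * Graphs in which any n vertices have a common neighbour *)

Section Dominated.
Variables (V : finType) (G : sgraph V).

(** Any n distinct vertices have a common neighbour. *)
Definition all_dominated n := forall s : seq V, uniq s -> size s = n ->
  exists w, all (G w) s.

Lemma extend_uniq (s : seq V) k : uniq s -> size s <= k <= #|V| ->
  exists t, uniq (s ++ t) /\ size (s ++ t) = k.
Proof.
move=> us /andP[sk kV]; exists (take (k - size s) (enum [predC s])); split.
  rewrite cat_uniq us take_uniq ?enum_uniq// andbT.
  by apply/hasPn => x /mem_take; rewrite mem_enum.
rewrite size_cat size_takel ?subnKC// -cardE.
have := cardC (mem s); rewrite (card_uniqP us) => sV.
by rewrite leq_subLR sV.
Qed.

(** A clique of at most n vertices is part of a set of n vertices, and a common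
    neighbour of the latter enlarges the clique. *)
Lemma dominated_clique n s k : n <= #|V| -> all_dominated n -> clique G s ->
  size s <= k <= n.+1 -> exists t, clique G (s ++ t) /\ size (s ++ t) = k.
Proof.
move=> nV dom cs /andP[sk kn]; have [m] := ubnP (k - size s).
elim: m s cs sk => // m IH s cs sk lt.
have [ks|ks] := eqVneq (size s) k; first by exists [::]; rewrite cats0.
have {}sk : size s < k by rewrite ltn_neqAle ks.
have [|t [ut tn]] := @extend_uniq s n (clique_uniq cs).
  by rewrite nV andbT -ltnS (leq_trans sk).
have [w] := dom _ ut tn; rewrite all_cat => /andP[ws _].
have [||| t' []] := IH (rcons s w).
- rewrite /clique pairwise_rcons; apply/andP; split; last exact: cs.
  by apply/allP => x /(allP ws); rewrite adj_sym.
- by rewrite size_rcons.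
- by move: lt sk; rewrite size_rcons; lia.
by rewrite cat_rcons => ct st; exists (w :: t').
Qed.

End Dominated.

Section DominatedTriples.
Variables (R : realType) (V : finType) (G : sgraph V).
Hypothesis Gplanar : planar R G.

Lemma dominated_small n : 0 < n <= #|V| -> all_dominated G n -> n <= 3.
Proof.
move=> /andP[n0 nV] dom; rewrite leqNgt; apply/negP => n4.
have [//|t [ct st]] := @dominated_clique V G n [::] 5 nV dom isT.
exact: no_K5 Gplanar _ ct st.
Qed.

Hypothesis dom : all_dominated G 3.

Lemma dominated3 x y z : uniq [:: x; y; z] -> exists w, [/\ G x w, G y w & G z w].
Proof.
move=> u; have [w /and4P[wx wy wz _]] := dom u (erefl _).
by exists w; split; rewrite adj_sym.
Qed.

Lemma clique4_realizes x0 t : clique G t -> size t = 4 ->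
  realizes G (nth x0 t) 4 K4_edges [::].
Proof.
move=> ct t4; have ut := clique_uniq ct; split=> //.
  by move=> i j; rewrite !inE -t4 => ti tj /eqP; rewrite nth_uniq// => /eqP.
case: t ct t4 {ut} => [|a [|b [|c [|d []]]]] //; rewrite /clique /= !andbT.
move=> /and3P[/and3P[ab ac ad] /andP[bc bd] cd] _ e.
by rewrite !inE => /or4P[/eqP->|/eqP->|/eqP->|/or3P[]/eqP->].
Qed.

End DominatedTriples.

Section Classification.
Variables (R : realType) (V : finType) (G : sgraph V).
Hypothesis Gplanar : planar R G.
Hypothesis dom : all_dominated G 3.
Hypothesis V3 : 3 <= #|V|.

Lemma spanning_card (f : nat -> V) k :
  (forall v, ~ {in gtn k, forall i, f i != v}) -> #|V| <= k.
Proof.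
move=> all_f; rewrite -(size_iota 0 k) -(size_map f).
apply: leq_trans (card_size _); apply: subset_leq_card.
apply/fintype.subsetP => v _; apply: contraT => nv; case: (all_f v) => i ik.
apply: contra nv => /eqP <-; apply: map_f; rewrite mem_iota; exact: ik.
Qed.

Lemma dominated_S7 : (forall x, exists2 y, y != x & ~~ G x y) -> isomorphic G S7.
Proof.
move=> far.
have [//|t [ct t4]] := @dominated_clique V G 3 [::] 4 V3 dom isT.
case: t ct t4 => // x0 t ct t4.
have d3 := dominated3 dom.
have us_univ u x : u \in [::] -> x != u -> G u x by [].
have others x : x \notin ([::] : seq V) -> exists2 y, y != x & ~~ G x y by [].
have [||||||g [rg _ _]] := @certifies_sound R V G Gplanar d3 [::] us_univ others
  8 S7_edges cert_S7 4 K4_edges [::] (nth x0 (x0 :: t)) _ _ _ _ _ _ cert_S7_ok => //.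
- exact: clique4_realizes.
have max : forall i j, i < 8 -> j < 8 -> ~~ linked S7_edges i j -> ~~ G (g i) (g j).
  move=> i j; apply: (check_maximal_sound Gplanar rg (ws := S7_maximal)).
  by vm_compute.
apply: (coded_isomorphic (@attach_code_inj 4) (@attach_code_lt 4)
  (@attach_code_card 4) S7_code rg _ max).
apply: (@spanning_card g) => v gv.
have rg' : realizes G (extend g 8 v) 9 S7_edges [::].
  by rewrite -[S7_edges]cat0s -[[::]]cat0s; apply: realizes_extend rg _ _ gv _ _ => // e.
have [||||||h [[_ hE _] _ _]] := @certifies_sound R V G Gplanar d3 [::] us_univ others
  0 [:: (0, 0)] cert_S7_full 9 S7_edges [::] (extend g 8 v) _ _ _ _ _ _ cert_S7_full_ok => //.
by have := hE (0, 0) (mem_head _ _); rewrite /= adj_irr.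
Qed.

Lemma dominated_S5 a : (forall x, x != a -> G a x) ->
  (forall x, x != a -> exists2 y, y != x & ~~ G x y) -> isomorphic G S5.
Proof.
move=> univ far.
have [//|t [ct t4]] := @dominated_clique V G 3 [:: a] 4 V3 dom isT.
have d3 := dominated3 dom.
have us_univ u x : u \in [:: a] -> x != u -> G u x by rewrite inE => /eqP->; exact: univ.
have others x : x \notin [:: a] -> exists2 y, y != x & ~~ G x y.
  by rewrite inE; exact: far.
have [||||||g [rg gu _]] := @certifies_sound R V G Gplanar d3 [:: a] us_univ others
  7 S5_edges cert_S5 4 K4_edges [::] (nth a (a :: t)) _ _ _ _ _ _ cert_S5_ok => //.
- by case=> // _; rewrite inE.
- by move=> u; rewrite inE => /eqP->; exists 0.
- exact: clique4_realizes.
have max : forall i j, i < 7 -> j < 7 -> ~~ linked S5_edges i j -> ~~ G (g i) (g j).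
  move=> i j; apply: (check_maximal_sound Gplanar rg (ws := S5_maximal)).
  by vm_compute.
have g0 : g 0 = a by apply/eqP; have := gu 0 isT; rewrite inE.
apply: (coded_isomorphic (@attach_code_inj 3) (@attach_code_lt 3)
  (@attach_code_card 3) S5_code rg _ max).
apply: (@spanning_card g) => v gv.
have gv0 : g 0 != v by exact: gv.
have rg' : realizes G (extend g 7 v) 8 ((0, 7) :: S5_edges) [::].
  rewrite -cat1s -[[::] in X in realizes _ _ _ _ X]cat0s.
  apply: realizes_extend rg _ _ gv _ _ => // e; rewrite inE => /eqP->; split=> //=.
  by rewrite g0 univ// eq_sym -g0.
have [||||||h [[_ hE _] _ _]] := @certifies_sound R V G Gplanar d3 [:: a] us_univ others
  0 [:: (0, 0)] cert_S5_full 8 ((0, 7) :: S5_edges) [::] (extend g 7 v)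
  _ _ _ _ _ _ cert_S5_full_ok => //.
- by case=> // _; rewrite /extend /= g0 inE.
- by move=> u; rewrite inE => /eqP->; exists 0; rewrite // /extend /= g0.
by have := hE (0, 0) (mem_head _ _); rewrite /= adj_irr.
Qed.

Lemma clique4_isomorphic t : clique G t -> size t = 4 -> (forall x, x \in t) ->
  isomorphic G (complete 4).
Proof.
move=> ct t4 tV; have ut := clique_uniq ct.
case: t ct t4 tV ut => // x0 t ct t4 tV ut.
apply: (@isomorphic_of_inj _ _ _ _ (fun i : 'I_4 => nth x0 (x0 :: t) i)).
- by move=> i j /eqP; rewrite nth_uniq ?t4// => /eqP/val_inj.
- rewrite card_ord -t4; apply: leq_trans (card_size _).
  exact/subset_leq_card/fintype.subsetP.
move=> i j; rewrite /= /complete_rel.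
have /pairwiseP h := ct.
have [lt|lt|/val_inj->] := ltngtP i j; last by rewrite adj_irr eqxx.
  by rewrite (h x0) ?inE ?t4// -val_eqE ltn_eqF.
by rewrite adj_sym (h x0) ?inE ?t4// -val_eqE gtn_eqF.
Qed.

(** The vertices other than a and b induce a linear forest: a vertex with three
    neighbours would give a K_{3,3}, and a cycle joined to a, b is not planar.
    None of them is isolated, because it has a common neighbour with a and b. *)
Lemma dominated_T a b : a != b -> (forall x, x != a -> G a x) -> (forall x, x != b -> G b x) ->
  isomorphic G (complete 4) \/ exists2 m, 3 <= m & in_T m G.
Proof.
move=> ab au bu.
pose U := [set~ a]%SET :\ b.
have inU x : (x \in U) = (x != a) && (x != b) by rewrite !inE andbC.
pose e x y := [&& G x y, x \in U & y \in U].
have e_sym : symmetric e by move=> x y; rewrite /e adj_sym; congr (_ && _); exact: andbC.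
have e_irr : irreflexive e by move=> x; rewrite /e adj_irr.
have Ge : subrel e G by move=> x y /andP[].
have aU x : x \in U -> G a x by rewrite inU => /andP[xa _]; exact: au.
have bU x : x \in U -> G b x by rewrite inU => /andP[_ xb]; exact: bu.
have gab : G a b by rewrite au// eq_sym.
have nbr x : x \in U -> exists2 y, e x y & y \in U.
  move=> xU; have [|w [aw bw xw]] := @dominated3 _ _ dom a b x.
    move: xU; rewrite inU /= !inE !negb_or ab andbT => /andP[xa xb].
    by rewrite eq_sym xa eq_sym xb.
  have wU : w \in U.
    by rewrite inU; apply/andP; split; apply/eqP => E; subst w;
       [rewrite adj_irr in aw|rewrite adj_irr in bw].
  by exists w => //; rewrite /e xw xU.
have [|||s [us sU cs]] := @linear_forest_order V e e_sym e_irr _ _ U.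
- move=> x y z w /and3P[xy xU yU] /and3P[xz _ zU] /and3P[xw _ wU]; apply/negP => u.
  apply: (no_K33 Gplanar (A := [:: a; b; x]) (B := [:: y; z; w])) => //.
    move: xU; rewrite inU /= !inE !negb_or ab andbT => /andP[xa xb].
    by rewrite eq_sym xa eq_sym xb.
  move=> p q; rewrite !inE => /or3P[]/eqP-> /or3P[]/eqP-> //;
    by [exact: aU | exact: bU].
- move=> x p /andP[up xp] p2; apply/negP => lx.
  have pU : all [in U] (x :: p).
    case: p xp {up} p2 lx => // y p xp _ _.
    have /andP[/and3P[_ xU _] _] := xp; rewrite /= xU /=.
    elim: p x y xp {xU} => /= [|z p IH] x y /andP[/and3P[_ _ ->]]//.
    exact: IH.
  apply: (no_K2_join_cycle Gplanar gab (x := x) (p := p)) => //.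
  + by rewrite /trail up (sub_path Ge).
  + exact: Ge.
  + by apply: sub_all pU => y; exact: aU.
  + by apply: sub_all pU => y; exact: bU.
- by move=> x y _ /and3P[].
have uabs : uniq [:: a, b & s].
  by rewrite !cons_uniq in_cons (negPf ab) !sU !inU !eqxx us andbF.
have abs x : x \in [:: a, b & s].
  by rewrite !in_cons sU inU; case: eqP => //= _; case: eqP.
have [x0 x0s] : exists x, x \in s.
  apply/existsP; apply: contraLR V3 => /existsPn ns.
  rewrite -ltnNge ltnS.
  apply: leq_trans (card_size [:: a; b]); apply/subset_leq_card/fintype.subsetP => x _.
  by have := abs x; rewrite !in_cons (negPf (ns x)) in_nil.
have [s3|s3] := leqP 3 (size s); [right|left]; last first.
  have [//|t [ct t4]] := @dominated_clique V G 3 [::] 4 V3 dom isT.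
  have ut := clique_uniq ct; apply: (clique4_isomorphic ct) => // x.
  have [|||_ ->//] := @uniq_min_size _ t [:: a, b & s].
  - exact: ut.
  - by move=> y _.
  - by rewrite t4 /= !ltnS -ltnS.
exists (size s) => //; split; first exact: ltnW.
pose at_ (i : 'I_(size s)) := nth a s i.
have at_s i : at_ i \in s by exact: mem_nth.
have at_U i : at_ i \in U by rewrite -sU.
pose H := @SGraph _ (fun i j => G (at_ i) (at_ j)) (fun i j => adj_sym G _ _)
  (fun i => adj_irr G _).
exists H; split.
- move=> i j /= ij; have eij : e (at_ i) (at_ j) by rewrite /e ij !at_U.
  have := cs _ _ (at_U i) eij; rewrite !index_uniq// /path_rel.
  by case=> ->; rewrite eqxx ?orbT.
- move=> i; have [y /and3P[iy _ _] yU] := nbr _ (at_U i).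
  have ys : index y s < size s by rewrite index_mem sU.
  by exists (Ordinal ys); rewrite /= /at_ nth_index// sU.
pose g (x : 'I_(size s) + 'I_2) :=
  match x with inl i => at_ i | inr j => if val j == 0 then a else b end.
apply: (@isomorphic_of_inj _ _ _ _ g).
- have nU (j : 'I_2) : g (inr j) \notin U.
    by rewrite /= inU; case: ifP; rewrite eqxx ?andbF.
  move=> [i|i] [j|j].
  + by move=> /eqP; rewrite nth_uniq// => /eqP/val_inj->.
  + by move=> E; have := nU j; rewrite -E at_U.
  + by move=> E; have := nU i; rewrite E at_U.
  + case: i j => [[|[|i]] Hi] [[|[|j]] Hj] //= => [_|E|E|_].
    * by congr inr; apply: val_inj.
    * by rewrite E eqxx in ab.
    * by rewrite E eqxx in ab.
    * by congr inr; apply: val_inj.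
- rewrite card_sum !card_ord addn2 -[(_).+2]/(size [:: a, b & s]).
  by apply: leq_trans (card_size _); apply/subset_leq_card/fintype.subsetP.
move=> [i|i] [j|j] //=.
- by case: ifP => _; rewrite adj_sym ?aU ?bU.
- by case: ifP => _; rewrite ?aU ?bU.
- case: i j => [[|[|i]] Hi] [[|[|j]] Hj] //=; rewrite /complete_rel -val_eqE /= ?adj_irr//.
  by rewrite adj_sym.
Qed.

Lemma dominated_classification : isomorphic G (complete 4) \/
  exists2 m, 3 <= m & [\/ in_T m G, isomorphic G S5 | isomorphic G S7].
Proof.
pose univ x := [forall y, (y != x) ==> G x y].
have univP x : univ x -> forall y, y != x -> G x y.
  by move=> /forallP u y yx; have := u y; rewrite yx.
have nuniv x : ~~ univ x -> exists2 y, y != x & ~~ G x y.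
  by move=> /forallPn[y]; rewrite negb_imply => /andP[]; exists y.
have [/existsP[a ua]|/existsPn n1] := boolP [exists x, univ x]; last first.
  by right; exists 3 => //; apply: Or33; apply: dominated_S7 => x; exact/nuniv/n1.
have [/existsP[b /andP[ba ub]]|/existsPn n2] := boolP [exists x, (x != a) && univ x].
  have [|K4|[m m3 mT]] := dominated_T _ (univP a ua) (univP b ub).
  - by rewrite eq_sym.
  - by left.
  - by right; exists m => //; apply: Or31.
right; exists 3 => //; apply: Or32; apply: (dominated_S5 (univP a ua)) => x xa.
by apply: nuniv; have := n2 x; rewrite xa.
Qed.

End Classification.

(** * Counts in K_4, S_5, S_7 and the graphs of the class T_m *)

Section Transport.
Variables (V W : finType) (G : sgraph V) (H : sgraph W).

Lemma isomorphic_sym : isomorphic G H -> isomorphic H G.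
Proof.
move=> [f [g fK gK] fG]; exists g; first by exists f.
by move=> x y; rewrite -fG !gK.
Qed.

Lemma isomorphic_counts n a : isomorphic G H -> common_counts G n a -> common_counts H n a.
Proof.
move=> [f [g fK gK] fG] /common_countsP[s [us sn sa]]; apply/common_countsP.
exists [seq f x | x <- s]; split.
- by rewrite map_inj_uniq//; exact: can_inj fK.
- by rewrite size_map.
rewrite -sa -(card_imset _ (can_inj fK)); apply: eq_card => w.
rewrite -[w]gK mem_imset; last exact: can_inj fK.
by rewrite !inE all_map; apply: eq_all => x /=; rewrite fG.
Qed.

End Transport.

Section Models.

Lemma complete_counts m n a : n <= m -> common_counts (complete m) n a <-> a = m - n.
Proof.
move=> nm; have cnt (s : seq 'I_m) : uniq s -> #|commons (complete m) s| = m - size s.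
  move=> us; have := cardC (mem s); rewrite card_ord (card_uniqP us) => sm.
  rewrite -(addKn (size s) #|commons _ _|) -[X in _ = X - _]sm; congr (_ + _ - _).
  apply: eq_card => w; rewrite !inE.
  apply/allP/idP => [h|ws x xs] /=.
    by apply/negP => /h; rewrite /= /complete_rel eqxx.
  by rewrite /complete_rel; apply: contraNneq ws => ->.
split=> [/common_countsP[s [us <- <-]]|->]; first exact: cnt.
have [||t [ut tn]] := @extend_uniq _ ([::] : seq 'I_m) n; rewrite ?card_ord//.
by apply/common_countsP; exists t; rewrite cnt ?tn.
Qed.

(** Any three distinct labels below k have a common neighbour. *)
Definition triples_linked k (E : seq (nat * nat)) :=
  all (fun x => all (fun y => all (fun z => uniq [:: x; y; z] ==>
    has (fun i => all (linked E i) [:: x; y; z]) (iota 0 k))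
  (iota 0 k)) (iota 0 k)) (iota 0 k).

(** In S_5 and S_7 the labels 4, 0, 1 stand for the vertex attached to a, b, c
    and for a, b, whose only common neighbour is c. *)
Lemma attach_K4_counts k (H : sgraph ('I_4 + 'I_k.+1)%type) E :
  (forall x y, H x y = linked E (attach_code x) (attach_code y)) ->
  triples_linked (4 + k.+1) E ->
  count (fun i => all (linked E i) [:: 4; 0; 1]) (iota 0 (4 + k.+1)) = 1 ->
  count (fun i => all (linked E i) [:: 0; 1; 2]) (iota 0 (4 + k.+1)) = 2 ->
  [/\ ~ common_counts H 3 0, common_counts H 3 1 & common_counts H 3 2].
Proof.
move=> HE ok c1 c2.
have cnt := coded_commons (@attach_code_inj k.+1) (@attach_code_lt k.+1)
  (@attach_code_card k.+1) HE.
split.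
- move=> /common_countsP[s [us s3]]; rewrite cnt.
  case: s us s3 => [|x [|y [|z []]]] // us _ /eqP.
  rewrite eqn0Ngt -has_count => /negP; apply.
  have := allP ok (attach_code x); rewrite mem_iota attach_code_lt => /(_ isT).
  move=> /allP/(_ (attach_code y)); rewrite mem_iota attach_code_lt => /(_ isT).
  move=> /allP/(_ (attach_code z)); rewrite mem_iota attach_code_lt => /(_ isT).
  rewrite (map_inj_uniq (@attach_code_inj k.+1) [:: x; y; z]) us.
  exact.
- apply/common_countsP; exists [:: inr ord0; inl K4a; inl K4b].
  by split=> //; rewrite cnt; exact: c1.
- apply/common_countsP; exists [:: inl K4a; inl K4b; inl K4c].
  by split=> //; rewrite cnt; exact: c2.
Qed.

(** One common neighbour: the two vertices of K_2 and an end of the path.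
    At least two: three vertices of the path. *)
Lemma T_counts m (H : sgraph 'I_m) : 3 <= m -> subrel H (path_graph m) ->
  (forall i, exists j, H i j) ->
  [/\ ~ common_counts (graph_join H (complete 2)) 3 0,
      common_counts (graph_join H (complete 2)) 3 1 &
      exists2 a, 2 <= a & common_counts (graph_join H (complete 2)) 3 a].
Proof.
set J := graph_join H (complete 2) => m3 sub nbr.
pose u0 : 'I_m + 'I_2 := inr ord0; pose u1 : 'I_m + 'I_2 := inr ord_max.
have u01 : u0 != u1 by [].
have is_u (j : 'I_2) : inr j = u0 \/ inr j = u1.
  by case: j => [[|[|j]] Hj] //; [left|right]; congr inr; apply: val_inj.
have J0 y : y != u0 -> J u0 y by case: y => [i|j] //=; rewrite /complete_rel eq_sym.
have J1 y : y != u1 -> J u1 y by case: y => [i|j] //=; rewrite /complete_rel eq_sym.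
have notin u s : (forall y, y != u -> J u y) -> u \notin s -> all (J u) s.
  by move=> Ju us; apply/allP => y ys; apply: Ju; apply: contraNneq us => <-.
split.
- move=> /common_countsP[s [us s3 /eqP]]; rewrite cards_eq0 => /eqP/setP s0.
  have none w : ~ all (J w) s by move=> ws; have := s0 w; rewrite !inE ws.
  have [us0|/(notin _ _ J0)/none//] := boolP (u0 \in s).
  have [us1|/(notin _ _ J1)/none//] := boolP (u1 \in s).
  have [x xs] : exists2 x, x \in s & x \notin [:: u0; u1].
    apply/hasP; apply: contraT => /hasPn sU.
    have := uniq_leq_size us (s2 := [:: u0; u1]); rewrite s3; apply.
    by move=> y /sU; rewrite negbK.
  rewrite !inE negb_or => /andP[x0 x1].
  have ux : uniq [:: u0; u1; x] by rewrite /= !inE negb_or u01 eq_sym x0 eq_sym x1.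
  have [||_ sE] := uniq_min_size ux (s2 := s); last 1 first.
  + case: x xs x0 x1 ux sE => [i|j] xs x0 x1 ux sE; last first.
      by case: (is_u j) x0 x1 => ->; rewrite eqxx.
    have [j ij] := nbr i; apply: (none (inl j)); apply/allP => y.
    by rewrite -sE !inE => /or3P[]/eqP-> //=; rewrite adj_sym.
  + by move=> y; rewrite !inE => /or3P[]/eqP->.
  + by rewrite s3.
- apply/common_countsP.
  have m0 : 0 < m by exact: leq_trans m3.
  pose i0 := Ordinal m0; exists [:: u0; u1; inl i0]; split=> //.
  have [j i0j] := nbr i0; rewrite (_ : commons _ _ = [set inl j]%SET) ?cards1//.
  have next i : H i0 i -> val i = 1.
    by move=> /sub; rewrite /= /path_rel /= => /orP[/eqP<-|].
  apply/setP => w; rewrite !inE /=; case: w => [i|i] /=.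
    apply/idP/eqP => [|[->]]; rewrite andbT.
      by rewrite adj_sym => /next ij; congr inl; apply: val_inj; rewrite ij (next j).
    by rewrite adj_sym.
  by case: (is_u i) => [[->]|[->]]; rewrite /complete_rel ?eqxx ?andbF.
- exists #|commons J [seq inl i | i <- take 3 (enum 'I_m)]|.
    apply: (@leq_trans #|[:: u0; u1]|).
      by have /card_uniqP -> : uniq [:: u0; u1] by [].
    apply/subset_leq_card/fintype.subsetP => w; rewrite !inE.
    by case/orP => /eqP->; apply/allP => y /mapP[i _ ->].
  apply/common_countsP; exists [seq inl i | i <- take 3 (enum 'I_m)]; split=> //.
    by rewrite map_inj_uniq ?take_uniq ?enum_uniq// => i j [].
  by rewrite size_map size_takel// size_enum_ord.
Qed.
End Models.

(** * Which counts occur in a planar graph *)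

Section Main.
Variables (R : realType) (V : finType) (G : sgraph V).
Implicit Types (n a m : nat).

Lemma count0_absent n : ~ common_counts G n 0 -> all_dominated G n.
Proof.
move=> n0 s us sn; apply/existsP; apply: contra_notT n0 => /existsPn none.
apply/common_countsP; exists s; split=> //.
by apply/eqP; rewrite cards_eq0; apply/eqP/setP => w; rewrite !inE (negPf (none w)).
Qed.

Lemma count1_absent n : ~ common_counts G n 1 -> all_second G n.
Proof.
move=> n1 v s us sn vs.
have : ~~ [forall w, (w \in commons G s) ==> (w == v)].
  apply: contra_notN n1 => /forallP only; apply/common_countsP; exists s; split=> //.
  rewrite (_ : commons G s = [set v]%SET) ?cards1//; apply/setP => w; rewrite inE.
  apply/idP/eqP => [ws|->]; last by rewrite inE.
  by have := only w; rewrite ws => /eqP.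
by case/forallPn => w; rewrite negb_imply inE => /andP[ws wv]; exists w.
Qed.

Lemma neighbours_seq n v : n <= degree G v ->
  exists s, [/\ uniq s, size s = n & all (G v) s].
Proof.
move=> nv; exists (take n (enum (neighbours G v))); split.
- by rewrite take_uniq// enum_uniq.
- by rewrite size_takel// -cardE.
- by apply/allP => x /mem_take; rewrite mem_enum inE.
Qed.

Lemma max_degree_vertex n : 0 < n -> n <= max_degree G -> exists v, n <= degree G v.
Proof.
move=> n0 nD; apply/existsP; apply: contraLR nD => /existsPn small.
rewrite -ltnNge -(prednK n0) ltnS; apply/bigmax_leqP => v _.
by rewrite -ltnS prednK// ltnNge.
Qed.

Lemma max_degree_card n : n <= max_degree G -> n <= #|V|.
Proof. by move/leq_trans; apply; apply/bigmax_leqP => v _; exact: max_card. Qed.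

Lemma count_contains n a : 1 < a -> common_counts G n a ->
  contains G (complete_bipartite 2 n).
Proof.
move=> a1 /common_countsP[s [us sn sa]]; rewrite -sa in a1.
have [x [y [xs ys xy]]] := card_gt1P a1.
rewrite !inE in xs ys.
pose f (u : 'I_2 + 'I_n) :=
  match u with inl i => if val i == 0 then x else y | inr j => nth x s j end.
have fG (i : 'I_2) (j : 'I_n) : G (f (inl i)) (f (inr j)).
  rewrite /=; have js : nth x s j \in s by rewrite mem_nth// sn.
  by case: ifP => _; [exact: (allP xs)|exact: (allP ys)].
exists f; last by move=> [i|i] [j|j] //= _; [exact: fG | rewrite adj_sym; exact: fG].
have neq (i : 'I_2) (j : 'I_n) : f (inl i) <> f (inr j).
  by move=> E; have := fG i j; rewrite E adj_irr.
move=> [i|i] [j|j].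
- case: i j => [[|[|i]] Hi] [[|[|j]] Hj] //= => [_|E|E|_].
  + by congr inl; apply: val_inj.
  + by rewrite E eqxx in xy.
  + by rewrite E eqxx in xy.
  + by congr inl; apply: val_inj.
- by move/neq.
- by move/esym/neq.
- by move=> /eqP; rewrite nth_uniq ?sn// => /eqP/val_inj->.
Qed.

Hypothesis Gplanar : planar R G.

Lemma count_le2 n a : 3 <= n -> common_counts G n a -> a <= 2.
Proof.
move=> n3 /common_countsP[s [us sn <-]]; rewrite leqNgt; apply/negP => c3.
apply: (no_K33 Gplanar (A := take 3 (enum (commons G s))) (B := take 3 s)).
- by rewrite take_uniq// enum_uniq.
- by rewrite take_uniq.
- by rewrite size_takel// -cardE.
- by rewrite size_takel// sn.
- by move=> w x /mem_take; rewrite mem_enum inE => /allP h /mem_take; exact: h.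
Qed.

Lemma count2 n s x y : 3 <= n -> uniq s -> size s = n ->
  all (G x) s -> all (G y) s -> x != y -> common_counts G n 2.
Proof.
move=> n3 us sn xs ys xy.
have cs : common_counts G n #|commons G s| by apply/common_countsP; exists s.
have <- // : #|commons G s| = 2.
apply/eqP; rewrite eqn_leq (count_le2 n3 cs)/=.
by apply/card_gt1P; exists x, y; rewrite !inE.
Qed.

Lemma contains_count2 n : 3 <= n -> contains G (complete_bipartite 2 n) ->
  common_counts G n 2.
Proof.
move=> n3 [f finj fG].
have com (i : 'I_2) : all (G (f (inl i))) [seq f (inr i) | i : 'I_n].
  by apply/allP => x /mapP[j _ ->]; apply: fG.
apply: (count2 n3 _ _ (com ord0) (com ord_max)).
- by rewrite map_inj_uniq ?enum_uniq// => i j /finj[].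
- by rewrite size_map size_enum_ord.
- by apply/eqP => /finj.
Qed.

Lemma twins_count2 n m : 3 <= n -> m <= n -> n <= max_degree G -> twins_from m G ->
  common_counts G n 2.
Proof.
move=> n3 mn nD tw.
have [v nv] := max_degree_vertex (ltn_trans (isT : 0 < 2) n3) nD.
have [w wv /setP wN] := tw v (leq_trans mn nv).
have [s [us sn vs]] := neighbours_seq nv.
apply: (count2 n3 us sn _ vs wv); apply/allP => x xs.
by have := wN x; rewrite !inE (allP vs).
Qed.

Lemma twins_count1 n m : m <= n -> twins_from m G -> ~ common_counts G n 1.
Proof.
move=> mn tw /common_countsP[s [us sn /eqP/cards1P[v sv]]].
have vs : v \in commons G s by rewrite sv inE.
have dv : n <= degree G v.
  rewrite -sn -(card_uniqP us); apply/subset_leq_card/fintype.subsetP => x xs.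
  by move: vs; rewrite !inE => /allP/(_ x xs).
have [w wv /setP wN] := tw v (leq_trans mn dv).
suff : w \in commons G s by rewrite sv inE (negPf wv).
rewrite inE; apply/allP => x xs; have := wN x; rewrite !inE => ->.
by move: vs; rewrite inE => /allP/(_ x xs).
Qed.

(** Otherwise there is a K_4, say a, b, c, d, and twins a' of a and c' of c
    give a K_{3,3} with sides a, a', b and c, c', d. *)
Lemma twins_count0 n m : 3 <= n -> m <= n -> n <= max_degree G -> twins_from m G ->
  common_counts G n 0.
Proof.
move=> n3 mn nD tw; apply: contrapT => /count0_absent dom.
have nV := max_degree_card nD.
have n4 : n <= 3 by apply: (dominated_small Gplanar _ dom); rewrite nV andbT ltnW// ltnW.
have nE : n = 3 by apply/eqP; rewrite eqn_leq n4.
subst n.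
have [//|t [ct t4]] := dominated_clique (s := [::]) (k := 4) nV dom isT.
case: t ct t4 => [|a [|b [|c [|d []]]]] //; rewrite /clique /= !andbT.
move=> /and3P[/and3P[ab ac ad] /andP[bc bd] cd] _.
have twin x y z u : G x y -> G x z -> G x u -> uniq [:: y; z; u] ->
    exists2 x', x' != x & forall p, G x' p = G x p.
  move=> xy xz xu uy; have [|x' xx' /setP xN] := tw x.
    apply: leq_trans mn _; rewrite -[3]/(size [:: y; z; u]) -(card_uniqP uy).
    by apply/subset_leq_card/fintype.subsetP => p; rewrite !inE => /or3P[]/eqP->.
  by exists x' => // p; have := xN p; rewrite !inE.
have ne x y : G x y -> x != y by apply: contraTneq => ->; rewrite adj_irr.
have [|a' aa' aN] := twin a b c d ab ac ad.
  by rewrite /= !inE negb_or !ne.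
have [ca cb] : G c a /\ G c b by rewrite adj_sym ac adj_sym.
have [|c' cc' cN] := twin c a b d ca cb cd.
  by rewrite /= !inE negb_or !ne.
have c'a : G a c' by rewrite adj_sym cN adj_sym.
have c'b : G b c' by rewrite adj_sym cN adj_sym.
apply: (no_K33 Gplanar (A := [:: a; a'; b]) (B := [:: c; c'; d])) => //.
- by rewrite /= !inE negb_or eq_sym aa' !ne// aN.
- by rewrite /= !inE negb_or eq_sym cc' !ne// cN.
move=> p q; rewrite !inE => /or3P[]/eqP-> /or3P[]/eqP->; rewrite ?aN//.
Qed.

Lemma twins_from_in_Q n : 3 <= n -> n <= max_degree G -> twins_from n G ->
  exists m, [/\ in_Q R m G, 3 <= m, m <= n & n <= max_degree G].
Proof.
move=> n3 nD tw; pose P m := (3 <= m) && `[< twins_from m G >].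
have exP : exists m, P m by exists n; rewrite /P n3; apply/asboolP.
have Pn : P n by rewrite /P n3; apply/asboolP.
case: (ex_minnP exP) => m /andP[m3 /asboolP mtw] min.
have mn := min _ Pn.
exists m; split=> //; split=> //; first exact: leq_trans nD.
by move=> k k3 ktw; apply: min; rewrite /P k3; apply/asboolP.
Qed.

Lemma exceptional_counts m : 3 <= m -> [\/ in_T m G, isomorphic G S5 | isomorphic G S7] ->
  [/\ ~ common_counts G 3 0, common_counts G 3 1 & common_counts G 3 2].
Proof.
have S5c := attach_K4_counts S5_code isT erefl erefl.
have S7c := attach_K4_counts S7_code isT erefl erefl.
move=> m3 [[_ [H [sub nbr iso]]]|iso|iso].
- have [c0 c1 [a a2 Ha]] := T_counts m3 sub nbr.
  have ca' := isomorphic_counts (isomorphic_sym iso) Ha.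
  split.
  + by move/(isomorphic_counts iso).
  + exact: isomorphic_counts (isomorphic_sym iso) c1.
  + by move: (ca'); have -> : a = 2 by apply/eqP; rewrite eqn_leq a2 (count_le2 _ ca').
- have [c0 c1 c2] := S5c; split; first by move/(isomorphic_counts iso).
    exact: isomorphic_counts (isomorphic_sym iso) c1.
  exact: isomorphic_counts (isomorphic_sym iso) c2.
- have [c0 c1 c2] := S7c; split; first by move/(isomorphic_counts iso).
    exact: isomorphic_counts (isomorphic_sym iso) c1.
  exact: isomorphic_counts (isomorphic_sym iso) c2.
Qed.

Lemma count0_unexceptional n : 3 <= n <= #|V| ->
  ~ (n = 3 /\ isomorphic G (complete 4)) ->
  ~ (n = 3 /\ exists2 m, n <= m & [\/ in_T m G, isomorphic G S5 | isomorphic G S7]) ->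
  common_counts G n 0.
Proof.
move=> /andP[n3 nV] not1 not2; apply: contrapT => /count0_absent dom.
have n4 : n <= 3 by apply: (dominated_small Gplanar _ dom); rewrite nV andbT ltnW// ltnW.
have nE : n = 3 by apply/eqP; rewrite eqn_leq n4.
subst n; have [K4|T] := dominated_classification Gplanar dom nV.
  exact: not1.
exact: not2.
Qed.

End Main.

Theorem theorem1p2 (R : realType) (V : finType) (G : sgraph V) (n : nat) :
  planar R G -> 3 <= n ->
  let A := common_counts G n in
  let case1 := n = 3 /\ isomorphic G (complete 4) in
  let case2 := n = 3 /\
    exists2 m, n <= m & [\/ in_T m G, isomorphic G S5 | isomorphic G S7] in
  let case3 := exists m, [/\ in_Q R m G, 3 <= m, m <= n & n <= max_degree G] in
  let none_of_1_2_3 := [/\ ~ case1, ~ case2 & ~ case3] in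
  let case4 := #|V| < n in
  let case5 := max_degree G < n in
  let case6 := contains G (complete_bipartite 2 n) in
  (case1 -> A = [set 1]%classic) /\
  (case2 -> A = [set 1; 2]%classic) /\
  (case3 -> A = [set 0; 2]%classic) /\
  (none_of_1_2_3 -> case4 -> A = set0) /\
  (none_of_1_2_3 -> ~ case4 -> case5 -> A = [set 0]%classic) /\
  (none_of_1_2_3 -> ~ case4 -> ~ case5 -> case6 ->
     A = [set 0; 1; 2]%classic) /\
  (none_of_1_2_3 -> ~ case4 -> ~ case5 -> ~ case6 ->
     A = [set 0; 1]%classic).
Proof.
move=> Gplanar n3 A case1 case2 case3 none case4 case5 case6.
have small a : A a -> [\/ a = 0, a = 1 | a = 2].
  move=> /(count_le2 Gplanar n3).
  by case: a => [|[|[|]]] // _; [apply: Or31|apply: Or32|apply: Or33].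
split=> [[nE iso]|].
  rewrite /A nE; apply/seteqP; split=> a /=.
    by move=> /(isomorphic_counts iso)/complete_counts ->.
  by move=> ->; apply: isomorphic_counts (isomorphic_sym iso) _; apply/complete_counts.
split=> [[nE [m nm c]]|].
  rewrite nE in nm; have [c0 c1 c2] := exceptional_counts Gplanar nm c.
  apply/seteqP; split=> a /=; last by rewrite /A nE => -[]->.
  move=> Aa; have [a0|->|->] := small _ Aa; [|by left|by right].
  by case: c0; rewrite -{2}a0 -nE.
split=> [[m [[_ _ _ tw _] m3 mn nD]]|].
  apply/seteqP; split=> a /=; last first.
    by case=> ->; [exact: (twins_count0 Gplanar n3 mn nD tw)
                  |exact: (twins_count2 Gplanar n3 mn nD tw)].
  move=> Aa; have [->|a1|->] := small _ Aa; [by left| |by right].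
  by case: (twins_count1 mn tw); rewrite -a1.
split=> [_ Vn|].
  apply/seteqP; split=> a //= /common_countsP[s [us sn _]].
  by move: Vn; rewrite /case4 -sn ltnNge -(card_uniqP us) max_card.
split=> [_ /negP nV Dn|].
  rewrite /case4 -leqNgt in nV.
  have cnt (s : seq V) : size s = n -> uniq s -> #|commons G s| = 0.
    move=> sn us; apply/eqP; rewrite cards_eq0; apply/eqP/setP => w; rewrite !inE.
    apply/negbTE/negP => /allP ws; move: Dn; rewrite /case5 ltnNge => /negP; apply.
    apply: leq_trans (leq_bigmax w); rewrite -sn -(card_uniqP us).
    by apply/subset_leq_card/fintype.subsetP => x xs; rewrite inE ws.
  apply/seteqP; split=> a /=.
    by move=> /common_countsP[s [us sn <-]]; exact: cnt.
  move=> ->; have [//||t [ut tn]] := @extend_uniq _ ([::] : seq V) n.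
    by rewrite nV.
  by apply/common_countsP; exists t; rewrite cnt.
have c0 : none -> ~ case4 -> A 0.
  move=> [n1 n2 _] /negP; rewrite /case4 -leqNgt => nV.
  by apply: (count0_unexceptional Gplanar) => //; rewrite n3.
split=> [no V_n /negP nD K2n|].
  rewrite /case5 -leqNgt in nD; have [_ _ notQ] := no.
  have c2 := contains_count2 Gplanar n3 K2n.
  (* Without 1, the graph would belong to some Q_m, which is the third case. *)
  have c1 : A 1.
    apply: contrapT => /count1_absent second.
    by apply/notQ/twins_from_in_Q => //; exact: (second_twins Gplanar).
  apply/seteqP; split=> a /=.
    by move=> /small[]->; [left; left|left; right|right].
  by case=> [[->|->]|->] //; exact: c0.
move=> no V_n /negP; rewrite /case5 -leqNgt => nD K2n.
have le1 a : A a -> a <= 1.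
  by move=> Aa; rewrite leqNgt; apply/negP => a1; apply: K2n; exact: count_contains Aa.
have [v nv] := max_degree_vertex (ltn_trans (isT : 0 < 2) n3) nD.
have [s [us sn vs]] := neighbours_seq nv.
have As : A #|commons G s| by apply/common_countsP; exists s.
have s1 : 0 < #|commons G s| by apply/card_gt0P; exists v; rewrite inE.
have c1 : A 1.
  by have <- // : #|commons G s| = 1 by apply/eqP; rewrite eqn_leq le1.
apply/seteqP; split=> a /=.
  by move=> Aa; have := le1 _ Aa; case: a Aa => [|[|]] // _ _; [left|right].
by case=> -> //; exact: c0.
Qed.
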